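(* Let $G$ be a topologically finitely generated topological group. Let $k\subset K$ be a weakly cartesian pair of Hausdorff topological fields of characteristic zero, and assume that $k$ is straight. Then there is a canonical isomorphism $$G\widehat{\otimes}K\cong (G\widehat{\otimes}k)_K$$ of pro-unipotent groups over $K$, where the right-hand side denotes base change from $k$ to $K$.
   Context: A topological group is topologically finitely generated if it contains a dense algebraically finitely generated subgroup. A topological field is a field with a topology for which addition, multiplication, additive inversion and multiplicative inversion are continuous; a topological vector space over it is a vector space with a topology making addition and scalar multiplication continuous. A Hausdorff topological field $k$ is straight if every linear functional with closed kernel on a Hausdorff topological $k$-vector space is continuous. A topological vector space $V$ over a Hausdorff topological field $k$ is weakly cartesian if every finite-dimensional subspace of $V$ is closed and is linearly homeomorphic to $k^r$ (product topology) for some $r$. If $k$ is a closed subfield of a Hausdorff topological field $K$, then $k\subset K$ is a weakly cartesian pair if $K$ is weakly cartesian as a topological vector space over $k$. For $F$ a Hausdorff topological field of characteristic zero: an affine algebraic group over $F$ is unipotent if it has a closed embedding into the group of upper-unitriangular $m\times m$ matrices for some $m$; an affine group scheme over $F$ is pro-unipotent if all its finite-dimensional quotient group schemes are unipotent (equivalently it is an inverse limit of unipotent groups). For $U$ unipotent, $U(F)$ has the topology transported from $\mathrm{Lie}(U)\cong F^r$ along the bijection $\exp:\mathrm{Lie}(U)\to U(F)$; for $U=\varprojlim_iU_i$ pro-unipotent, $U(F)=\varprojlim_iU_i(F)$ has the inverse limit topology. The continuous Mal'cev $F$-completion $G\widehat{\otimes}F$ is the pro-unipotent group over $F$ representing $U\mapsto\mathrm{Hom}_{\mathrm{cont}}(G,U(F))$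 on pro-unipotent groups over $F$. *)

(* Defs.v *)
From HB Require Import structures.
From mathcomp Require Import all_boot all_order all_algebra.
From mathcomp Require Import boolp classical_sets functions.
From mathcomp Require Import topology pseudometric_normed_Zmodule tvs.

Set Implicit Arguments.
Unset Strict Implicit.
Unset Printing Implicit Defensive.

Import GRing.Theory.

Local Open Scope classical_set_scope.
Local Open Scope ring_scope.

HB.mixin Record Topological_Group_isTopGroup G of Topological G & Group G := {
  mulg_continuous : continuous (fun x : G * G => (x.1 * x.2)%g) ;
  invg_continuous : continuous (fun x : G => (x^-1)%g) ;
}.

#[short(type="topGroupType")]
HB.structure Definition TopGroup :=
  {G of Topological G & Group G & Topological_Group_isTopGroup G}.

HB.mixin Record TopologicalZmodule_Field_isTopField F
    of TopologicalZmodule F & GRing.Field F := {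
  mulr_continuous : continuous (fun x : F * F => x.1 * x.2) ;
  invr_continuous : forall x : F, x != 0 -> {for x, continuous (@GRing.inv F)} ;
}.

#[short(type="topFieldType")]
HB.structure Definition TopField :=
  {F of TopologicalZmodule F & GRing.Field F
      & TopologicalZmodule_Field_isTopField F}.

(* A record separate from the hierarchy: the structures joining topology and
   module in the library are confined to ordered base fields. *)
Record topVectType (F : topFieldType) := TopVect {
  tv_top :> topologicalZmodType ;
  tv_scale : F -> tv_top -> tv_top ;
  tv_scaleA : forall a b v, tv_scale a (tv_scale b v) = tv_scale (a * b) v ;
  tv_scale1 : left_id 1 tv_scale ;
  tv_scaleDr : right_distributive tv_scale +%R ;
  tv_scaleDl : forall v, {morph tv_scale^~ v : a b / a + b} ;
  tv_scale_continuous : continuous (fun z : F * tv_top => tv_scale z.1 z.2)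
}.

Definition tv_module (F : topFieldType) (V : topVectType F) : Type := V.

HB.instance Definition _ (F : topFieldType) (V : topVectType F) :=
  GRing.Zmodule.copy (tv_module V) V.
HB.instance Definition _ (F : topFieldType) (V : topVectType F) :=
  GRing.Zmodule_isLmodule.Build F (tv_module V) (@tv_scaleA F V)
    (@tv_scale1 F V) (@tv_scaleDr F V) (@tv_scaleDl F V).

Definition generated_subgroup (G : groupType) (s : seq G) : set G :=
  [set x | forall H : {pred G}, group_closed H -> {subset s <= H} -> x \in H].

Definition topologically_fin_gen (G : topGroupType) : Prop :=
  exists s : seq G, dense (generated_subgroup s).

Definition top_embedding (S T : topologicalType) (f : S -> T) : Prop :=
  injective f /\
  forall A : set S, open A <-> exists2 B : set T, open B & A = f @^-1` B.

Definition straight (k : topFieldType) : Prop :=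
  hausdorff_space k /\
  forall V : topVectType k, hausdorff_space V ->
  forall f : {scalar tv_module V},
    closed (f @^-1` [set 0] : set V) -> continuous (f : V -> k).

Definition fin_dim_subspace (F : fieldType) (V : lmodType F) (W : set V) :
    Prop :=
  exists n (u : 'I_n -> V), W = range (fun c : 'rV[F]_n => \sum_i c 0 i *: u i).

(* The library topology on ['rV[k]_r] is the product topology. *)
Definition weakly_cartesian (k : topFieldType) (V : topVectType k) : Prop :=
  forall W : set V, fin_dim_subspace (W : set (tv_module V)) ->
    closed W /\
    exists r (b : {linear 'rV[k]_r -> tv_module V}),
      range b = W /\ top_embedding (b : 'rV[k]_r -> V).

Record closed_subfield (k K : topFieldType) := ClosedSubfield {
  subfield_incl :> {rmorphism k -> K} ;
  subfield_emb : top_embedding subfield_incl ;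
  subfield_closed : closed (range subfield_incl)
}.

Section SubfieldVect.
Variables (k K : topFieldType) (i : closed_subfield k K).

Definition subfield_scale (a : k) (x : K) : K := i a * x.

Fact subfield_scaleA a b x :
  subfield_scale a (subfield_scale b x) = subfield_scale (a * b) x.
Proof. by rewrite /subfield_scale mulrA rmorphM. Qed.

Fact subfield_scale1 : left_id 1 subfield_scale.
Proof. by move=> x; rewrite /subfield_scale rmorph1 mul1r. Qed.

Fact subfield_scaleDr : right_distributive subfield_scale +%R.
Proof. by move=> a x y; rewrite /subfield_scale mulrDr. Qed.

Fact subfield_scaleDl x : {morph subfield_scale^~ x : a b / a + b}.
Proof. by move=> a b; rewrite /subfield_scale rmorphD mulrDl. Qed.

Fact subfield_continuous : continuous i.
Proof. by apply/continuousP => B oB; apply/(subfield_emb i).2; exists B. Qed.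

Fact subfield_scale_continuous :
  continuous (fun z : k * K => subfield_scale z.1 z.2).
Proof.
move=> z.
apply: (@continuous_comp _ _ _ (fun z : k * K => (i z.1, z.2))
   (fun z : K * K => z.1 * z.2)); last exact: mulr_continuous.
apply: cvg_pair => /=; last exact: cvg_snd.
by apply: continuous_comp; [exact: cvg_fst | exact: subfield_continuous].
Qed.

Definition subfield_vect : topVectType k :=
  @TopVect k K subfield_scale subfield_scaleA subfield_scale1 subfield_scaleDr
    subfield_scaleDl subfield_scale_continuous.

End SubfieldVect.

Definition weakly_cartesian_pair (k K : topFieldType)
    (i : closed_subfield k K) : Prop :=
  weakly_cartesian (subfield_vect i).

Definition restr (k K : fieldType) (i : {rmorphism k -> K}) (R : Type) : Type :=
  R.

Section Restr.
Variables (k K : fieldType) (i : {rmorphism k -> K}).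

Section Alg.
Variable R : comAlgType K.

HB.instance Definition _ := GRing.ComNzRing.copy (restr i R) R.

Definition restr_scale (a : k) (x : restr i R) : restr i R := i a *: (x : R).

Fact restr_scaleA a b x :
  restr_scale a (restr_scale b x) = restr_scale (a * b) x.
Proof. by rewrite /restr_scale scalerA rmorphM. Qed.

Fact restr_scale1 : left_id 1 restr_scale.
Proof. by move=> x; rewrite /restr_scale rmorph1 scale1r. Qed.

Fact restr_scaleDr : right_distributive restr_scale +%R.
Proof. by move=> a x y; rewrite /restr_scale scalerDr. Qed.

Fact restr_scaleDl x : {morph restr_scale^~ x : a b / a + b}.
Proof. by move=> a b; rewrite /restr_scale rmorphD scalerDl. Qed.

HB.instance Definition _ := GRing.Zmodule_isLmodule.Build k (restr i R)
  restr_scaleA restr_scale1 restr_scaleDr restr_scaleDl.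

Fact restr_scaleAl a (x y : restr i R) : a *: (x * y) = (a *: x) * y.
Proof. exact: scalerAl. Qed.

HB.instance Definition _ :=
  GRing.Lmodule_isLalgebra.Build k (restr i R) restr_scaleAl.
HB.instance Definition _ := GRing.Lalgebra_isComAlgebra.Build k (restr i R).

End Alg.

Definition restr_mor (R S : comAlgType K) (f : {lrmorphism R -> S}) :
  restr i R -> restr i S := f.

Section Mor.
Variables (R S : comAlgType K) (f : {lrmorphism R -> S}).

Fact restr_mor_additive : zmod_morphism (restr_mor f).
Proof. exact: (rmorphB f). Qed.
Fact restr_mor_multiplicative : monoid_morphism (restr_mor f).
Proof. by split; [exact: (rmorph1 f) | exact: (rmorphM f)]. Qed.
Fact restr_mor_scalable : scalable (restr_mor f).
Proof. by move=> a x; exact: (linearZZ f). Qed.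

HB.instance Definition _ := GRing.isZmodMorphism.Build
  (restr i R) (restr i S) (restr_mor f) restr_mor_additive.
HB.instance Definition _ := GRing.isMonoidMorphism.Build
  (restr i R) (restr i S) (restr_mor f) restr_mor_multiplicative.
HB.instance Definition _ := GRing.isScalable.Build
  k (restr i R) (restr i S) *:%R (restr_mor f) restr_mor_scalable.

End Mor.

Definition restr_unit : k^o -> restr i K^o := i.

Fact restr_unit_additive : zmod_morphism restr_unit.
Proof. exact: (rmorphB i). Qed.
Fact restr_unit_multiplicative : monoid_morphism restr_unit.
Proof. by split; [exact: (rmorph1 i) | exact: (rmorphM i)]. Qed.
Fact restr_unit_scalable : scalable restr_unit.
Proof. by move=> a x; exact: (rmorphM i). Qed.

HB.instance Definition _ := GRing.isZmodMorphism.Build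
  k^o (restr i K^o) restr_unit restr_unit_additive.
HB.instance Definition _ := GRing.isMonoidMorphism.Build
  k^o (restr i K^o) restr_unit restr_unit_multiplicative.
HB.instance Definition _ := GRing.isScalable.Build
  k k^o (restr i K^o) *:%R restr_unit restr_unit_scalable.

End Restr.
Arguments restr_mor {k K} i {R S} f _.
Arguments restr_unit {k K} i _.

Definition restr_hom (k K : fieldType) (i : {rmorphism k -> K})
    (R S : comAlgType K) (f : {lrmorphism R -> S}) :
  {lrmorphism restr i R -> restr i S} := restr_mor i f.
Arguments restr_hom {k K} i {R S} f.

Definition restr_unit_hom (k K : fieldType) (i : {rmorphism k -> K}) :
  {lrmorphism k^o -> restr i K^o} := restr_unit i.

Section Dual.
Variable F : fieldType.

Record dual := Dual { dual_re : F^o ; dual_eps : F^o }.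

Definition dual_pair (x : dual) : F^o * F^o := (dual_re x, dual_eps x).
Definition pair_dual (p : F^o * F^o) : dual := Dual p.1 p.2.

Fact dual_pairK : cancel dual_pair pair_dual. Proof. by case. Qed.

HB.instance Definition _ := Choice.copy dual (can_type dual_pairK).

Lemma dual_ext x y :
  dual_re x = dual_re y -> dual_eps x = dual_eps y -> x = y.
Proof. by case: x y => [a b] [c d] /= -> ->. Qed.

Definition dual_zero : dual := Dual 0 0.
Definition dual_opp (x : dual) : dual := Dual (- dual_re x) (- dual_eps x).
Definition dual_add (x y : dual) : dual :=
  Dual (dual_re x + dual_re y) (dual_eps x + dual_eps y).

Fact dual_addA : associative dual_add.
Proof. by move=> x y z; apply: dual_ext; exact: addrA. Qed.
Fact dual_addC : commutative dual_add.
Proof. by move=> x y; apply: dual_ext; exact: addrC. Qed.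
Fact dual_add0 : left_id dual_zero dual_add.
Proof. by move=> x; apply: dual_ext; exact: add0r. Qed.
Fact dual_addN : left_inverse dual_zero dual_opp dual_add.
Proof. by move=> x; apply: dual_ext; exact: addNr. Qed.

HB.instance Definition _ :=
  GRing.isZmodule.Build dual dual_addA dual_addC dual_add0 dual_addN.

Definition dual_one : dual := Dual 1 0.
Definition dual_mul (x y : dual) : dual :=
  Dual (dual_re x * dual_re y)
    (dual_re x * dual_eps y + dual_eps x * dual_re y).

Fact dual_mulA : associative dual_mul.
Proof.
move=> x y z; apply: dual_ext => /=; first exact: mulrA.
by rewrite mulrDr mulrDl !mulrA addrA.
Qed.
Fact dual_mulC : commutative dual_mul.
Proof.
move=> x y; apply: dual_ext => /=; first exact: mulrC.
by rewrite addrC; congr (_ + _); exact: mulrC.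
Qed.
Fact dual_mul1 : left_id dual_one dual_mul.
Proof.
by move=> x; apply: dual_ext => /=; rewrite ?mul1r ?mul0r ?addr0.
Qed.
Fact dual_mulDl : left_distributive dual_mul +%R.
Proof.
move=> x y z; apply: dual_ext => /=; first exact: mulrDl.
by rewrite !mulrDl addrACA.
Qed.
Fact dual_one_neq0 : dual_one != 0.
Proof. by apply/eqP => -[] /eqP; rewrite oner_eq0. Qed.

HB.instance Definition _ := GRing.Zmodule_isComNzRing.Build dual
  dual_mulA dual_mulC dual_mul1 dual_mulDl dual_one_neq0.

Definition dual_scale (a : F) (x : dual) : dual :=
  Dual (a * dual_re x) (a * dual_eps x).

Fact dual_scaleA a b x : dual_scale a (dual_scale b x) = dual_scale (a * b) x.
Proof. by apply: dual_ext; exact: mulrA. Qed.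
Fact dual_scale1 : left_id 1 dual_scale.
Proof. by move=> x; apply: dual_ext; exact: mul1r. Qed.
Fact dual_scaleDr : right_distributive dual_scale +%R.
Proof. by move=> a x y; apply: dual_ext; exact: mulrDr. Qed.
Fact dual_scaleDl x : {morph dual_scale^~ x : a b / a + b}.
Proof. by move=> a b; apply: dual_ext; exact: mulrDl. Qed.

HB.instance Definition _ := GRing.Zmodule_isLmodule.Build F dual
  dual_scaleA dual_scale1 dual_scaleDr dual_scaleDl.

Fact dual_scaleAl (a : F) (x y : dual) : a *: (x * y) = (a *: x) * y.
Proof.
apply: dual_ext => /=; first exact: mulrA.
by rewrite mulrDr !mulrA.
Qed.

HB.instance Definition _ := GRing.Lmodule_isLalgebra.Build F dual dual_scaleAl.
HB.instance Definition _ := GRing.Lalgebra_isComAlgebra.Build F dual.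

Fact dual_re_additive : zmod_morphism dual_re. Proof. by []. Qed.
Fact dual_re_multiplicative : monoid_morphism dual_re. Proof. by split. Qed.
Fact dual_re_scalable : scalable dual_re. Proof. by []. Qed.

HB.instance Definition _ :=
  GRing.isZmodMorphism.Build dual F^o dual_re dual_re_additive.
HB.instance Definition _ :=
  GRing.isMonoidMorphism.Build dual F^o dual_re dual_re_multiplicative.
HB.instance Definition _ :=
  GRing.isScalable.Build F dual F^o *:%R dual_re dual_re_scalable.

(* The endomorphism [eps |-> a * eps]. *)
Definition dual_homothety (a : F) (x : dual) : dual :=
  Dual (dual_re x) (a * dual_eps x).

Section Homothety.
Variable a : F.

Fact dual_homothety_additive : zmod_morphism (dual_homothety a).
Proof. by move=> x y; apply: dual_ext => //=; exact: mulrBr. Qed.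
Fact dual_homothety_multiplicative : monoid_morphism (dual_homothety a).
Proof.
split; first by apply: dual_ext => //=; exact: mulr0.
move=> x y; apply: dual_ext => //=.
rewrite mulrDr; congr (_ + _); [exact: mulrCA | exact: mulrA].
Qed.
Fact dual_homothety_scalable : scalable (dual_homothety a).
Proof. by move=> b x; apply: dual_ext => //=; exact: mulrCA. Qed.

HB.instance Definition _ := GRing.isZmodMorphism.Build dual dual
  (dual_homothety a) dual_homothety_additive.
HB.instance Definition _ := GRing.isMonoidMorphism.Build dual dual
  (dual_homothety a) dual_homothety_multiplicative.
HB.instance Definition _ := GRing.isScalable.Build F dual dual *:%R
  (dual_homothety a) dual_homothety_scalable.
End Homothety.

End Dual.

(* [comAlgType F] consists of the nonzero commutative algebras.  Nothing is
   lost: an affine group scheme has a rational point, so that its coordinate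
   ring is nonzero, and it has exactly one point over the zero ring. *)
Record group_functor (F : fieldType) := GroupFunctor {
  points :> comAlgType F -> groupType ;
  pmap : forall R S : comAlgType F, {lrmorphism R -> S} ->
    {multiplicative points R -> points S} ;
  pmap_id : forall (R : comAlgType F) (g : points R),
    pmap (idfun : {lrmorphism R -> R}) g = g ;
  pmap_comp : forall (R S T : comAlgType F)
    (f : {lrmorphism R -> S}) (h : {lrmorphism S -> T}) (g : points R),
    pmap (h \o f : {lrmorphism R -> T}) g = pmap h (pmap f g)
}.
Arguments pmap {F} g {R S} _ : rename.

Section GroupSchemes.
Variable F : fieldType.
Implicit Types G H U Q : group_functor F.

Record group_hom G H := GroupHom {
  hom_on :> forall R : comAlgType F, {multiplicative G R -> H R} ;
  hom_natural : forall (R S : comAlgType F) (f : {lrmorphism R -> S}) (g : G R),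
    hom_on S (pmap G f g) = pmap H f (hom_on R g)
}.

Definition is_group_iso G H (f : group_hom G H) : Prop :=
  forall R : comAlgType F, bijective (f R).

(* [G] is [Spec A], with universal point [x]. *)
Definition represents G (A : comAlgType F) (x : G A) : Prop :=
  forall (R : comAlgType F) (g : G R),
    exists2 phi : {lrmorphism A -> R}, pmap G phi x = g
      & forall psi : {lrmorphism A -> R}, pmap G psi x = g -> psi =1 phi.

Definition affine G : Prop := exists (A : comAlgType F) (x : G A), represents x.

Definition fin_gen_algebra (A : comAlgType F) : Prop :=
  exists s : seq A, forall S : {pred A},
    GRing.subalg_closed S -> {subset s <= S} -> forall a, a \in S.

Definition algebraic G : Prop :=
  exists (A : comAlgType F) (x : G A), represents x /\ fin_gen_algebra A.

(* [phi : O(H) -> O(G)] is the map of coordinate rings dual to [f : G -> H],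
   for the identifications of [G] and [H] with spectra given by [x] and [y]. *)
Definition comorphism G H (f : group_hom G H) (A B : comAlgType F)
    (x : G A) (y : H B) (phi : {lrmorphism B -> A}) : Prop :=
  [/\ represents x, represents y & pmap H phi y = f A x].

Definition closed_embedding G H (f : group_hom G H) : Prop :=
  exists (A B : comAlgType F) (x : G A) (y : H B) (phi : {lrmorphism B -> A}),
    comorphism f x y phi /\ forall a, exists b, phi b = a.

(* Over a field, [O(H) -> O(G)] is faithfully flat as soon as it is injective. *)
Definition quotient_map G H (f : group_hom G H) : Prop :=
  exists (A B : comAlgType F) (x : G A) (y : H B) (phi : {lrmorphism B -> A}),
    comorphism f x y phi /\ injective phi.

End GroupSchemes.

Section Unitriangular.
Variable m : nat.

Definition unitriangular (R : comNzRingType) : {pred 'M[R]_m} :=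
  [pred M : 'M[R]_m |
    [forall i : 'I_m, forall j : 'I_m, (j <= i)%N ==> (M i j == (i == j)%:R)]].

Section Ring.
Variable R : comNzRingType.
Implicit Types M N : 'M[R]_m.

Lemma unitriangularP M :
  reflect (forall i j : 'I_m, (j <= i)%N -> M i j = (i == j)%:R)
    (M \in @unitriangular R).
Proof.
apply: (iffP forallP) => [H i j ji | H i].
  by move/forallP: (H i) => /(_ j) /implyP /(_ ji) /eqP.
by apply/forallP => j; apply/implyP => ji; apply/eqP/H.
Qed.

Definition ut_of : Type := {M : 'M[R]_m | M \in @unitriangular R}.

HB.instance Definition _ := Choice.on ut_of.

Lemma unitriangular1 : (1 : 'M[R]_m) \in @unitriangular R.
Proof. by apply/unitriangularP => i j _; rewrite mxE. Qed.

Lemma unitriangularM M N : M \in @unitriangular R -> N \in @unitriangular R ->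
  M * N \in @unitriangular R.
Proof.
move=> /unitriangularP HM /unitriangularP HN.
apply/unitriangularP => i j ji; rewrite mxE (bigD1 i) //= big1 => [|l li].
  by rewrite addr0 HM // HN // eqxx mul1r.
case: (leqP l i) => [le_li | lt_il].
  by rewrite HM // eq_sym (negbTE li) mul0r.
rewrite HN; last exact: leq_trans ji (ltnW lt_il).
case: eqP => [e | _]; last by rewrite mulr0.
by move: lt_il; rewrite e ltnNge ji.
Qed.

Definition ut_inv_mx M : 'M[R]_m := \sum_(k < m) (1 - M) ^+ k.

Lemma strict_upper_expr M k (i j : 'I_m) : M \in @unitriangular R ->
  (j < i + k)%N -> ((1 - M) ^+ k) i j = 0.
Proof.
move=> /unitriangularP HM; elim: k i j => [|k IH] i j.
  rewrite addn0 expr0 mxE => ji; case: eqP => // e.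
  by move: ji; rewrite e ltnn.
move=> jik; rewrite exprS mxE big1 // => l _.
case: (leqP l i) => [li | il].
  by rewrite !mxE HM // subrr mul0r.
by rewrite IH ?mulr0 // (leq_trans jik) // addnS -addSn leq_add2r.
Qed.

Lemma strict_upper_nilp M : M \in @unitriangular R -> (1 - M) ^+ m = 0.
Proof.
move=> HM; apply/matrixP => i j; rewrite strict_upper_expr ?mxE //.
by rewrite (leq_trans (ltn_ord j)) // leq_addl.
Qed.

Lemma ut_mulmV M : M \in @unitriangular R -> M * ut_inv_mx M = 1.
Proof.
move=> HM; have := subrX1 (1 - M) m; rewrite strict_upper_nilp // sub0r.
rewrite addrAC subrr add0r mulNr => /oppr_inj <-; reflexivity.
Qed.

Lemma ut_mulVm M : M \in @unitriangular R -> ut_inv_mx M * M = 1.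
Proof.
move=> HM; rewrite -[RHS](ut_mulmV HM) /ut_inv_mx mulr_suml mulr_sumr.
apply: eq_bigr => k _; apply: commr_sym; apply: commrX.
by apply: commrB; [exact: commr1 | exact: commr_refl].
Qed.

Lemma unitriangularV M :
  M \in @unitriangular R -> ut_inv_mx M \in @unitriangular R.
Proof.
move=> HM; apply/unitriangularP => i j ji; rewrite /ut_inv_mx summxE.
have m_gt0 : (0 < m)%N by apply: leq_ltn_trans (ltn_ord i).
rewrite (bigD1 (Ordinal m_gt0)) //= expr0 mxE big1 ?addr0 // => k k_neq0.
rewrite strict_upper_expr // (leq_ltn_trans ji) // -addn1 leq_add2l lt0n.
by apply: contra k_neq0 => /eqP k0; apply/eqP/val_inj.
Qed.

Definition ut_mul (M N : ut_of) : ut_of :=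
  exist _ (val M * val N) (unitriangularM (valP M) (valP N)).
Definition ut_one : ut_of := exist _ 1 unitriangular1.
Definition ut_inv (M : ut_of) : ut_of :=
  exist _ (ut_inv_mx (val M)) (unitriangularV (valP M)).

Fact ut_mulA : associative ut_mul.
Proof. by move=> M N P; apply: val_inj; exact: mulrA. Qed.
Fact ut_mul1g : left_id ut_one ut_mul.
Proof. by move=> M; apply: val_inj; exact: mul1r. Qed.
Fact ut_mulg1 : right_id ut_one ut_mul.
Proof. by move=> M; apply: val_inj; exact: mulr1. Qed.
Fact ut_mulVg : left_inverse ut_one ut_inv ut_mul.
Proof. by move=> M; apply: val_inj; exact: ut_mulVm (valP M). Qed.
Fact ut_mulgV : right_inverse ut_one ut_inv ut_mul.
Proof. by move=> M; apply: val_inj; exact: ut_mulmV (valP M). Qed.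

HB.instance Definition _ :=
  isGroup.Build ut_of ut_mulA ut_mul1g ut_mulg1 ut_mulVg ut_mulgV.

End Ring.

Section Map.
Variables (R S : comNzRingType) (f : {rmorphism R -> S}).

Lemma unitriangular_map (M : 'M[R]_m) : M \in @unitriangular R ->
  map_mx f M \in @unitriangular S.
Proof.
move=> /unitriangularP HM; apply/unitriangularP => i j ji.
by rewrite mxE HM // rmorph_nat.
Qed.

Definition ut_map (M : ut_of R) : ut_of S :=
  exist _ (map_mx f (val M)) (unitriangular_map (valP M)).

Fact ut_map_is_multiplicative : {morph ut_map : M N / (M * N)%g}.
Proof. by move=> M N; apply: val_inj; exact: map_mxM. Qed.

HB.instance Definition _ :=
  isMultiplicative.Build (ut_of R) (ut_of S) ut_map ut_map_is_multiplicative.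

End Map.

Variable F : fieldType.

Fact ut_map_id (R : comAlgType F) (M : ut_of R) :
  ut_map (idfun : {lrmorphism R -> R}) M = M.
Proof. by apply: val_inj; exact: map_mx_id. Qed.

Fact ut_map_comp (R S T : comAlgType F)
    (f : {lrmorphism R -> S}) (h : {lrmorphism S -> T}) (M : ut_of R) :
  ut_map (h \o f : {lrmorphism R -> T}) M = ut_map h (ut_map f M).
Proof. by apply: val_inj; exact: map_mx_comp. Qed.

Definition UT : group_functor F :=
  @GroupFunctor F (fun R => ut_of R) (fun R S f => ut_map f)
    ut_map_id ut_map_comp.

End Unitriangular.

Section Unipotent.
Variable F : fieldType.
Implicit Types U Q : group_functor F.

Definition unipotent U : Prop :=
  algebraic U /\ exists m (f : group_hom U (UT m F)), closed_embedding f.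

(* The finite-dimensional quotient group schemes are the algebraic ones. *)
Definition pro_unipotent U : Prop :=
  affine U /\
  forall Q (p : group_hom U Q), algebraic Q -> quotient_map p -> unipotent Q.

Definition Lie U : set (U (dual F)) :=
  [set X | pmap U (@dual_re F) X = 1%g].

(* A linear isomorphism [F^r ~ Lie U]: the sum of [Lie U] is the group law of
   [U (dual F)], and [a] acts through [eps |-> a * eps]. *)
Definition lie_coordinates U (r : nat) (b : 'rV[F]_r -> U (dual F)) : Prop :=
  [/\ forall v w, b (v + w) = (b v * b w)%g,
      forall a v, b (a *: v) = pmap U (dual_homothety a) (b v)
    & set_bij setT (@Lie U) b].

(* [rho X = 1 + eps * lie_mx rho X] *)
Definition lie_mx U m (rho : group_hom U (UT m F)) (X : U (dual F)) : 'M[F]_m :=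
  map_mx (@dual_eps F) (val (rho (dual F) X)).

(* [g = exp X] if [rho g] is the exponential of the matrix [lie_mx rho X], whose
   [m]-th power is zero, for every unitriangular representation [rho]. *)
Definition is_exp U (X : U (dual F)) (g : U F^o) : Prop :=
  forall m (rho : group_hom U (UT m F)),
    val (rho F^o g) = \sum_(n < m) (n`!%:R)^-1 *: lie_mx rho X ^+ n.

End Unipotent.

Section RationalPoints.
Variable F : topFieldType.
Implicit Types U Q : group_functor F.

(* The topology of [U(F)], [U] unipotent, transported from [Lie U ~ F^r]. *)
Definition unipotent_open U (W : set (U F^o)) : Prop :=
  exists r (b : 'rV[F]_r -> U (dual F)), lie_coordinates b /\
    open [set v | exists2 g, W g & is_exp (b v) g].

(* The inverse limit topology on [U(F)], [U] pro-unipotent, with respect to the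
   system of all finite-dimensional quotients of [U]. *)
Definition rat_points U : Type := U F^o.

HB.instance Definition _ U := Group.on (rat_points U).

Definition rat_points_subbase U : set (set (rat_points U)) :=
  [set V | exists Q (p : group_hom U Q) (W : set (Q F^o)),
     [/\ algebraic Q, quotient_map p, unipotent_open W & V = p F^o @^-1` W]].

HB.instance Definition _ U :=
  isSubBaseTopological.Build (rat_points U) (@rat_points_subbase U) id.

End RationalPoints.

(* [(M, eta)] represents [U |-> Hom_cont(G, U(F))] on pro-unipotent groups. *)
Definition is_malcev_completion (G : topGroupType) (F : topFieldType)
    (M : group_functor F) (eta : {multiplicative G -> rat_points M}) : Prop :=
  [/\ pro_unipotent M, continuous eta &
      forall (U : group_functor F) (f : {multiplicative G -> rat_points U}),
        pro_unipotent U -> continuous f ->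
        exists2 phi : group_hom M U, (forall x, phi F^o (eta x) = f x)
          & forall psi : group_hom M U, (forall x, psi F^o (eta x) = f x) ->
            forall R : comAlgType F, psi R =1 phi R].

Lemma lrmorphism_eq (F : fieldType) (R S : comAlgType F)
    (f g : {lrmorphism R -> S}) : f =1 g -> f = g.
Proof.
case: f => f cf; case: g => g cg /= /funext fg; subst g.
congr GRing.LRMorphism.Pack.
case: cf => [[a] [b] [c]]; case: cg => [[a'] [b'] [c']].
by rewrite (Prop_irrelevance a a') (Prop_irrelevance b b')
  (Prop_irrelevance c c').
Qed.

Section BaseChange.
Variables (k K : fieldType) (i : {rmorphism k -> K}) (G : group_functor k).

Fact base_change_id (R : comAlgType K) (g : G (restr i R)) :
  pmap G (restr_hom i (idfun : {lrmorphism R -> R})) g = g.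
Proof.
by rewrite -[RHS](pmap_id g); congr (pmap G _ g); exact: lrmorphism_eq.
Qed.

Fact base_change_comp (R S T : comAlgType K)
    (f : {lrmorphism R -> S}) (h : {lrmorphism S -> T}) (g : G (restr i R)) :
  pmap G (restr_hom i (h \o f : {lrmorphism R -> T})) g =
  pmap G (restr_hom i h) (pmap G (restr_hom i f) g).
Proof. by rewrite -pmap_comp; congr (pmap G _ g); exact: lrmorphism_eq. Qed.

(* [G_K(R) = G(R)] for a [K]-algebra [R]. *)
Definition base_change : group_functor K :=
  @GroupFunctor K (fun R => G (restr i R)) (fun R S f => pmap G (restr_hom i f))
    base_change_id base_change_comp.

(* [G(k) -> G(K) = G_K(K)] *)
Definition base_change_point (g : G k^o) : base_change K^o :=
  pmap G (restr_unit_hom i) g.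

End BaseChange.

(* Main.v *)
(* An affine group [U = Spec A] is pro-unipotent exactly when [A] is generated
   by the entries of unitriangular representations of [U], and then every
   element of [A] is a matrix coefficient [xi rho w] of a single such [rho]; the
   topology of [U(F)] is that of the entries of [rho].
   Write [O(Gk)] and [O(GK)] for the coordinate rings of the two completions.
   The canonical map [O(Gk) (x) K -> O(GK)] is bijective for the following
   reason.  Let [f : G -> UT_m(K)] be continuous and [w] in [K^m], and let [D] be
   a dense finitely generated subgroup of [G].  Since a product of [m]
   matrices [f(g) - 1] vanishes, the [k]-span of [f(D) w] is finite dimensional.  As [K] is
   weakly cartesian over [k], this span is closed in [K^m] and has continuous
   coordinates, so it is [G]-stable, and [G] acts on it through a continuous
   [lam : G -> UT_N(k)] which a matrix [T] over [K] intertwines with [f].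
   - If [f] comes from [rho : GK -> UT_m], then [lam] extends to [Gk], and [T]
     intertwines [rho] with that extension: every coefficient of [rho] is a
     [K]-combination of coefficients of [Gk].  This gives surjectivity.
   - If [K = k], the same argument shows that an element of [O(Gk)] vanishing on
     [G] is zero.  An element [sum_j e_j (x) a_j] of the kernel, with [e_j]
     independent over [k], has all [a_j] vanishing on [G].  This gives
     injectivity. *)

Require Import Defs.
From HB Require Import structures.
From mathcomp.multinomials Require Import -(notations) mpoly.
From mathcomp Require Import all_boot all_order all_algebra.
From mathcomp Require Import boolp classical_sets functions.
From mathcomp Require Import topology pseudometric_normed_Zmodule tvs.
From mathcomp Require Import finmap ring.

Set Implicit Arguments.
Unset Strict Implicit.
Unset Printing Implicit Defensive.

Import GRing.Theory.

Local Open Scope classical_set_scope.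
Local Open Scope ring_scope.

(** The definitions speak of all algebraic quotients of a group, the argument of matrices over its
    coordinate ring; much of the work is to pass between them. From quotients to matrices: a
    function on U is a coefficient of a finite-dimensional representation, so it lives on the image
    of U in GL_n, an algebraic quotient and therefore unipotent. From matrices to quotients:
    functions generated by unitriangular entries are killed by iterated differences, so long
    products of matrices r(g) - 1 vanish for every representation r; taking g universal turns this
    into the vanishing of products of constant matrices, which an Engel argument triangularizes over
    F. The topology is defined through exp on Lie algebras, while continuity is needed for matrix
    entries; log and exp are polynomial in the entries and translate one into the other. The
    universal property concerns homomorphisms only, but intertwining relations have to be extended
    from G to the completion. Such a relation is recast as the equality of two homomorphisms to a
    larger unitriangular group, where uniqueness applies. *)

Local Notation pmap := Defs.pmap.

(** * Linear functionals *)

Section Functionals.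
Variables (k : fieldType) (V : lmodType k).

Definition lin_closed (P : V -> Prop) : Prop :=
  P 0 /\ forall a u v, P u -> P v -> P (a *: u + v).

Lemma lin_closedZ P a u : lin_closed P -> P u -> P (a *: u).
Proof. by move=> [P0 PD] Pu; rewrite -[_ *: _]addr0; apply: PD. Qed.

Lemma lin_closedB P u v : lin_closed P -> P u -> P v -> P (u - v).
Proof.
by move=> [P0 PD] Pu Pv; rewrite addrC -scaleN1r; apply: PD.
Qed.

Lemma lin_closed_sum P (I : Type) (r : seq I) (Q : pred I) (F : I -> V) :
  lin_closed P -> (forall i, Q i -> P (F i)) -> P (\sum_(i <- r | Q i) F i).
Proof.
move=> [P0 PD] PF; elim/big_ind: _ => // u v Pu Pv.
by rewrite -[u]scale1r; apply: PD.
Qed.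

(* A subspace maximal among those avoiding [a] is a complement of the line of
   [a]; the coordinate along that line is the functional. *)
Lemma functional_exists (a : V) : a != 0 -> exists f : {scalar V}, f a = 1.
Proof.
move=> a0.
(* [Zorn_bigcup] also tests the empty chain, whose union is empty and hence no subspace; this forces
   the second alternative. *)
pose P (H : set V) := lin_closed H /\ ~ H a \/ H = set0.
have [|H [PH Hmax]] := @Zorn_bigcup V P.
  move=> F FP totF.
  have [[X0 FX0 [x X0x]]|F0] :=
      pselect (exists2 X, F X & X !=set0); last first.
    right; apply/seteqP; split=> // x [X FX Xx]; case: F0; exists X => //.
    by exists x.
  have clF X : F X -> X !=set0 -> lin_closed X /\ ~ X a.
    by move=> FX [y Xy]; case: (FP X FX) => // X00; rewrite X00 in Xy.
  left; split; last first.
    by move=> [X FX Xa]; have [|_] := clF X FX; first by exists a.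
  split.
    by exists X0 => //; case: (clF X0 FX0) => [|[]//]; exists x.
  move=> c u v [X FX Xu] [Y FY Yv].
  have [XY|YX] := totF X Y FX FY.
    have [|[_ YD] _] := clF Y FY; first by exists v.
    by exists Y => //; apply: YD => //; apply: XY.
  have [|[_ XD] _] := clF X FX; first by exists u.
  by exists X => //; apply: XD => //; apply: YX.
have {PH}[HL Ha] : lin_closed H /\ ~ H a.
  case: PH => // H0.
  have P0 : P [set 0].
    left; split; last by move/eqP; rewrite (negbTE a0).
    split=> //= c u v /= -> ->; by rewrite scaler0 addr0.
  case: (Hmax [set 0]) => //; split; first by rewrite H0.
  by rewrite H0 => /(_ 0 erefl).
(* If [b] is not in [H], maximality puts [a] in the sum of [H] and the line of [b]; the coefficient
   of [b] is nonzero because [a] is not in [H], so one can solve for [b]. *)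
have ex b : exists c, H (b - c *: a).
  have [Hb|Hb] := pselect (H b); first by exists 0; rewrite scale0r subr0.
  pose H' : set V := [set v | exists c, H (v - c *: b)].
  have H'L : lin_closed H'.
    split; first by exists 0; rewrite scale0r subr0; case: HL.
    move=> c u v [d Hd] [e He]; exists (c * d + e).
    rewrite scalerDl opprD addrACA -scalerA -scalerBr.
    by case: HL => _; apply.
  have [[c Hc]|H'a] := pselect (H' a).
    have c0 : c != 0.
      by apply/eqP => c0; move: Hc; rewrite c0 scale0r subr0.
    exists c^-1; have := lin_closedZ (- c^-1) HL Hc.
    by rewrite scalerBr scalerA mulNr mulVf // scaleN1r opprK scaleNr addrC.
  case: (Hmax H'); last by left.
  split; first by move=> v Hv; exists 0; rewrite scale0r subr0.
  move=> /(_ b) H'H; apply: Hb; apply: H'H.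
  by exists 1; rewrite scale1r subrr; case: HL.
have uniq b c d : H (b - c *: a) -> H (b - d *: a) -> c = d.
  move=> Hc Hd; apply/eqP; rewrite -subr_eq0; apply/negPn/negP => cd.
  apply: Ha; have := lin_closedB HL Hd Hc.
  rewrite opprB addrCA addrAC subrr add0r -scalerBl => /(lin_closedZ (c - d)^-1 HL).
  by rewrite scalerA mulVf // scale1r.
pose f b := projT1 (cid (ex b)).
have fP b : H (b - f b *: a) by exact: projT2 (cid (ex b)).
have fL : linear_for *%R f.
  move=> c u v; apply: (uniq (c *: u + v)) => //.
  rewrite scalerDl opprD addrACA -scalerA -scalerBr.
  by case: HL => _; apply.
pose fM := GRing.isLinear.Build k V k *%R f fL.
exists (HB.pack_for {scalar V} f fM); apply: (uniq a); first exact: fP.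
by rewrite scale1r subrr; case: HL.
Qed.

(** Elimination, one element of [s] at a time: what is left of [a] after subtracting its components
    along the old [e i] is a new basis vector unless it is zero, and its functional is corrected to
    kill the old ones. The last clause says that [e i] lies in the span of [s], in a form that
    carries linear properties from [s] to [e]. *)
Lemma dual_basis (s : seq V) : exists n (e : 'I_n -> V) (f : 'I_n -> {scalar V}),
  [/\ forall i j, f i (e j) = (i == j)%:R,
      forall x, x \in s -> x = \sum_i f i x *: e i
    & forall P : V -> Prop, lin_closed P -> (forall x, x \in s -> P x) ->
      forall i, P (e i)].
Proof.
elim: s => [|a s [n [e [f [fe se Pe]]]]].
  by exists 0%N, (fun _ => 0), (fun _ => \0); split=> // [[] //|P _ _ [] //].
pose b := a - \sum_i f i a *: e i.
have fb i : f i b = 0.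
  rewrite /b linearB linear_sum /= (bigD1 i) //= big1 ?addr0.
    by rewrite linearZ /= fe eqxx mulr1 subrr.
  by move=> j ji; rewrite linearZ /= fe eq_sym (negbTE ji) mulr0.
have [b0|b0] := eqVneq b 0.
  exists n, e, f; split=> //.
    by move=> x; rewrite inE => /orP [/eqP ->|/se //]; apply/eqP; rewrite -subr_eq0 -/b b0.
  by move=> P PL Ps; apply: Pe => // x xs; apply: Ps; rewrite inE xs orbT.
have [g gb] := functional_exists b0.
pose h x := g x - \sum_i g (e i) * f i x.
have hL : linear_for *%R h.
  move=> c u v; rewrite /h linearP mulrBr addrACA -opprD; congr (_ - _).
  rewrite mulr_sumr -big_split /=; apply: eq_bigr => i _.
  by rewrite linearP mulrDr mulrCA.
pose hM := GRing.isLinear.Build k V k *%R h hL.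
have [H HE] : exists H : {scalar V},
    forall x, H x = g x - \sum_i g (e i) * f i x.
  by exists (HB.pack_for {scalar V} h hM).
have He j : H (e j) = 0.
  rewrite HE (bigD1 j) //= fe eqxx mulr1 big1 ?addr0 ?subrr //.
  by move=> i ij; rewrite fe (negbTE ij) mulr0.
have Hb : H b = 1.
  by rewrite HE gb big1 ?subr0 // => i _; rewrite fb mulr0.
exists n.+1, (fun i => oapp e b (unlift ord0 i)),
  (fun i => if unlift ord0 i is Some j then f j else H); split.
- move=> i j; case: unliftP => [i'|] ->; case: unliftP => [j'|] -> /=.
  + by rewrite fe (inj_eq lift_inj).
  + by rewrite fb.
  + by rewrite He.
  + by rewrite Hb.
- have rec x : \sum_i (if unlift ord0 i is Some j then f j else H) x *:
       oapp e b (unlift ord0 i) = H x *: b + \sum_i f i x *: e i.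
    rewrite big_ord_recl unlift_none /=; congr (_ + _).
    by apply: eq_bigr => i _; rewrite liftK.
  move=> x; rewrite rec inE => /orP [/eqP ->|xs].
    have -> : H a = 1.
      have aE : a = b + \sum_i f i a *: e i by rewrite subrK.
      rewrite {1}aE linearD Hb linear_sum big1 ?addr0 // => i _.
      by rewrite linearZ /= He mulr0.
    by rewrite scale1r subrK.
  have -> : H x = 0; last by rewrite scale0r add0r; exact: se.
  rewrite (se x xs) linear_sum big1 // => i _.
  by rewrite linearZ /= He mulr0.
- move=> P PL Ps i.
  have Pe' j : P (e j) by apply: Pe => // x xs; apply: Ps; rewrite inE xs orbT.
  case: (unliftP ord0 i) => [j|] _ //=; apply: lin_closedB => //.
    by apply: Ps; rewrite mem_head.
  by apply: lin_closed_sum => // j _; apply: lin_closedZ.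
Qed.

End Functionals.

(** * Tensor products of commutative algebras *)

Section Tensor.
Variables (k : fieldType) (R A : comAlgType k).
Implicit Types (s : seq (R * A)) (f : {scalar A}).

Definition tens_eval s : {scalar A} -> R := fun f => \sum_(p <- s) f p.2 *: p.1.

(* Linear functionals on [A] separate points, so that [R (x) A] embeds into the
   functions from the dual of [A] to [R]. *)
Definition tensor : Type :=
  {F : {scalar A} -> R | `[< exists s, F = tens_eval s >]}.

HB.instance Definition _ := Choice.on tensor.

Definition tens s : tensor := exist _ (tens_eval s) (asboolT (ex_intro _ s erefl)).

Definition tens_at (t : tensor) (f : {scalar A}) : R := val t f.

Lemma tens_atE s f : tens_at (tens s) f = \sum_(p <- s) f p.2 *: p.1.
Proof. by []. Qed.

Lemma tensP t : exists s, t = tens s.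
Proof. by case: (asboolW (svalP t)) => s ts; exists s; apply: val_inj. Qed.

Definition tens_rep t : seq (R * A) := projT1 (cid (tensP t)).

Lemma tens_repK t : tens (tens_rep t) = t.
Proof. by rewrite -(projT2 (cid (tensP t))). Qed.

Lemma tens_ext (t u : tensor) : (forall f, tens_at t f = tens_at u f) -> t = u.
Proof. by move=> tu; apply: val_inj; apply/funext. Qed.

Definition mulf f (b : A) : A -> k := fun x => f (x * b).
Fact mulf_linear f b : linear_for *%R (mulf f b).
Proof. by move=> c u v; rewrite /mulf mulrDl -scalerAl linearP. Qed.
HB.instance Definition _ f b :=
  GRing.isLinear.Build k A k *%R (mulf f b) (@mulf_linear f b).

Definition seqM (s s' : seq (R * A)) : seq (R * A) :=
  [seq (p.1 * q.1, p.2 * q.2) | p <- s, q <- s'].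

Lemma tens_atM s s' f :
  tens_at (tens (seqM s s')) f = \sum_(q <- s') tens_at (tens s) (mulf f q.2) * q.1.
Proof.
rewrite tens_atE big_allpairs_dep exchange_big /=; apply: eq_bigr => q _.
by rewrite tens_atE mulr_suml; apply: eq_bigr => p _; rewrite scalerAl.
Qed.

Lemma seqMC (s s' : seq (R * A)) : tens (seqM s s') = tens (seqM s' s).
Proof.
apply: tens_ext => f; rewrite !tens_atE !big_allpairs_dep exchange_big /=.
by apply: eq_bigr => q _; apply: eq_bigr => p _; rewrite /= [p.1 * _]mulrC [p.2 * _]mulrC.
Qed.

(** By [tens_atM] a product depends on its left factor only through the values at the functionals
    [mulf f q.2]. With [seqMC] this makes multiplication of tensors well defined. *)
Lemma seqM_eql s1 s2 s' : tens s1 = tens s2 -> tens (seqM s1 s') = tens (seqM s2 s').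
Proof. by move=> s12; apply: tens_ext => f; rewrite !tens_atM s12. Qed.

Definition tadd (t u : tensor) := tens (tens_rep t ++ tens_rep u).
Definition topp (t : tensor) := tens [seq (- p.1, p.2) | p <- tens_rep t].
Definition tscale c (t : tensor) := tens [seq (c *: p.1, p.2) | p <- tens_rep t].
Definition tmul (t u : tensor) := tens (seqM (tens_rep t) (tens_rep u)).

Lemma tens_at_add t u f : tens_at (tadd t u) f = tens_at t f + tens_at u f.
Proof. by rewrite -{2}[t]tens_repK -{2}[u]tens_repK !tens_atE big_cat. Qed.
Lemma tens_at_opp t f : tens_at (topp t) f = - tens_at t f.
Proof.
rewrite -{2}[t]tens_repK !tens_atE big_map -sumrN.
by apply: eq_bigr => p _; rewrite scalerN.
Qed.
Lemma tens_at_scale c t f : tens_at (tscale c t) f = c *: tens_at t f.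
Proof.
rewrite -{2}[t]tens_repK !tens_atE big_map scaler_sumr.
by apply: eq_bigr => p _; rewrite !scalerA mulrC.
Qed.
Lemma tmulE s s' : tmul (tens s) (tens s') = tens (seqM s s').
Proof.
rewrite /tmul (seqM_eql _ (tens_repK (tens s))) seqMC.
by rewrite (seqM_eql _ (tens_repK (tens s'))) seqMC.
Qed.

Fact taddA : associative tadd.
Proof. by move=> t u v; apply: tens_ext => f; rewrite !tens_at_add addrA. Qed.
Fact taddC : commutative tadd.
Proof. by move=> t u; apply: tens_ext => f; rewrite !tens_at_add addrC. Qed.
Fact tadd0 : left_id (tens [::]) tadd.
Proof.
by move=> t; apply: tens_ext => f; rewrite tens_at_add tens_atE big_nil add0r.
Qed.
Fact taddN : left_inverse (tens [::]) topp tadd.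
Proof.
move=> t; apply: tens_ext => f.
by rewrite tens_at_add tens_at_opp addNr tens_atE big_nil.
Qed.

HB.instance Definition _ := GRing.isZmodule.Build tensor taddA taddC tadd0 taddN.

Fact tmulA : associative tmul.
Proof.
move=> t u v; have [[s ->] [s' ->] [s'' ->]] := And3 (tensP t) (tensP u) (tensP v).
rewrite !tmulE; apply: tens_ext => f; rewrite !tens_atE !big_allpairs_dep.
apply: eq_bigr => p _; rewrite big_allpairs_dep; apply: eq_bigr => q _.
by apply: eq_bigr => r _; rewrite /= !mulrA.
Qed.
Fact tmulC : commutative tmul.
Proof.
by move=> t u; have [[s ->] [s' ->]] := conj (tensP t) (tensP u); rewrite !tmulE seqMC.
Qed.
Fact tmul1 : left_id (tens [:: (1, 1)]) tmul.
Proof.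
move=> t; have [s ->] := tensP t; rewrite tmulE; apply: tens_ext => f.
rewrite !tens_atE big_allpairs_dep big_seq1; apply: eq_bigr => p _.
by rewrite /= !mul1r.
Qed.
Fact tmulDl : left_distributive tmul tadd.
Proof.
move=> t u v; have [s ->] := tensP v; apply: tens_ext => f.
rewrite tens_at_add -[t]tens_repK -[u]tens_repK -[tadd _ _]tens_repK !tmulE.
rewrite !tens_atM -big_split /=; apply: eq_bigr => q _.
by rewrite -mulrDl !tens_repK tens_at_add.
Qed.
Fact tone_neq0 : tens [:: (1, 1)] != 0.
Proof.
have [f f1] := functional_exists (oner_neq0 A).
apply/eqP => /(congr1 (tens_at ^~ f)); rewrite !tens_atE big_seq1 big_nil f1.
by rewrite scale1r => /eqP; rewrite oner_eq0.
Qed.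

HB.instance Definition _ := GRing.Zmodule_isComNzRing.Build tensor
  tmulA tmulC tmul1 tmulDl tone_neq0.

Fact tscaleA a b t : tscale a (tscale b t) = tscale (a * b) t.
Proof. by apply: tens_ext => f; rewrite !tens_at_scale scalerA. Qed.
Fact tscale1 : left_id 1 tscale.
Proof. by move=> t; apply: tens_ext => f; rewrite tens_at_scale scale1r. Qed.
Fact tscaleDr : right_distributive tscale +%R.
Proof.
move=> a t u; apply: tens_ext => f.
by rewrite tens_at_scale !tens_at_add scalerDr !tens_at_scale.
Qed.
Fact tscaleDl t : {morph tscale^~ t : a b / a + b}.
Proof.
move=> a b; apply: tens_ext => f.
by rewrite tens_at_add !tens_at_scale scalerDl.
Qed.

HB.instance Definition _ := GRing.Zmodule_isLmodule.Build k tensor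
  tscaleA tscale1 tscaleDr tscaleDl.

Fact tscaleAl (a : k) (t u : tensor) : a *: (t * u) = (a *: t) * u.
Proof.
have [s ->] := tensP u; apply: tens_ext => f; rewrite tens_at_scale.
rewrite -{1}[t]tens_repK -[a *: t]tens_repK.
rewrite ![_ * tens s]tmulE !tens_atM scaler_sumr.
by apply: eq_bigr => q _; rewrite !tens_repK tens_at_scale scalerAl.
Qed.

HB.instance Definition _ := GRing.Lmodule_isLalgebra.Build k tensor tscaleAl.
HB.instance Definition _ := GRing.Lalgebra_isComAlgebra.Build k tensor.

Definition tinl (r : R) : tensor := tens [:: (r, 1)].
Definition tinr (a : A) : tensor := tens [:: (1, a)].

Fact tinl_additive : zmod_morphism tinl.
Proof.
move=> r r'; apply: tens_ext => f.
rewrite tens_at_add tens_at_opp !tens_atE !big_seq1 /=.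
by rewrite scalerBr.
Qed.
Fact tinl_multiplicative : monoid_morphism tinl.
Proof.
split=> // r r'; rewrite [RHS]tmulE; apply: tens_ext => f.
by rewrite !tens_atE big_allpairs_dep !big_seq1 /= mulr1.
Qed.
Fact tinl_scalable : scalable tinl.
Proof.
move=> a r; apply: tens_ext => f; rewrite tens_at_scale !tens_atE !big_seq1 /=.
by rewrite !scalerA mulrC.
Qed.
HB.instance Definition _ := GRing.isZmodMorphism.Build R tensor tinl tinl_additive.
HB.instance Definition _ :=
  GRing.isMonoidMorphism.Build R tensor tinl tinl_multiplicative.
HB.instance Definition _ := GRing.isScalable.Build k R tensor *:%R tinl tinl_scalable.

Fact tinr_additive : zmod_morphism tinr.
Proof.
move=> r r'; apply: tens_ext => f.
rewrite tens_at_add tens_at_opp !tens_atE !big_seq1 /=.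
by rewrite linearB scalerBl.
Qed.
Fact tinr_multiplicative : monoid_morphism tinr.
Proof.
split=> // r r'; rewrite [RHS]tmulE; apply: tens_ext => f.
by rewrite !tens_atE big_allpairs_dep !big_seq1 /= mulr1.
Qed.
Fact tinr_scalable : scalable tinr.
Proof.
move=> a r; apply: tens_ext => f; rewrite tens_at_scale !tens_atE !big_seq1 /=.
by rewrite linearZ /= scalerA.
Qed.
HB.instance Definition _ := GRing.isZmodMorphism.Build A tensor tinr tinr_additive.
HB.instance Definition _ :=
  GRing.isMonoidMorphism.Build A tensor tinr tinr_multiplicative.
HB.instance Definition _ := GRing.isScalable.Build k A tensor *:%R tinr tinr_scalable.

Lemma tensE s : tens s = \sum_(p <- s) tinl p.1 * tinr p.2.
Proof.
elim: s => [|p s IH]; first by rewrite big_nil.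
rewrite big_cons -IH; apply: tens_ext => f; rewrite tens_at_add.
rewrite [_ * _]tmulE !tens_atE big_cons big_allpairs_dep !big_seq1 /=.
by rewrite mulr1 mul1r.
Qed.

Lemma tens_atZ c t f : tens_at (c *: t) f = c *: tens_at t f.
Proof. exact: tens_at_scale. Qed.

Lemma tens_atD t u f : tens_at (t + u) f = tens_at t f + tens_at u f.
Proof. exact: tens_at_add. Qed.

Lemma tens_at_sum I (r : seq I) (F : I -> tensor) f :
  tens_at (\sum_(i <- r) F i) f = \sum_(i <- r) tens_at (F i) f.
Proof.
elim: r => [|i r IH]; first by rewrite !big_nil; exact: big_nil.
by rewrite !big_cons -IH; exact: tens_at_add.
Qed.

(** [tens_at _ f] is the [R]-linear map id (x) f from R (x) A to R; for [f] in a dual basis it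
    extracts a coefficient. *)
Lemma tens_at_tinl r t f : tens_at (tinl r * t) f = r * tens_at t f.
Proof.
have [s ->] := tensP t; rewrite [_ * _]tmulE !tens_atE big_allpairs_dep big_seq1.
rewrite mulr_sumr; apply: eq_bigr => p _ /=.
by rewrite mul1r scalerAr.
Qed.

Lemma tens_at_tinr a f : tens_at (tinr a) f = f a *: 1.
Proof. by rewrite tens_atE big_seq1. Qed.

Section Lift.
Variables (S : comAlgType k) (g : {lrmorphism R -> S}) (h : {lrmorphism A -> S}).

(** Expanding the second components of both lists in one dual basis expresses each sum through the
    values [tens_at _ (f i)], which agree. *)
Lemma tens_lift_eq (s s' : seq (R * A)) : tens s = tens s' ->
  \sum_(p <- s) g p.1 * h p.2 = \sum_(p <- s') g p.1 * h p.2.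
Proof.
move=> st; have [n [e [f [_ fe _]]]] := dual_basis [seq p.2 | p <- s ++ s'].
have sumE u : {subset u <= s ++ s'} ->
    \sum_(p <- u) g p.1 * h p.2 = \sum_i g (tens_at (tens u) (f i)) * h (e i).
  move=> ust; under [RHS]eq_bigr => i _ do rewrite tens_atE linear_sum mulr_suml.
  rewrite exchange_big /= !big_seq; apply: eq_bigr => p pu.
  rewrite {1}(fe p.2 _); last by apply/map_f/ust.
  rewrite linear_sum mulr_sumr; apply: eq_bigr => i _.
  by rewrite !linearZ /= -scalerAl scalerAr.
by rewrite !sumE ?st // => p; rewrite mem_cat => ->; rewrite ?orbT.
Qed.

Definition tlift (t : tensor) : S := \sum_(p <- tens_rep t) g p.1 * h p.2.

Lemma tliftE s : tlift (tens s) = \sum_(p <- s) g p.1 * h p.2.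
Proof. by apply: tens_lift_eq; rewrite tens_repK. Qed.

Fact tlift_additive : zmod_morphism tlift.
Proof.
move=> t u; have [[s ->] [s' ->]] := conj (tensP t) (tensP u).
have -> : tens s - tens s' = tens (s ++ [seq (- p.1, p.2) | p <- s']).
  apply: tens_ext => f; rewrite tens_at_add tens_at_opp !tens_atE big_cat big_map.
  by rewrite -sumrN; congr (_ + _); apply: eq_bigr => p _; rewrite scalerN.
rewrite !tliftE big_cat big_map -sumrN; congr (_ + _).
by apply: eq_bigr => p _; rewrite rmorphN mulNr.
Qed.
Fact tlift_multiplicative : monoid_morphism tlift.
Proof.
split; first by rewrite [1]/(tens _) tliftE big_seq1 !rmorph1 mulr1.
move=> t u; have [[s ->] [s' ->]] := conj (tensP t) (tensP u).
rewrite [_ * _]tmulE !tliftE big_allpairs_dep mulr_suml; apply: eq_bigr => p _.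
by rewrite mulr_sumr; apply: eq_bigr => q _; rewrite !rmorphM mulrACA.
Qed.
Fact tlift_scalable : scalable tlift.
Proof.
move=> a t; have [s ->] := tensP t.
have -> : a *: tens s = tens [seq (a *: p.1, p.2) | p <- s].
  apply: tens_ext => f; rewrite tens_at_scale !tens_atE big_map scaler_sumr.
  by apply: eq_bigr => p _; rewrite !scalerA mulrC.
rewrite !tliftE big_map scaler_sumr; apply: eq_bigr => p _.
by rewrite linearZ /= scalerAl.
Qed.
HB.instance Definition _ := GRing.isZmodMorphism.Build tensor S tlift tlift_additive.
HB.instance Definition _ :=
  GRing.isMonoidMorphism.Build tensor S tlift tlift_multiplicative.
HB.instance Definition _ := GRing.isScalable.Build k tensor S *:%R tlift tlift_scalable.

Lemma tlift_inl r : tlift (tinl r) = g r.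
Proof. by rewrite tliftE big_seq1 rmorph1 mulr1. Qed.
Lemma tlift_inr a : tlift (tinr a) = h a.
Proof. by rewrite tliftE big_seq1 rmorph1 mul1r. Qed.

End Lift.
End Tensor.

(** * Points and coordinate rings *)

Lemma mult1 (G H : groupType) (f : {multiplicative G -> H}) : f 1%g = 1%g.
Proof. by apply: (mulgI (f 1%g)); rewrite -gmulfM !mulg1. Qed.

Lemma multV (G H : groupType) (f : {multiplicative G -> H}) x :
  f x^-1%g = ((f x)^-1)%g.
Proof. by apply: (mulgI (f x)); rewrite -gmulfM !mulgV mult1. Qed.

Section Counit.
Variables (F : fieldType) (R : comAlgType F).

Definition unit_map : F^o -> R := fun a => a *: 1.

Fact unit_map_additive : zmod_morphism unit_map.
Proof. by move=> a b; rewrite /unit_map scalerBl. Qed.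
Fact unit_map_multiplicative : monoid_morphism unit_map.
Proof.
by split=> [|a b]; rewrite /unit_map ?scale1r // -scalerAl mul1r scalerA.
Qed.
Fact unit_map_scalable : scalable unit_map.
Proof. by move=> a b; rewrite /unit_map scalerA. Qed.
HB.instance Definition _ :=
  GRing.isZmodMorphism.Build F^o R unit_map unit_map_additive.
HB.instance Definition _ :=
  GRing.isMonoidMorphism.Build F^o R unit_map unit_map_multiplicative.
HB.instance Definition _ :=
  GRing.isScalable.Build F F^o R *:%R unit_map unit_map_scalable.

End Counit.

Section Evaluation.
Variables (F : fieldType) (U : group_functor F) (A : comAlgType F) (x : U A).
Hypothesis rx : represents x.

Definition ev (R : comAlgType F) (g : U R) : {lrmorphism A -> R} :=
  s2val (cid2 (rx g)).

Lemma pmap_ev (R : comAlgType F) (g : U R) : pmap U (ev g) x = g.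
Proof. exact: (s2valP (cid2 (rx g))). Qed.

Lemma ev_uniq (R : comAlgType F) (g : U R) (phi : {lrmorphism A -> R}) :
  pmap U phi x = g -> phi =1 ev g.
Proof. exact: (s2valP' (cid2 (rx g))). Qed.

Lemma ev_inj (R : comAlgType F) (g h : U R) : ev g =1 ev h -> g = h.
Proof.
by move=> /lrmorphism_eq gh; rewrite -(pmap_ev g) gh pmap_ev.
Qed.

Lemma ev_pmap (R S : comAlgType F) (f : {lrmorphism R -> S}) (g : U R) (a : A) :
  ev (pmap U f g) a = f (ev g a).
Proof.
rewrite -(ev_uniq (phi := (f \o ev g : {lrmorphism A -> S})) _ a) //.
by rewrite pmap_comp pmap_ev.
Qed.

Lemma ev_id a : ev x a = a.
Proof.
by rewrite -(ev_uniq (phi := (idfun : {lrmorphism A -> A})) _ a) // pmap_id.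
Qed.

Definition counit : {lrmorphism A -> F^o} := ev (1%g : U F^o).

Lemma ev1 (R : comAlgType F) a : ev (1%g : U R) a = counit a *: 1.
Proof.
have -> : (1%g : U R) = pmap U (@unit_map F R) 1%g by rewrite mult1.
by rewrite ev_pmap.
Qed.

Definition coprod : {lrmorphism A -> tensor A A} :=
  ev (pmap U (@tinl F A A) x * pmap U (@tinr F A A) x)%g.

Lemma coprodP (R : comAlgType F) (g h : U R) a :
  ev (g * h)%g a = tlift (ev g) (ev h) (coprod a).
Proof.
rewrite /coprod -ev_pmap; congr (ev _ a).
rewrite gmulfM -!pmap_comp; congr (_ * _)%g.
  rewrite -[LHS]pmap_ev; congr (pmap U _ x); apply: lrmorphism_eq => b /=.
  by rewrite tlift_inl.
rewrite -[LHS]pmap_ev; congr (pmap U _ x); apply: lrmorphism_eq => b /=.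
by rewrite tlift_inr.
Qed.

Lemma coprod_rep a : exists s : seq (A * A),
  coprod a = tens s /\ forall (R : comAlgType F) (g h : U R),
    ev (g * h)%g a = \sum_(p <- s) ev g p.1 * ev h p.2.
Proof.
have [s cs] := tensP (coprod a); exists s; split=> // R g h.
by rewrite coprodP cs tliftE.
Qed.

Definition mx_rep n (m : 'M[A]_n) : Prop :=
  (forall (R : comAlgType F) (g h : U R),
     map_mx (ev (g * h)%g) m = map_mx (ev g) m *m map_mx (ev h) m) /\
  (forall R : comAlgType F, map_mx (ev (1%g : U R)) m = 1%:M).

(** Local finiteness: the translates u |-> a(g u) lie in a finite-dimensional stable space, on which
    [m] is the matrix of the action. Here [xi] holds the coordinates of [a] in a basis of that space
    and [w] the values of this basis at 1. *)
Lemma mx_rep_comodule (a : A) : exists n (m : 'M[A]_n) (xi : 'rV[F]_n) (w : 'cV[F]_n),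
  mx_rep m /\ a = \sum_i \sum_j (xi 0 i * w j 0) *: m i j.
Proof.
have [s [_ sP]] := coprod_rep a.
have [r [f [b [fb bs _]]]] := dual_basis [seq p.1 | p <- s].
pose e q := \sum_(p <- s) b q p.1 *: p.2.
have aP (R : comAlgType F) (g u : U R) : ev (g * u)%g a = \sum_q ev g (f q) * ev u (e q).
  rewrite sP (eq_bigr (fun q => \sum_(p <- s) b q p.1 *: (ev g (f q) * ev u p.2))).
    rewrite exchange_big /= !big_seq; apply: eq_bigr => p ps.
    rewrite {1}(bs p.1 _) ?map_f // linear_sum mulr_suml; apply: eq_bigr => q _.
    by rewrite linearZ scalerAl.
  move=> q _; rewrite linear_sum mulr_sumr; apply: eq_bigr => p _.
  by rewrite linearZ scalerAr.
clearbody e.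
(* The span of the [e q] is stable: compare a(g (h u)) with a((g h) u) and take the coefficient of
   [f q], which makes sense as the [f q] are independent. *)
have eP q : exists c : 'I_r -> A, forall (R : comAlgType F) (h u : U R),
    ev (h * u)%g (e q) = \sum_p ev h (c p) * ev u (e p).
  have [c cP] := choice (fun p => coprod_rep (f p)).
  exists (fun p => \sum_(z <- c p) b q z.1 *: z.2) => R h u.
  (* With [g] the universal point over the right factor of R (x) A, the functional [b q] acts on the
     variable [g] alone. *)
  pose l (y : U R) := pmap U (@tinl F R A) y; pose g := pmap U (@tinr F R A) x.
  have lM y z : (l (y * z) = l y * l z)%g by exact: gmulfM.
  have lE y v : ev (l y) v = tinl A (ev y v) by rewrite ev_pmap.
  have gE v : ev g v = tinr R v by rewrite ev_pmap ev_id.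
  have := congr1 (fun y => tens_at (ev y a) (b q)) (mulgA g (l h) (l u)).
  rewrite -lM !aP /= => E.
  transitivity (tens_at (\sum_p ev g (f p) * ev (l (h * u)%g) (e p)) (b q)).
    rewrite tens_at_sum (bigD1 q) //= big1 => [|p pq].
      rewrite addr0 lE gE mulrC tens_at_tinl tens_at_tinr.
      by rewrite fb eqxx scale1r mulr1.
    rewrite lE gE mulrC tens_at_tinl tens_at_tinr.
    by rewrite fb eq_sym (negbTE pq) scale0r mulr0.
  rewrite E tens_at_sum; apply: eq_bigr => p _.
  rewrite (cP p).2 linear_sum !mulr_suml tens_at_sum; apply: eq_bigr => z _.
  rewrite !lE gE -mulrA mulrC -mulrA !tens_at_tinl tens_at_tinr.
  by rewrite linearZ /= -!scalerAl -!scalerAr mulr1 mulrC.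
have [n [w [d [dw we Pw]]]] := dual_basis [seq e q | q <- enum 'I_r].
have {}we q : e q = \sum_i d i (e q) *: w i by apply/we/map_f; rewrite mem_enum.
(* The condition that translates of [v] stay in the span of the [w j] is linear in [v], so the last
   clause of [dual_basis] brings it from the [e q] to the basis [w]. *)
pose P (v : A) := exists c : 'I_n -> A, forall (R : comAlgType F) (h u : U R),
    ev (h * u)%g v = \sum_j ev h (c j) * ev u (w j).
have {}Pw i : P (w i).
  apply: (Pw P) => [|_ /mapP [q _ ->]]; last first.
    have [c cP] := eP q; exists (fun j => \sum_p d j (e p) *: c p) => R h u.
    rewrite cP; under [RHS]eq_bigr => j _ do rewrite linear_sum mulr_suml.
    rewrite exchange_big; apply: eq_bigr => p _ /=.
    rewrite {1}(we p) linear_sum mulr_sumr; apply: eq_bigr => j _.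
    by rewrite !linearZ /= -scalerAl scalerAr.
  split.
    exists (fun _ => 0) => R h u; rewrite linear0 big1 // => j _.
    by rewrite linear0 mul0r.
  move=> t u v [c cP] [c' cP']; exists (fun j => t *: c j + c' j) => R h y.
  rewrite linearP /= cP cP' scaler_sumr -big_split; apply: eq_bigr => j _ /=.
  by rewrite linearP mulrDl scalerAl.
have [c cP] := choice Pw.
pose m := \matrix_(i, j) c i j.
(* An entry of [m] is a coefficient of a translate of [w i], read off by the dual functional [d l];
   multiplicativity of [m] thereby reduces to associativity in [U]. *)
have mE (R : comAlgType F) (h : U R) i l : ev h (c i l) =
    tens_at (ev (pmap U (@tinl F R A) h * pmap U (@tinr F R A) x)%g (w i)) (d l).
  rewrite cP tens_at_sum (bigD1 l) //= big1 => [|j jl].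
    by rewrite !ev_pmap ev_id tens_at_tinl tens_at_tinr dw eqxx scale1r mulr1 addr0.
  rewrite !ev_pmap ev_id tens_at_tinl tens_at_tinr dw eq_sym (negbTE jl).
  by rewrite scale0r mulr0.
have mR : mx_rep m.
  split=> [R g h|R]; apply/matrixP => i l; rewrite !mxE.
    rewrite mE gmulfM -mulgA cP tens_at_sum; apply: eq_bigr => j _.
    by rewrite !mxE (mE _ h) ev_pmap tens_at_tinl.
  rewrite mE mult1 mul1g ev_pmap ev_id tens_at_tinr dw eq_sym.
  by case: (i == l); rewrite ?scale1r ?scale0r.
have wE i : w i = \sum_j counit (w j) *: m i j.
  rewrite -{1}[w i]ev_id -[x]mulg1 cP; apply: eq_bigr => j _.
  by rewrite ev_id ev1 -scalerAr mulr1 mxE.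
exists n, m, (\row_i \sum_q counit (f q) * d i (e q)), (\col_j counit (w j)).
split=> //; rewrite -{1}[a]ev_id -[x]mul1g aP.
rewrite (eq_bigr (fun q => \sum_i (counit (f q) * d i (e q)) *: w i)); last first.
  move=> q _; rewrite ev1 ev_id -scalerAl mul1r {1}(we q) scaler_sumr.
  by apply: eq_bigr => i _; rewrite scalerA.
rewrite exchange_big; apply: eq_bigr => i _ /=.
rewrite -scaler_suml {1}(wE i) scaler_sumr; apply: eq_bigr => j _.
by rewrite !mxE scalerA.
Qed.

End Evaluation.

(** * Generated subalgebras *)

Section GeneratedSubalgebra.
Variables (F : fieldType) (A : comAlgType F).
Implicit Types (P S : A -> Prop) (a b : A).

Definition subalg S : Prop :=
  [/\ S 1, forall c u v, S u -> S v -> S (c *: u + v)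
    & forall u v, S u -> S v -> S (u * v)].

(** As a quantification over all subalgebras this doubles as an induction principle: a proof of
    [gen P a] is applied directly to the property to be shown. *)
Definition gen P a : Prop := forall S, subalg S -> (forall b, P b -> S b) -> S a.

Lemma subalg_gen P : subalg (gen P).
Proof.
split=> [S [S1 _ _] _ //|c u v Pu Pv S SS PS|u v Pu Pv S SS PS].
  by have [_ SD _] := SS; exact: SD (Pu S SS PS) (Pv S SS PS).
by have [_ _ SM] := SS; exact: SM (Pu S SS PS) (Pv S SS PS).
Qed.

Lemma gen_sub P a : P a -> gen P a. Proof. by move=> Pa S _; apply. Qed.

Lemma gen_trans P S a : (forall b, P b -> gen S b) -> gen P a -> gen S a.
Proof. by move=> PS; apply; [exact: subalg_gen | exact: PS]. Qed.

Lemma subalg_lin S : subalg S -> lin_closed S.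
Proof.
case=> S1 SD SM; split=> //.
by rewrite -(subrr (1 : A)) addrC -scaleN1r; apply: SD.
Qed.

Definition gen_pred P : {pred A} := fun a => `[< gen P a >].

Lemma gen_predP P a : reflect (gen P a) (a \in gen_pred P).
Proof. exact: asboolP. Qed.

Fact gen_pred_subalg P : GRing.subalg_closed (gen_pred P).
Proof.
have [G1 GD GM] := subalg_gen P.
split=> [|c u v|u v].
- exact/gen_predP.
- by move=> /gen_predP Pu /gen_predP Pv; apply/gen_predP; exact: GD.
- by move=> /gen_predP Pu /gen_predP Pv; apply/gen_predP; exact: GM.
Qed.
HB.instance Definition _ P := GRing.isSubalgClosed.Build F A (gen_pred P) (gen_pred_subalg P).

Variable P : A -> Prop.

Definition gen_alg : Type := {a | a \in gen_pred P}.
HB.instance Definition _ := [isSub of gen_alg for sval].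
HB.instance Definition _ := [Choice of gen_alg by <:].
HB.instance Definition _ := [SubChoice_isSubNzRing of gen_alg by <:].
HB.instance Definition _ := [SubZmodule_isSubLmodule of gen_alg by <:].
HB.instance Definition _ := [SubNzRing_SubLmodule_isSubLalgebra of gen_alg by <:].
HB.instance Definition _ := [SubNzRing_isSubComNzRing of gen_alg by <:].
HB.instance Definition _ := GRing.Lalgebra_isComAlgebra.Build F gen_alg.

Definition gen_val : gen_alg -> A := val.
Fact gen_val_additive : zmod_morphism gen_val. Proof. exact: raddfB. Qed.
Fact gen_val_multiplicative : monoid_morphism gen_val.
Proof. by split; [exact: rmorph1 | exact: rmorphM]. Qed.
Fact gen_val_scalable : scalable gen_val.
Proof. by move=> a u; rewrite /gen_val linearZZ. Qed.
HB.instance Definition _ := GRing.isZmodMorphism.Build gen_alg A gen_val gen_val_additive.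
HB.instance Definition _ :=
  GRing.isMonoidMorphism.Build gen_alg A gen_val gen_val_multiplicative.
HB.instance Definition _ := GRing.isScalable.Build F gen_alg A *:%R gen_val gen_val_scalable.

End GeneratedSubalgebra.

Section GeneratedTheory.
Variable F : fieldType.

Lemma gen_valP (A : comAlgType F) (P : A -> Prop) (b : gen_alg P) : gen P (gen_val b).
Proof. exact/gen_predP/(valP b). Qed.

Lemma gen_valK (A : comAlgType F) (P : A -> Prop) a : gen P a -> 
  exists b : gen_alg P, gen_val b = a.
Proof. by move=> /gen_predP Pa; exists (exist _ a Pa). Qed.

Lemma gen_val_inj (A : comAlgType F) (P : A -> Prop) : injective (@gen_val F A P).
Proof. exact: val_inj. Qed.

Lemma gen_ext (A : comAlgType F) (P : A -> Prop) (a b : gen_alg P) :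
  gen_val a = gen_val b -> a = b.
Proof. exact: gen_val_inj. Qed.

Lemma gen_valB (A : comAlgType F) (P : A -> Prop) (a b : gen_alg P) :
  gen_val (a - b) = gen_val a - gen_val b.
Proof. exact: raddfB. Qed.
Lemma gen_val1 (A : comAlgType F) (P : A -> Prop) : gen_val (1 : gen_alg P) = 1.
Proof. exact: rmorph1. Qed.
Lemma gen_val_nat (A : comAlgType F) (P : A -> Prop) n :
  gen_val (n%:R : gen_alg P) = n%:R.
Proof. exact: rmorph_nat. Qed.
Lemma gen_valM (A : comAlgType F) (P : A -> Prop) (a b : gen_alg P) :
  gen_val (a * b) = gen_val a * gen_val b.
Proof. exact: rmorphM. Qed.
Lemma gen_valZ (A : comAlgType F) (P : A -> Prop) c (b : gen_alg P) :
  gen_val (c *: b) = c *: gen_val b.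
Proof. exact: gen_val_scalable. Qed.
Lemma gen_val_sum (A : comAlgType F) (P : A -> Prop) I (r : seq I) (E : I -> gen_alg P) :
  gen_val (\sum_(i <- r) E i) = \sum_(i <- r) gen_val (E i).
Proof. exact: (raddf_sum (@gen_val F A P)). Qed.
Lemma gen_valP_lin (A : comAlgType F) (P : A -> Prop) c (a b : gen_alg P) :
  gen_val (c *: a + b) = c *: gen_val a + gen_val b.
Proof. by rewrite -gen_valZ; exact: (raddfD (@gen_val F A P)). Qed.

Lemma subalg_image (A B : comAlgType F) (f : {lrmorphism A -> B}) (S : A -> Prop) :
  subalg S -> subalg (fun b => exists2 a, S a & f a = b).
Proof.
case=> S1 SD SM; split=> [|c _ _ [u Su <-] [v Sv <-]|_ _ [u Su <-] [v Sv <-]].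
- by exists 1; rewrite ?rmorph1.
- by exists (c *: u + v); [exact: SD | rewrite linearP].
- by exists (u * v); [exact: SM | rewrite rmorphM].
Qed.

Lemma subalg_preim (A B : comAlgType F) (f : {lrmorphism A -> B}) (S : B -> Prop) :
  subalg S -> subalg (fun a => S (f a)).
Proof.
case=> S1 SD SM; split=> [|c u v Su Sv|u v Su Sv].
- by rewrite rmorph1.
- by rewrite linearP; exact: SD.
- by rewrite rmorphM; exact: SM.
Qed.

Lemma subalg_eq (A B : comAlgType F) (f g : {lrmorphism A -> B}) :
  subalg (fun a => f a = g a).
Proof.
split=> [|c u v fu fv|u v fu fv]; first by rewrite !rmorph1.
  by rewrite !linearP /= fu fv.
by rewrite !rmorphM /= fu fv.
Qed.

Lemma subalgT (A : comAlgType F) : subalg (fun _ : A => True).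
Proof. by []. Qed.

Lemma gen_map (A B : comAlgType F) (f : {lrmorphism A -> B}) (P : A -> Prop)
    (S : B -> Prop) a :
  (forall p, P p -> gen S (f p)) -> gen P a -> gen S (f a).
Proof.
move=> PS /(_ (fun a => gen S (f a))); apply=> //.
exact/subalg_preim/subalg_gen.
Qed.

Definition gen_seq (A : comAlgType F) (s : seq A) : A -> Prop := gen (fun a => a \in s).

Lemma fin_gen_algebraP (A : comAlgType F) :
  fin_gen_algebra A <-> exists s : seq A, forall a, gen_seq s a.
Proof.
split=> [] [s sP]; exists s; last first.
  move=> S [S1 SD SM] sS a.
  by apply: (sP a (fun a => a \in S)) => //; split=> // c u v; exact: SD.
move=> a S [S1 SD SM] PS.
have Scl : GRing.subalg_closed ((fun a => `[< S a >]) : {pred A}).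
    split=> [|c u v|u v]; first exact/asboolP.
      by move=> /asboolP Su /asboolP Sv; apply/asboolP; exact: SD.
    by move=> /asboolP Su /asboolP Sv; apply/asboolP; exact: SM.
have sS : {subset s <= ((fun a => `[< S a >]) : {pred A})}.
  by move=> b /PS Sb; exact/asboolP.
exact: asboolW (sP _ Scl sS a).
Qed.

End GeneratedTheory.

(** * Algebraic quotients *)

Section AlgebraPoints.
Variables (F : fieldType) (B : comAlgType F).

Definition alg_points (R : comAlgType F) : Type := {lrmorphism B -> R}.
HB.instance Definition _ R := gen_eqMixin (alg_points R).
HB.instance Definition _ R := gen_choiceMixin (alg_points R).

End AlgebraPoints.

Section ImageGroup.
Variables (F : fieldType) (U : group_functor F) (A : comAlgType F) (x : U A).
Hypothesis rx : represents x.
Variables (n : nat) (m : 'M[A]_n).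
Hypothesis mR : mx_rep rx m.

Definition antipode : {lrmorphism A -> A} := ev rx (x^-1)%g.

Lemma ev_antipode (R : comAlgType F) (g : U R) a :
  ev rx g (antipode a) = ev rx (g^-1)%g a.
Proof. by rewrite -[in RHS](pmap_ev rx g) -multV ev_pmap. Qed.

Lemma antipodeK a : antipode (antipode a) = a.
Proof. by rewrite ev_antipode invgK ev_id. Qed.

(** Generators of the coordinate ring of the image of [U] in GL_n; the antipodes supply the entries
    of the inverse matrix. *)
Definition img_gens (a : A) : Prop := exists i j, a = m i j \/ a = antipode (m i j).

Local Notation B := (gen_alg img_gens).
Local Notation v := (@gen_val F A img_gens).

Lemma v_ext (a b : B) : v a = v b -> a = b.
Proof. exact: gen_ext. Qed.

Lemma img_antipode a : gen img_gens a -> gen img_gens (antipode a).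
Proof.
apply: gen_map => _ [i [j [->|->]]]; apply: gen_sub; exists i, j; first by right.
by left; rewrite antipodeK.
Qed.

Definition img_antip (b : B) : B := projT1 (cid (gen_valK (img_antipode (gen_valP b)))).
Lemma img_antipE b : v (img_antip b) = antipode (v b).
Proof. exact: (projT2 (cid (gen_valK (img_antipode (gen_valP b))))). Qed.

Fact img_antip_additive : zmod_morphism img_antip.
Proof. by move=> a b; apply: v_ext; rewrite gen_valB !img_antipE gen_valB rmorphB. Qed.
Fact img_antip_multiplicative : monoid_morphism img_antip.
Proof.
split=> [|a b]; apply: v_ext; first by rewrite img_antipE gen_val1 rmorph1.
by rewrite gen_valM !img_antipE gen_valM rmorphM.
Qed.
Fact img_antip_scalable : scalable img_antip.
Proof. by move=> a b; apply: v_ext; rewrite linearZ /= !img_antipE !linearZ. Qed.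
HB.instance Definition _ := GRing.isZmodMorphism.Build B B img_antip img_antip_additive.
HB.instance Definition _ :=
  GRing.isMonoidMorphism.Build B B img_antip img_antip_multiplicative.
HB.instance Definition _ := GRing.isScalable.Build F B B *:%R img_antip img_antip_scalable.

(** [s] represents the comultiplication of [a] with both factors in the subalgebra [B]. *)
Definition img_dec (a : A) (s : seq (B * B)) : Prop :=
  forall (R : comAlgType F) (g h : U R),
    ev rx (g * h)%g a = \sum_(p <- s) ev rx g (v p.1) * ev rx h (v p.2).

Lemma img_dec1 : img_dec 1 [:: (1, 1)].
Proof. by move=> R g h; rewrite big_seq1 /= gen_val1 !rmorph1 mulr1. Qed.

Lemma img_dec_lin c a b s t : img_dec a s -> img_dec b t ->
  img_dec (c *: a + b) ([seq (c *: p.1, p.2) | p <- s] ++ t).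
Proof.
move=> sa tb R g h; rewrite linearP /= sa tb big_cat big_map scaler_sumr /=.
by congr (_ + _); apply: eq_bigr => p _; rewrite gen_valZ linearZ /= scalerAl.
Qed.

Lemma img_decM a b s t : img_dec a s -> img_dec b t ->
  img_dec (a * b) [seq (p.1 * q.1, p.2 * q.2) | p <- s, q <- t].
Proof.
move=> sa tb R g h; rewrite rmorphM /= sa tb big_allpairs_dep mulr_suml.
apply: eq_bigr => p _; rewrite mulr_sumr; apply: eq_bigr => q _ /=.
by rewrite !gen_valM !rmorphM /= mulrACA.
Qed.

Definition img_m i j : B := projT1 (cid (gen_valK (gen_sub
  (ex_intro _ i (ex_intro _ j (or_introl erefl)) : img_gens (m i j))))).
Definition img_m' i j : B := projT1 (cid (gen_valK (gen_sub
  (ex_intro _ i (ex_intro _ j (or_intror erefl)) : img_gens (antipode (m i j)))))).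
Lemma img_mE i j : v (img_m i j) = m i j.
Proof. by rewrite /img_m; case: cid. Qed.
Lemma img_m'E i j : v (img_m' i j) = antipode (m i j).
Proof. by rewrite /img_m'; case: cid. Qed.

Lemma ev_mxM (R : comAlgType F) (g h : U R) i j :
  ev rx (g * h)%g (m i j) = \sum_l ev rx g (m i l) * ev rx h (m l j).
Proof.
have /matrixP/(_ i j) := mR.1 R g h; rewrite !mxE => ->.
by apply: eq_bigr => l _; rewrite !mxE.
Qed.

Lemma ev_mx1 (R : comAlgType F) i j : ev rx (1%g : U R) (m i j) = (i == j)%:R.
Proof. by have /matrixP/(_ i j) := mR.2 R; rewrite !mxE. Qed.

Lemma img_dec_m i j : img_dec (m i j) [seq (img_m i l, img_m l j) | l <- enum 'I_n].
Proof.
move=> R g h; rewrite big_map big_enum ev_mxM; apply: eq_bigr => l _.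
by rewrite !img_mE.
Qed.

Lemma img_dec_m' i j :
  img_dec (antipode (m i j)) [seq (img_m' l j, img_m' i l) | l <- enum 'I_n].
Proof.
move=> R g h; rewrite big_map big_enum ev_antipode invgM ev_mxM.
apply: eq_bigr => l _; rewrite !img_m'E !ev_antipode.
by rewrite mulrC.
Qed.

Lemma img_dec_ex (b : B) : exists s, img_dec (v b) s.
Proof.
apply: (gen_valP b (S := fun a => exists s, img_dec a s)).
  split; first by exists [:: (1, 1)]; exact: img_dec1.
    by move=> c a a' [s sa] [t ta]; eexists; exact: img_dec_lin sa ta.
  by move=> a a' [s sa] [t ta]; eexists; exact: img_decM sa ta.
move=> _ [i [j [->|->]]]; eexists; [exact: img_dec_m | exact: img_dec_m'].
Qed.

Section Convolution.
Variables (R : comAlgType F) (phi psi : {lrmorphism B -> R}).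

(** This is the injectivity of B (x) B -> A (x) A. Both lists give the same tensor over [A]; in a
    basis [e] of the span of the second factors, which lies in [B], the coefficients of the first
    factors agree in [A], hence in [B]. *)
Lemma img_dec_uniq a s t : img_dec a s -> img_dec a t ->
  \sum_(p <- s) phi p.1 * psi p.2 = \sum_(p <- t) phi p.1 * psi p.2.
Proof.
move=> sa ta.
pose w (s : seq (B * B)) := [seq (v p.1, v p.2) | p <- s].
have {sa ta} st : tens (w s) = tens (w t).
  rewrite !tensE !big_map.
  have E (u : seq (B * B)) : \sum_(p <- u) tinl A (v p.1) * tinr A (v p.2) =
      \sum_(p <- u) ev rx (pmap U (@tinl F A A) x) (v p.1) *
        ev rx (pmap U (@tinr F A A) x) (v p.2).
    by apply: eq_bigr => p _; rewrite !ev_pmap !ev_id.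
  by rewrite !E -sa -ta.
have [r [e [f [_ fe Pe]]]] := dual_basis [seq v p.2 | p <- s ++ t].
have eB i : gen img_gens (e i).
  apply: Pe; first exact/subalg_lin/subalg_gen.
  by move=> _ /mapP [p _ ->]; exact: gen_valP.
have {}eB i : exists b, v b = e i := gen_valK (eB i).
have [e' e'E] := choice eB.
have sumE u : {subset u <= s ++ t} -> \sum_(p <- u) phi p.1 * psi p.2 =
    \sum_i phi (\sum_(p <- u) f i (v p.2) *: p.1) * psi (e' i).
  move=> ust; under [RHS]eq_bigr => i _ do rewrite linear_sum mulr_suml.
  rewrite exchange_big /= !big_seq; apply: eq_bigr => p pu.
  have pE : p.2 = \sum_i f i (v p.2) *: e' i.
    apply: v_ext; rewrite {1}(fe (v p.2)) ?gen_val_sum; last first.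
      by apply/mapP; exists p => //; exact: ust.
    by apply: eq_bigr => i _; rewrite gen_valZ e'E.
  rewrite {1}pE linear_sum mulr_sumr; apply: eq_bigr => i _.
  by rewrite !linearZ /= -scalerAl scalerAr.
rewrite !sumE => [|p pt|p ps]; rewrite ?mem_cat ?ps ?pt ?orbT //.
apply: eq_bigr => i _; congr (phi _ * _); apply: v_ext.
have := congr1 (fun z => tens_at z (f i)) st; rewrite !tens_atE !big_map !gen_val_sum => E.
by under eq_bigr do rewrite gen_valZ; under [RHS]eq_bigr do rewrite gen_valZ.
Qed.

Definition img_conv (b : B) : R :=
  \sum_(p <- projT1 (cid (img_dec_ex b))) phi p.1 * psi p.2.

Lemma img_convE b s : img_dec (v b) s -> img_conv b = \sum_(p <- s) phi p.1 * psi p.2.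
Proof. exact: img_dec_uniq (projT2 (cid (img_dec_ex b))). Qed.

Lemma img_conv_lin c a b : img_conv (c *: a + b) = c *: img_conv a + img_conv b.
Proof.
have [[s sa] [t tb]] := conj (img_dec_ex a) (img_dec_ex b).
have := img_dec_lin c sa tb; rewrite -gen_valP_lin => /img_convE ->.
rewrite (img_convE sa) (img_convE tb) big_cat big_map scaler_sumr /=.
by congr (_ + _); apply: eq_bigr => p _; rewrite linearZ /= scalerAl.
Qed.
Fact img_conv_linear : linear img_conv. Proof. exact: img_conv_lin. Qed.
Fact img_conv_multiplicative : monoid_morphism img_conv.
Proof.
split.
  by have := img_dec1; rewrite -(gen_val1 img_gens) => /img_convE ->;
    rewrite big_seq1 !rmorph1 mulr1.
move=> a b; have [[s sa] [t tb]] := conj (img_dec_ex a) (img_dec_ex b).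
have := img_decM sa tb; rewrite -gen_valM => /img_convE ->.
rewrite (img_convE sa) (img_convE tb) big_allpairs_dep mulr_suml.
apply: eq_bigr => p _; rewrite mulr_sumr; apply: eq_bigr => q _ /=.
by rewrite !rmorphM /= mulrACA.
Qed.
HB.instance Definition _ := GRing.isLinear.Build F B R *:%R img_conv img_conv_linear.
HB.instance Definition _ := GRing.isMonoidMorphism.Build B R img_conv img_conv_multiplicative.

End Convolution.

Section PointGroup.
Variable R : comAlgType F.
Local Notation Q := (alg_points B R).
Implicit Types phi psi : Q.

Definition img_mul phi psi : Q := img_conv phi psi : {lrmorphism B -> R}.
Definition img_one : Q := (@unit_map F R) \o (counit rx) \o v : {lrmorphism B -> R}.
Definition img_inv phi : Q := (phi : {lrmorphism B -> R}) \o img_antip : {lrmorphism B -> R}.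

Definition img_X phi := \matrix_(i, j) (phi : {lrmorphism B -> R}) (img_m i j).
Definition img_X' phi := \matrix_(i, j) (phi : {lrmorphism B -> R}) (img_m' i j).

(** A point of [B] is known by its matrix and the inverse matrix, so the group laws become matrix
    identities. *)
Lemma img_ext phi psi : img_X phi = img_X psi -> img_X' phi = img_X' psi -> phi = psi.
Proof.
move=> /matrixP X /matrixP X'; apply: lrmorphism_eq => b.
pose S b' := (phi : {lrmorphism B -> R}) b' = (psi : {lrmorphism B -> R}) b'.
have Ssub : subalg (fun a => exists2 b', S b' & v b' = a).
  exact/subalg_image/subalg_eq.
have [|b' Sb' /v_ext <- //] := gen_valP b Ssub.
move=> _ [i [j [->|->]]].
  by exists (img_m i j); [have := X i j; rewrite !mxE | exact: img_mE].
by exists (img_m' i j); [have := X' i j; rewrite !mxE | exact: img_m'E].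
Qed.

Lemma img_XM phi psi : img_X (img_mul phi psi) = img_X phi *m img_X psi.
Proof.
apply/matrixP => i j; rewrite !mxE; have := @img_dec_m i j.
rewrite -img_mE => /(img_convE phi psi) E; rewrite [LHS]E big_map big_enum.
by apply: eq_bigr => l _; rewrite !mxE.
Qed.
Lemma img_X'M phi psi : img_X' (img_mul phi psi) = img_X' psi *m img_X' phi.
Proof.
apply/matrixP => i j; rewrite !mxE; have := @img_dec_m' i j.
rewrite -img_m'E => /(img_convE phi psi) E; rewrite [LHS]E big_map big_enum.
by apply: eq_bigr => l _; rewrite !mxE mulrC.
Qed.
Lemma img_X1 : img_X img_one = 1%:M.
Proof.
apply/matrixP => i j; rewrite !mxE /= img_mE /counit ev_mx1.
by rewrite rmorph_nat.
Qed.
Lemma img_X'1 : img_X' img_one = 1%:M.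
Proof.
apply/matrixP => i j; rewrite !mxE /= img_m'E /counit ev_antipode invg1 ev_mx1.
by rewrite rmorph_nat.
Qed.
Lemma img_XV phi : img_X (img_inv phi) = img_X' phi.
Proof.
apply/matrixP => i j; rewrite !mxE /=; congr (_ _); apply: v_ext.
by rewrite img_antipE img_mE img_m'E.
Qed.
Lemma img_X'V phi : img_X' (img_inv phi) = img_X phi.
Proof.
apply/matrixP => i j; rewrite !mxE /=; congr (_ _); apply: v_ext.
by rewrite img_antipE img_mE img_m'E antipodeK.
Qed.
Lemma img_mm' i j : \sum_l img_m i l * img_m' l j = (i == j)%:R.
Proof.
apply: v_ext; rewrite gen_val_sum gen_val_nat -(ev_mx1 A) -(mulgV x) ev_mxM.
by apply: eq_bigr => l _; rewrite gen_valM img_mE img_m'E ev_id.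
Qed.
Lemma img_m'm i j : \sum_l img_m' i l * img_m l j = (i == j)%:R.
Proof.
apply: v_ext; rewrite gen_val_sum gen_val_nat -(ev_mx1 A) -(mulVg x) ev_mxM.
by apply: eq_bigr => l _; rewrite gen_valM img_mE img_m'E ev_id.
Qed.
Lemma img_XX' phi : img_X phi *m img_X' phi = 1%:M.
Proof.
apply/matrixP => i j; rewrite !mxE.
have := congr1 (phi : {lrmorphism B -> R}) (img_mm' i j).
rewrite linear_sum rmorph_nat => <-; apply: eq_bigr => l _.
by rewrite !mxE rmorphM.
Qed.
Lemma img_X'X phi : img_X' phi *m img_X phi = 1%:M.
Proof.
apply/matrixP => i j; rewrite !mxE.
have := congr1 (phi : {lrmorphism B -> R}) (img_m'm i j).
rewrite linear_sum rmorph_nat => <-; apply: eq_bigr => l _.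
by rewrite !mxE rmorphM.
Qed.

Fact img_mulA : associative img_mul.
Proof. by move=> f g h; apply: img_ext; rewrite ?img_XM ?img_X'M mulmxA. Qed.
Fact img_mul1g : left_id img_one img_mul.
Proof.
by move=> f; apply: img_ext; rewrite ?img_XM ?img_X'M ?img_X1 ?img_X'1 ?mul1mx ?mulmx1.
Qed.
Fact img_mulg1 : right_id img_one img_mul.
Proof.
by move=> f; apply: img_ext; rewrite ?img_XM ?img_X'M ?img_X1 ?img_X'1 ?mul1mx ?mulmx1.
Qed.
Fact img_mulVg : left_inverse img_one img_inv img_mul.
Proof.
move=> f; apply: img_ext.
  by rewrite img_XM img_XV img_X'X img_X1.
by rewrite img_X'M img_X'V img_X'X img_X'1.
Qed.
Fact img_mulgV : right_inverse img_one img_inv img_mul.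
Proof.
move=> f; apply: img_ext.
  by rewrite img_XM img_XV img_XX' img_X1.
by rewrite img_X'M img_X'V img_XX' img_X'1.
Qed.

Definition img_points : Type := Q.
HB.instance Definition _ := Choice.on img_points.
HB.instance Definition _ :=
  isGroup.Build img_points img_mulA img_mul1g img_mulg1 img_mulVg img_mulgV.

End PointGroup.

Section PointMap.
Variables (R S : comAlgType F) (f : {lrmorphism R -> S}).

Definition img_pmap (phi : img_points R) : img_points S :=
  f \o (phi : {lrmorphism B -> R}) : {lrmorphism B -> S}.

Lemma img_X_pmap phi : img_X (img_pmap phi) = map_mx f (img_X phi).
Proof. by apply/matrixP => i j; rewrite !mxE. Qed.
Lemma img_X'_pmap phi : img_X' (img_pmap phi) = map_mx f (img_X' phi).
Proof. by apply/matrixP => i j; rewrite !mxE. Qed.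

Fact img_pmap_mul : {morph img_pmap : phi psi / (phi * psi)%g}.
Proof.
move=> phi psi; apply: img_ext.
  rewrite img_X_pmap (img_XM phi psi : img_X (phi * psi)%g = _).
  by rewrite map_mxM -!img_X_pmap; exact/esym/img_XM.
rewrite img_X'_pmap (img_X'M phi psi : img_X' (phi * psi)%g = _).
by rewrite map_mxM -!img_X'_pmap; exact/esym/img_X'M.
Qed.
HB.instance Definition _ := isMultiplicative.Build (img_points R) (img_points S)
  img_pmap img_pmap_mul.
End PointMap.

Fact img_pmap_id (R : comAlgType F) (phi : img_points R) :
  img_pmap (idfun : {lrmorphism R -> R}) phi = phi.
Proof. exact: lrmorphism_eq. Qed.
Fact img_pmap_comp (R S T : comAlgType F) (f : {lrmorphism R -> S})
    (h : {lrmorphism S -> T}) (phi : img_points R) :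
  img_pmap (h \o f : {lrmorphism R -> T}) phi = img_pmap h (img_pmap f phi).
Proof. exact: lrmorphism_eq. Qed.

Definition img_group : group_functor F :=
  @GroupFunctor F img_points img_pmap img_pmap_id img_pmap_comp.

Definition img_proj (R : comAlgType F) (g : U R) : img_points R :=
  ev rx g \o v : {lrmorphism B -> R}.

Fact img_proj_mul R : {morph @img_proj R : g h / (g * h)%g}.
Proof.
move=> g h; apply: img_ext; rewrite ?[RHS]img_XM ?[RHS]img_X'M.
  apply/matrixP => i j; rewrite !mxE /= img_mE ev_mxM.
  by apply: eq_bigr => l _; rewrite !mxE /= !img_mE.
apply/matrixP => i j; rewrite !mxE /= img_m'E ev_antipode invgM ev_mxM.
by apply: eq_bigr => l _; rewrite !mxE /= !img_m'E !ev_antipode.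
Qed.
HB.instance Definition _ R := isMultiplicative.Build (U R) (img_points R)
  (@img_proj R) (@img_proj_mul R).

Fact img_proj_natural (R S : comAlgType F) (f : {lrmorphism R -> S}) (g : U R) :
  img_proj (pmap U f g) = pmap img_group f (img_proj g).
Proof. by apply: lrmorphism_eq => b /=; rewrite ev_pmap. Qed.

Definition img_hom : group_hom U img_group :=
  @GroupHom F U img_group img_proj img_proj_natural.

Definition img_point : img_group B := (idfun : {lrmorphism B -> B}).

Lemma img_represents : represents img_point.
Proof.
move=> R phi; exists phi; first exact: lrmorphism_eq.
by move=> psi <- b.
Qed.

Lemma img_quotient : quotient_map img_hom.
Proof.
exists A, B, x, img_point, v; split; last exact: gen_val_inj.
split=> //; first exact: img_represents.
by apply: lrmorphism_eq => b /=; rewrite ev_id.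
Qed.

Lemma img_fin_gen : fin_gen_algebra B.
Proof.
pose s := [seq img_m p.1 p.2 | p <- enum {: 'I_n * 'I_n}] ++
  [seq img_m' p.1 p.2 | p <- enum {: 'I_n * 'I_n}].
apply/fin_gen_algebraP; exists s => b.
have Ssub := subalg_image v (subalg_gen (fun c => c \in s)).
have [|b' Sb' /v_ext <- //] := gen_valP b Ssub.
move=> _ [i [j [->|->]]].
  exists (img_m i j); last exact: img_mE.
  apply: gen_sub; rewrite mem_cat; apply/orP; left.
  by apply/mapP; exists (i, j); rewrite ?mem_enum.
exists (img_m' i j); last exact: img_m'E.
apply: gen_sub; rewrite mem_cat; apply/orP; right.
by apply/mapP; exists (i, j); rewrite ?mem_enum.
Qed.

Lemma img_algebraic : algebraic img_group.
Proof.
exists B, img_point; split; [exact: img_represents | exact: img_fin_gen].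
Qed.

End ImageGroup.

Section ProUnipotentQuotients.
Variables (F : fieldType) (U : group_functor F) (A : comAlgType F) (x : U A).
Hypothesis rx : represents x.

(** The quotient is the image of [U] under a representation that has [a] among its coefficients. *)
Lemma algebraic_quotient (a : A) : exists (Q : group_functor F) (p : group_hom U Q)
    (B : comAlgType F) (y : Q B) (ry : represents y) (b : B),
  [/\ algebraic Q, quotient_map p
    & forall (R : comAlgType F) (g : U R), ev rx g a = ev ry (p R g) b].
Proof.
have [n [m [xi [w [mR aE]]]]] := mx_rep_comodule rx a.
have ga : gen (img_gens rx m) a.
  rewrite aE; have L := subalg_lin (subalg_gen (img_gens rx m)).
  apply: (lin_closed_sum _ L) => i _; apply: (lin_closed_sum _ L) => j _.
  by apply: (lin_closedZ _ L); apply: gen_sub; exists i, j; left.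
have [b ba] := gen_valK ga.
have ry := img_represents (mR := mR).
exists (img_group mR), (img_hom mR), _, (img_point mR), ry, b.
split; [exact: img_algebraic | exact: img_quotient | move=> R g].
rewrite -ba -(ev_uniq ry (g := img_hom mR R g)
  (phi := (ev rx g \o @gen_val F A _ : {lrmorphism _ -> R})) _ b) //.
exact: lrmorphism_eq.
Qed.

End ProUnipotentQuotients.

(** * Unitriangular groups *)

Section PolynomialEvaluation.
Variables (F : fieldType) (n : nat) (R : comAlgType F) (h : 'I_n -> R).

Definition poly_eval : mpoly n F -> R := mmap (GRing.in_alg R) h.

HB.instance Definition _ := GRing.RMorphism.on poly_eval.
Fact poly_eval_scalable : scalable poly_eval.
Proof. by move=> c p; rewrite /poly_eval mmapZ /= -scalerAl mul1r. Qed.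
HB.instance Definition _ :=
  GRing.isScalable.Build F (mpoly n F) R *:%R poly_eval poly_eval_scalable.

End PolynomialEvaluation.

Section UnitriangularScheme.
Variables (F : fieldType) (N : nat).

(** The universal matrix [y] has entries in the generated subalgebra and so comes from a point [y0]
    over it; the value of [c] at [y0] exhibits [c] as an element of that subalgebra. *)
Lemma ut_gen (C : comAlgType F) (y : UT N F C) : represents y ->
  forall c, gen (fun b => exists i j, b = val y i j) c.
Proof.
move=> ry c; set P := (fun _ => _).
have yP i j : gen P (val y i j) by apply: gen_sub; exists i, j.
pose z := choice (fun p => gen_valK (yP p.1 p.2)).
have [f fE] := z; pose M : 'M[gen_alg P]_N := \matrix_(i, j) f (i, j).
have MU : M \in @unitriangular N (gen_alg P).
  apply/unitriangularP => i j ji; rewrite mxE; apply: gen_val_inj.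
  rewrite fE gen_val_nat.
  by have /unitriangularP := valP y; apply.
pose y0 : UT N F (gen_alg P) := exist _ M MU.
have vy0 : pmap (UT N F) (@gen_val F C P) y0 = y.
  by apply: val_inj; apply/matrixP => i j; rewrite !mxE /= fE.
have E : ev ry y c = gen_val (ev ry y0 c) by rewrite -ev_pmap vy0.
by rewrite -(ev_id ry c) E; exact: gen_valP.
Qed.

Let X : 'M[mpoly (N * N) F]_N := \matrix_(i, j)
  if (j <= i)%N then (i == j)%:R else mpolyX F (mnm1 (mxvec_index i j)).
Let P : mpoly (N * N) F -> Prop := fun a => exists i j, a = X i j.

(** The variables are indexed by all N * N positions, and those on and below the diagonal do not
    occur in [X]. Passing to the subalgebra generated by the entries of [X] removes them, as the
    uniqueness of the representing morphism demands. *)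
Lemma UT_affine : affine (UT N F).
Proof.
have XP i j : gen P (X i j) by apply: gen_sub; exists i, j.
have [f fE] := choice (fun p => gen_valK (XP p.1 p.2)).
pose M : 'M[gen_alg P]_N := \matrix_(i, j) f (i, j).
have MU : M \in @unitriangular N (gen_alg P).
  apply/unitriangularP => i j ji; rewrite mxE; apply: gen_val_inj.
  by rewrite fE gen_val_nat mxE ji.
exists (gen_alg P), (exist _ M MU : UT N F (gen_alg P)) => R g.
pose phi1 : {lrmorphism mpoly (N * N) F -> R} :=
  poly_eval (fun k => mxvec (val g) 0 k).
have phiM i j : phi1 (X i j) = val g i j.
  rewrite mxE; case: ifP => ji.
    by rewrite rmorph_nat; have /unitriangularP -> := valP g.
  by rewrite /phi1 /= /poly_eval mmapX mmap1U mxvecE.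
exists (phi1 \o @gen_val F _ P : {lrmorphism _ -> R}).
  by apply: val_inj; apply/matrixP => i j; rewrite !mxE /= fE phiM.
move=> psi psig b.
set chi := (phi1 \o _ : {lrmorphism _ -> R}).
have Ssub := subalg_image (@gen_val F _ P) (subalg_eq psi chi).
have [|b' Sb' /gen_val_inj <- //] := gen_valP b Ssub.
move=> _ [i [j ->]]; exists (f (i, j)); last exact: fE.
rewrite /= fE phiM -psig mxE /= mxE; congr (psi _).
Qed.

End UnitriangularScheme.

(** * Nilpotent functions on a group *)

Section NilpotentFunctions.
Variables (G : groupType) (R : comNzRingType).
Implicit Types (f : G -> R) (n : nat).

Definition diff (h : G) f : G -> R := fun g => f (g * h)%g - f g.

(** All [n]-fold differences vanish: a group analogue of polynomial functions of degree less than
    [n]. *)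
Fixpoint nilp n f : Prop :=
  if n is p.+1 then forall h, nilp p (diff h f) else forall g, f g = 0.

Lemma nilp_ext n f f' : f =1 f' -> nilp n f -> nilp n f'.
Proof. by move=> /funext ->. Qed.

Lemma nilp0 n : nilp n (fun _ => 0).
Proof.
elim: n => //= n IH h; apply: nilp_ext IH => g.
by rewrite /diff subrr.
Qed.

Lemma nilpS n f : nilp n f -> nilp n.+1 f.
Proof.
elim: n f => [|n IH] f nf h; last exact/IH/nf.
by move=> g; rewrite /diff !nf subrr.
Qed.

Lemma nilp_le n p f : (n <= p)%N -> nilp n f -> nilp p f.
Proof. by move=> /subnK <- nf; elim: (p - n)%N => // d; exact: nilpS. Qed.

Lemma nilpD n f f' : nilp n f -> nilp n f' -> nilp n (fun g => f g + f' g).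
Proof.
elim: n f f' => [|n IH] f f' nf nf'; first by move=> g; rewrite nf nf' addr0.
move=> h; apply: nilp_ext (IH _ _ (nf h) (nf' h)) => g.
by rewrite /diff opprD addrACA.
Qed.

(** Induction on a bound for n + p, by the Leibniz rule d(f f') = df df' + df f' + f df'. *)
Lemma nilpM n p f f' : nilp n f -> nilp p f' -> nilp (n + p) (fun g => f g * f' g).
Proof.
move: {2}(n + p)%N (leqnn (n + p)) => d; elim: d n p f f' => [|d IH] [|n] [|p] f f' //.
- by move=> _ nf _ g; rewrite nf mul0r.
- by move=> _ nf _; apply: nilp_ext (nilp0 _) => g; rewrite nf mul0r.
- by move=> _ nf _; apply: nilp_ext (nilp0 _) => g; rewrite nf mul0r.
- by move=> _ _ nf'; apply: nilp_ext (nilp0 _) => g; rewrite nf' mulr0.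
rewrite addSn addnS !ltnS => le nf nf' h.
have N1 : nilp (n + p).+1 (fun g => diff h f g * diff h f' g).
  by apply/nilpS/IH => //; exact: leq_trans (leqnSn _) le.
have N2 : nilp (n + p).+1 (fun g => diff h f g * f' g).
  by rewrite -addnS; apply: IH => //; rewrite addnS.
have N3 : nilp (n + p).+1 (fun g => f g * diff h f' g).
  by rewrite -addSn; apply: IH => //; rewrite addSn.
apply: nilp_ext (nilpD N1 (nilpD N2 N3)) => g.
by rewrite /diff; ring.
Qed.

Lemma nilpZ n c f : nilp n f -> nilp n (fun g => c * f g).
Proof.
elim: n f => [|n IH] f nf /=; first by move=> g; rewrite nf mulr0.
by move=> h; apply: nilp_ext (IH _ (nf h)) => g; rewrite /diff mulrBr.
Qed.

Lemma nilp_cst c : nilp 1 (fun _ => c).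
Proof. by move=> h g; rewrite /diff subrr. Qed.

Variables (d : nat) (r : G -> 'M[R]_d).
Hypothesis rM : forall g h, r (g * h)%g = r g *m r h.
Hypothesis r1 : r 1%g = 1%:M.

Definition aug_prod (s : seq G) : 'M[R]_d :=
  foldr (fun h D => (r h - 1%:M) *m D) 1%:M s.

Lemma aug_prod_rcons s h : aug_prod (rcons s h) = aug_prod s *m (r h - 1%:M).
Proof.
elim: s => [|g s IH] /=; first by rewrite mulmx1 mul1mx.
by rewrite IH mulmxA.
Qed.

(** Differencing g |-> r(g) C along [h] replaces [C] by (r(h) - 1) C. After [n] differences the
    function is zero, in particular at g = 1. *)
Lemma nilp_aug_prod n (C : 'M[R]_d) :
  (forall i j, nilp n (fun g => (r g *m C) i j)) ->
  forall s, size s = n -> aug_prod s *m C = 0.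
Proof.
elim: n C => [|n IH] C nC s sn.
  move/size0nil: sn => ->; rewrite mul1mx -[C]mul1mx -r1.
  by apply/matrixP => i j; rewrite nC mxE.
case/lastP: s sn => // s h; rewrite size_rcons => -[sn].
rewrite aug_prod_rcons -mulmxA; apply: IH => // i j.
apply: nilp_ext (nC i j h) => g.
by rewrite /diff rM mulmxA mulmxBr mulmx1 mulmxBl !mxE.
Qed.

(** The induction runs over r(g) C with [C] supported on the entries j >= i + k: each difference
    multiplies [C] by the strictly upper triangular r(h) - 1, which raises [k] by one. *)
Lemma nilp_unitriangular : (forall g, r g \in @unitriangular d R) ->
  forall i j, nilp d (fun g => r g i j).
Proof.
move=> rU; have N k (C : 'M[R]_d) : (forall i j : 'I_d, (j < i + k)%N -> C i j = 0) ->
    forall i j, nilp (d - k) (fun g => (r g *m C) i j).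
  move dk : (d - k)%N => e; elim: e k dk C => [|e IH] k dk C Ck i j.
    have -> : C = 0.
      apply/matrixP => a b; rewrite mxE Ck // (leq_trans (ltn_ord b)) //.
      by rewrite (leq_trans _ (leq_addl a k)) // -subn_eq0 dk.
    by move=> g; rewrite mulmx0 mxE.
  move=> h; apply: nilp_ext (IH k.+1 _ ((r h - 1%:M) *m C) _ i j); first last.
  - move=> a b; rewrite addnS ltnS leq_eqVlt => ba; rewrite mxE big1 // => l _.
    have [la|al] := leqP l a.
      have /unitriangularP := rU h; rewrite !mxE => -> //.
      by rewrite subrr mul0r.
    rewrite Ck ?mulr0 //; apply: leq_ltn_trans (_ : (a + k < l + k)%N).
      by case/orP: ba => [/eqP ->|/ltnW].
    by rewrite ltn_add2r.
  - by rewrite subnS dk.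
  - by move=> g; rewrite /diff rM mulmxA mulmxBr mulmx1 mulmxBl !mxE.
move=> i j; have := N 0%N 1%:M _ i j; rewrite subn0 => N0.
apply: nilp_ext (N0 _) => [g|a b]; first by rewrite mulmx1.
by rewrite addn0 mxE; case: eqP => // ->; rewrite ltnn.
Qed.

End NilpotentFunctions.

(** * Simultaneous triangularization of nilpotent families *)

Section Triangularization.
Variable F : fieldType.

Lemma col_vector_base d (v : 'cV[F]_d.+1) : v != 0 ->
  exists2 P : 'M[F]_d.+1, P \in unitmx & P *m v = delta_mx 0 0.
Proof.
move=> v0; have rv : \rank v = 1%N.
  apply/eqP; rewrite eqn_leq lt0n mxrank_eq0 v0 andbT.
  exact: rank_leq_col.
have e0 : row_ebase v 0 0 != 0.
  by have := row_ebase_unit v; rewrite unitmxE det_mx11 unitfE.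
exists ((row_ebase v 0 0)^-1 *: invmx (col_ebase v)).
  by rewrite unitmxZ ?unitmx_inv ?col_ebase_unit // unitfE invr_eq0.
rewrite -{3}(mulmx_ebase v) rv -scalemxAl !mulmxA mulVmx ?col_ebase_unit // mul1mx.
apply/matrixP => i j; rewrite !mxE big_ord1 !mxE (ord1 j) andbT mulrCA mulVf // mulr1.
by case: i => [[|i] Hi].
Qed.

Lemma block_col0 d (M : 'M[F]_(1 + d)) : (forall i, M i 0 = 0) ->
  M = block_mx 0 (ursubmx M) 0 (drsubmx M).
Proof.
move=> M0; rewrite -{1}[M]submxK; congr (block_mx _ _ _ _).
  apply/matrixP => i j; rewrite !mxE (ord1 j) -[RHS](M0 (lshift d i)).
  by congr (M _ _); apply: val_inj.
apply/matrixP => i j; rewrite !mxE (ord1 j) -[RHS](M0 (rshift 1 i)).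
by congr (M _ _); apply: val_inj.
Qed.

Lemma block_strict d (u : 'rV[F]_d) (e : 'M[F]_d) :
  (forall i j : 'I_d, (j <= i)%N -> e i j = 0) ->
  forall i j : 'I_(1 + d), (j <= i)%N ->
    (block_mx 0 u 0 e : 'M[F]_(1 + d)) i j = 0.
Proof.
move=> eS i j; case: (split_ordP i) => a ->; case: (split_ordP j) => b -> ji.
- by rewrite block_mxEul mxE.
- by move: ji; rewrite /= (ord1 a).
- by rewrite block_mxEdl mxE.
- by rewrite block_mxEdr eS.
Qed.

(** As in Engel's theorem: a nonzero column of a longest nonvanishing product is killed by all of
    [S], and the induction continues modulo that vector. *)
Lemma nilpotent_triangularizable d (S : 'M[F]_d -> Prop) n :
  (forall s : seq 'M[F]_d, size s = n -> (forall M, M \in s -> S M) ->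
     foldr mulmx 1%:M s = 0) ->
  exists c c' : 'M[F]_d, [/\ c *m c' = 1%:M, c' *m c = 1%:M
    & forall M, S M -> forall i j : 'I_d, (j <= i)%N -> (c *m M *m c') i j = 0].
Proof.
elim: d S n => [|d IH] S n nS.
  by exists 1%:M, 1%:M; split; rewrite ?mulmx1 // => M _ [].
have [v v0 Sv] : exists2 v : 'cV[F]_d.+1, v != 0 & forall M, S M -> M *m v = 0.
  elim: n nS => [|n IHn] nS.
    have /matrixP/(_ 0 0)/eqP := nS [::] erefl (fun M => ltac:(by [])).
    by rewrite !mxE oner_eq0.
  have [[s [sn sS s0]]|no] := pselect (exists s : seq 'M[F]_d.+1,
      [/\ size s = n, forall M, M \in s -> S M & foldr mulmx 1%:M s <> 0]); last first.
    apply: IHn => s sn sS; apply: contrapT => s0; apply: no; by exists s.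
  have [j cj] : exists j, col j (foldr mulmx 1%:M s) != 0.
    apply: contrapT => no; apply: s0; apply/matrixP => i j.
    have : col j (foldr mulmx 1%:M s) = 0.
      by apply/eqP/negPn/negP => cj; apply: no; exists j.
    by move/matrixP/(_ i 0); rewrite !mxE.
  exists (col j (foldr mulmx 1%:M s)) => // M SM.
  have MD : M *m foldr mulmx 1%:M s = 0.
    apply: (nS (M :: s)); first by rewrite /= sn.
    by move=> M'; rewrite inE => /orP [/eqP -> //|/sS].
  by rewrite colE mulmxA MD mul0mx.
have [P Pu Pv] := col_vector_base v0.
pose J (M : 'M[F]_d.+1) : 'M[F]_(1 + d) := P *m M *m invmx P.
have JE M : S M -> J M = block_mx 0 (ursubmx (J M)) 0 (drsubmx (J M)).
  move=> SM; apply: block_col0 => i.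
  have : P *m M *m invmx P *m delta_mx 0 (0 : 'I_1) = 0.
    by rewrite -Pv mulmxA mulmxKV // -mulmxA Sv // mulmx0.
  by move/matrixP/(_ i 0); rewrite -colE !mxE.
have JM M M' : J (M *m M') = J M *m J M'.
  by rewrite /J -!mulmxA (mulmxA (invmx P) P) mulVmx // mul1mx.
have J1 : J 1%:M = 1%:M by rewrite /J mulmx1 mulmxV.
(* In a basis starting with [v] every member of [S] has zero first column; [T] collects the actions
   on the quotient by the line of [v]. *)
pose T := fun N : 'M[F]_d => exists2 M, S M & N = drsubmx (J M).
have [|c [c' [cc' c'c cT]]] := IH T n.
  move=> s sn sT.
  have [s' [s's sS]] : exists s', map (fun M => drsubmx (J M)) s' = s /\
      forall M, M \in s' -> S M.
    elim: s sT {sn} => [|N s IHs] sT; first by exists [::].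
    have [M SM ->] := sT N (mem_head _ _).
    have [|s' [<- sS]] := IHs; first by move=> M' sM'; apply: sT; rewrite inE sM' orbT.
    exists (M :: s'); split=> // M'; rewrite inE => /orP [/eqP -> //|/sS //].
  have s's0 : size s' = n by rewrite -sn -s's size_map.
  have <- : drsubmx (J (foldr mulmx 1%:M s')) = foldr mulmx 1%:M s.
    rewrite -s's; elim: s' sS {s's s's0} => [|M s' IHs] sS /=.
      by rewrite J1 (scalar_mx_block 1 d) block_mxKdr.
    rewrite -IHs; last by move=> M' sM'; apply: sS; rewrite inE sM' orbT.
    have SM : S M by apply: sS; rewrite mem_head.
    rewrite JM (JE M SM).
    have dr (X Y : 'M[F]_(1 + d)) : drsubmx (block_mx 0 (ursubmx X) 0 (drsubmx X) *m Y) =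
        drsubmx X *m drsubmx Y.
      by rewrite -[in LHS](submxK Y) mulmx_block block_mxKdr mul0mx add0r.
    by rewrite dr block_mxKdr.
  have s'0 : foldr mulmx 1%:M s' = 0 by exact: nS.
  rewrite [foldr _ _ _]s'0 /J mulmx0 mul0mx.
  by apply/matrixP => i j; rewrite !mxE.
pose B (e : 'M[F]_d) : 'M[F]_(1 + d) := block_mx 1%:M 0 0 e.
have BB e e' : e *m e' = 1%:M -> B e *m B e' = 1%:M.
  move=> ee'; rewrite /B mulmx_block !mul1mx !mulmx0 !mul0mx !addr0 add0r ee'.
  by rewrite -scalar_mx_block.
exists (B c *m P), (invmx P *m B c'); split.
- by rewrite mulmxA -(mulmxA (B c)) mulmxV // mulmx1 BB.
- by rewrite mulmxA -(mulmxA (invmx P)) BB // mulmx1 mulVmx.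
move=> M SM; have -> : B c *m P *m M *m (invmx P *m B c') = B c *m J M *m B c'.
  by rewrite /J !mulmxA.
rewrite JE // /B !mulmx_block !(mulmx0, mul0mx, mulmx1, mul1mx, addr0, add0r).
by apply: block_strict => i j ji; rewrite cT //; exists M.
Qed.

End Triangularization.

Definition scal_mx (F : fieldType) (R : comAlgType F) m n (c : 'M[F]_(m, n)) : 'M[R]_(m, n) :=
  map_mx (GRing.in_alg R) c.

Lemma map_scal_mx (F : fieldType) (R S : comAlgType F) (f : {lrmorphism R -> S}) m n
  (c : 'M[F]_(m, n)) : map_mx f (scal_mx R c) = scal_mx S c.
Proof. by apply/matrixP => i j; rewrite !mxE /= linearZ rmorph1. Qed.

Lemma scal_mxM (F : fieldType) (R : comAlgType F) m n p (c : 'M[F]_(m, n)) (d : 'M[F]_(n, p)) :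
  scal_mx R (c *m d) = scal_mx R c *m scal_mx R d.
Proof. exact: map_mxM. Qed.

Lemma scal_mx1 (F : fieldType) (R : comAlgType F) n : scal_mx R (1%:M : 'M[F]_n) = 1%:M.
Proof. exact: map_mx1. Qed.

Section HomEvaluation.
Variables (F : fieldType) (U Q : group_functor F) (f : group_hom U Q).
Variables (A B : comAlgType F) (x : U A) (y : Q B).
Hypotheses (rx : represents x) (ry : represents y).

Lemma ev_hom (R : comAlgType F) (g : U R) b :
  ev ry (f R g) b = ev rx g (ev ry (f A x) b).
Proof. by rewrite -ev_pmap -hom_natural pmap_ev. Qed.

Lemma comorphismE (phi : {lrmorphism B -> A}) : comorphism f x y phi ->
  phi =1 ev ry (f A x).
Proof. by case=> _ _ /(ev_uniq ry). Qed.

End HomEvaluation.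

Section UtGenerated.
Variables (F : fieldType) (U : group_functor F).

Definition ut_entry (A : comAlgType F) (x : U A) (a : A) : Prop :=
  exists n (f : group_hom U (UT n F)) i j, a = val (f A x) i j.

Definition ut_generated (A : comAlgType F) (x : U A) : Prop := forall a, gen (ut_entry x) a.

Lemma ev_ut (A : comAlgType F) (x : U A) (rx : represents x) n (f : group_hom U (UT n F))
    (R : comAlgType F) (g : U R) i j :
  ev rx g (val (f A x) i j) = val (f R g) i j.
Proof. by rewrite -{2}(pmap_ev rx g) hom_natural mxE. Qed.

Lemma ut_generated_transfer (A A' : comAlgType F) (x : U A) (x' : U A') :
  represents x -> represents x' -> ut_generated x -> ut_generated x'.
Proof.
move=> rx rx' gx a; have -> : a = ev rx x' (ev rx' x a).
  by rewrite -(ev_pmap rx') pmap_ev ev_id.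
apply: gen_map (gx (ev rx' x a)) => _ [n [f [i [j ->]]]].
by rewrite ev_ut; apply: gen_sub; exists n, f, i, j.
Qed.

(** Functions with such a bound form a subalgebra by [nilpM], and it contains the unitriangular
    entries. The bound is uniform in [R] because it will be applied to points over algebras R (x)
    A. *)
Lemma ut_nilp (A : comAlgType F) (x : U A) (rx : represents x) : ut_generated x ->
  forall a, exists n, forall R : comAlgType F, nilp n (fun g : U R => ev rx g a).
Proof.
move=> gx a; pose S b := exists n, forall R : comAlgType F, nilp n (fun g : U R => ev rx g b).
apply: (gx a S) => [|_ [n [f [i [j ->]]]]].
  split.
  - exists 1%N => R; have N1 := nilp_cst (G := U R) (1 : R).
    by apply: nilp_ext N1 => g; rewrite rmorph1.
  - move=> c u v [n nu] [p nv]; exists (maxn n p) => R.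
    have N1 := nilpZ (c *: 1) (nilp_le (leq_maxl n p) (nu R)).
    apply: nilp_ext (nilpD N1 (nilp_le (leq_maxr n p) (nv R))) => g.
    by rewrite linearP -scalerAl mul1r.
  - move=> u v [n nu] [p nv]; exists (n + p)%N => R.
    by apply: nilp_ext (nilpM (nu R) (nv R)) => g; rewrite rmorphM.
exists n => R; apply: nilp_ext (nilp_unitriangular (r := fun g => val (f R g)) _ _ i j).
- by move=> g; rewrite ev_ut.
- by move=> g h; rewrite gmulfM.
- by move=> g; exact: valP.
Qed.

End UtGenerated.

(** * Conjugating representations into unitriangular form *)

Section Conjugation.
Variables (F : fieldType) (U Q : group_functor F) (q : group_hom U Q).
Variables (A B : comAlgType F) (x : U A) (y : Q B).
Hypotheses (rx : represents x) (ry : represents y) (gx : ut_generated x).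
Hypothesis q_inj : injective (ev ry (q A x)).
Variables (n : nat) (m : 'M[B]_n).
Hypothesis mR : mx_rep ry m.

Let r (R : comAlgType F) (g : U R) : 'M[R]_n := map_mx (ev ry (q R g)) m.

Let rM (R : comAlgType F) (g h : U R) : r (g * h)%g = r g *m r h.
Proof. by rewrite /r gmulfM mR.1. Qed.

Let r1 (R : comAlgType F) : r (1%g : U R) = 1%:M.
Proof. by rewrite /r mult1 mR.2. Qed.

Let r_pmap (R S : comAlgType F) (f : {lrmorphism R -> S}) (g : U R) :
  r (pmap U f g) = map_mx f (r g).
Proof. by apply/matrixP => i j; rewrite !mxE hom_natural ev_pmap. Qed.

Let augN : exists N, forall (R : comAlgType F) (s : seq (U R)), size s = N ->
  aug_prod (@r R) s = 0.
Proof.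
have [d dP] := choice (fun p : 'I_n * 'I_n => ut_nilp rx gx (ev ry (q A x) (m p.1 p.2))).
exists (\max_p d p)%N => R s sN.
rewrite -[aug_prod _ _]mulmx1; apply: (nilp_aug_prod (@rM R) (r1 R)) sN => i j.
have le : (d (i, j) <= \max_p d p)%N by exact: leq_bigmax.
apply: nilp_ext (nilp_le le (dP (i, j) R)) => g.
by rewrite mulmx1 /r [RHS]mxE; exact/esym/ev_hom.
Qed.

(** The constant coefficient matrices of r(x) - 1. Functionals separate the points of [A], so
    triangularizing all of them over [F] triangularizes r(x) - 1. *)
Let co (a : {scalar A}) : 'M[F]_n := \matrix_(i, j) a ((r x - 1%:M) i j).

(** Each step trades a point of [U] for a functional: the extra point is the universal one over the
    right factor of R (x) A, and applying [a] to that factor turns its r(z) - 1 into [co a]. With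
    [s] empty, products of [N] matrices [co a] vanish. *)
Let aug_co N (R : comAlgType F) (s : seq (U R)) (t : seq {scalar A}) :
  (forall (R : comAlgType F) (s : seq (U R)), size s = N -> aug_prod (@r R) s = 0) ->
  (size s + size t)%N = N ->
  aug_prod (@r R) s *m scal_mx R (foldr (fun a D => co a *m D) 1%:M t) = 0.
Proof.
move=> N0; elim: t R s => [|a t IH] R s /=.
  by rewrite addn0 => /N0 ->; rewrite mul0mx.
rewrite addnS => sN; set D := foldr _ _ t.
pose l := pmap U (@tinl F R A); pose z := pmap U (@tinr F R A) x.
have := IH _ (rcons (map l s) z); rewrite size_rcons size_map => /(_ sN).
have -> : aug_prod (@r _) (rcons (map l s) z) =
    map_mx (@tinl F R A) (aug_prod (@r R) s) *m map_mx (@tinr F R A) (r x - 1%:M).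
  rewrite aug_prod_rcons map_mxB map_mx1 -r_pmap; congr (_ *m _).
  elim: s {sN} => [|h s IHs] /=; first by rewrite map_mx1.
  by rewrite IHs map_mxM map_mxB map_mx1 r_pmap.
move=> E; apply/matrixP => i k.
have := congr1 (fun M : 'M_n => tens_at (M i k) a) E.
rewrite [in X in _ = X]mxE -/D => {}E; rewrite [RHS]mxE.
have {E} : tens_at ((map_mx (@tinl F R A) (aug_prod (@r R) s) *m
   (map_mx (@tinr F R A) (r x - 1%:M) *m scal_mx (tensor R A) D)) i k) a = 0.
  by rewrite mulmxA E tens_atE big_nil.
move=> <-; rewrite !mxE tens_at_sum; apply: eq_bigr => j _.
rewrite [map_mx _ _ i j]mxE tens_at_tinl; congr (_ * _).
rewrite !mxE /= tens_at_sum scaler_suml; apply: eq_bigr => p _.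
rewrite [map_mx _ _ j p]mxE !mxE /= -scalerAr mulr1.
by rewrite tens_atZ tens_at_tinr scalerA mulrC ?mxE.
Qed.

(** With [q] the identity this makes every function on [U] a coefficient of a unitriangular
    representation; with [q] a quotient map it embeds algebraic quotients in unitriangular
    groups. *)
Lemma unipotent_conj : exists c c' : 'M[F]_n, [/\ c *m c' = 1%:M, c' *m c = 1%:M
  & exists rho : group_hom Q (UT n F), forall (R : comAlgType F) (g : Q R),
      val (rho R g) = scal_mx R c *m map_mx (ev ry g) m *m scal_mx R c'].
Proof.
have [N N0] := augN.
have [|c [c' [cc' c'c cS]]] :=
    @nilpotent_triangularizable F n (fun M => exists a, M = co a) N.
  move=> s sN sS.
  have [t ts] : exists t, s = map co t.
    elim: s sS {sN} => [|M s IH] sS; first by exists [::].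
    have [a ->] := sS M (mem_head _ _).
    have [|t ->] := IH; first by move=> M' sM'; apply: sS; rewrite inE sM' orbT.
    by exists (a :: t).
  have tN : (size (Nil (U F^o)) + size t)%N = N by rewrite -sN ts size_map.
  have := aug_co N0 tN; rewrite mul1mx => /matrixP E.
  apply/matrixP => i j; have := E i j; rewrite !mxE /= => /eqP.
  rewrite scaler_eq0 oner_eq0 orbF => /eqP <-; congr (fun_of_matrix _ i j).
  by rewrite ts; elim: t {ts tN E} => //= a t ->.
exists c, c'; split=> //.
pose m' := scal_mx B c *m m *m scal_mx B c'.
(* A wrong entry of [m'] would stay nonzero in [A] by [q_inj], hence have value 1 under some
   functional [a], against the triangular shape of the conjugate of [co a]. *)
have m'U : m' \in @unitriangular n B.
  apply/unitriangularP => i j ji; apply/eqP; rewrite -subr_eq0; apply/eqP.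
  apply: q_inj; rewrite rmorph0; apply/eqP/negPn/negP => /functional_exists [a a1].
  have := cS (co a) (ex_intro _ a erefl) i j ji; rewrite -[RHS](linear0 a) => /eqP.
  suff -> : (c *m co a *m c') i j = a (ev ry (q A x) (m' i j - (i == j)%:R)).
    by rewrite a1 linear0 oner_eq0.
  have -> : ev ry (q A x) (m' i j - (i == j)%:R) =
      (scal_mx A c *m (r x - 1%:M) *m scal_mx A c') i j.
    rewrite mulmxBr mulmxBl mulmx1 -scal_mxM cc' scal_mx1 rmorphB rmorph_nat.
    rewrite /r -{1}(map_scal_mx (ev ry (q A x))) -{1}(map_scal_mx (ev ry (q A x))).
    by rewrite -!map_mxM !mxE.
  rewrite !mxE linear_sum; apply: eq_bigr => k _.
  rewrite !mxE /= -scalerAr mulr1 linearZ /= mulrC; congr (_ * _).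
  rewrite linear_sum; apply: eq_bigr => l _.
  by rewrite mxE [scal_mx _ _ _ _]mxE /= -scalerAl mul1r linearZ.
pose m0 : ut_of n B := exist _ m' m'U.
pose rho0 (R : comAlgType F) (g : Q R) : UT n F R := ut_map (ev ry g) m0.
have rho0E (R : comAlgType F) (g : Q R) :
    val (rho0 R g) = scal_mx R c *m map_mx (ev ry g) m *m scal_mx R c'.
  by rewrite /= !map_mxM !map_scal_mx.
have rho0M R : {morph @rho0 R : g h / (g * h)%g}.
  move=> g h; apply: val_inj; transitivity (val (rho0 R g) *m val (rho0 R h)) => //.
  rewrite !rho0E mR.1 !mulmxA -(mulmxA _ (scal_mx R c') (scal_mx R c)) -scal_mxM c'c.
  by rewrite scal_mx1 mulmx1.
pose M R := isMultiplicative.Build (Q R) (UT n F R) (@rho0 R) (@rho0M R).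
pose rho1 R : {multiplicative Q R -> UT n F R} :=
  HB.pack_for {multiplicative Q R -> UT n F R} (@rho0 R) (M R).
have rho1N (R S : comAlgType F) (f : {lrmorphism R -> S}) (g : Q R) :
    rho1 S (pmap Q f g) = pmap (UT n F) f (rho1 R g).
  apply: val_inj; apply/matrixP => i j; rewrite [LHS]mxE /= ev_pmap [RHS]mxE.
  by congr (f _); rewrite [RHS]mxE.
by exists (GroupHom rho1N) => R g; rewrite -rho0E.
Qed.

End Conjugation.

(** * Pro-unipotent groups *)

Section Homs.
Variables (F : fieldType).

Fact hom_id_natural (U : group_functor F) (R S : comAlgType F) (f : {lrmorphism R -> S})
  (g : U R) : (idfun : {multiplicative U S -> U S}) (pmap U f g) =
    pmap U f ((idfun : {multiplicative U R -> U R}) g).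
Proof. by []. Qed.
Definition hom_id (U : group_functor F) : group_hom U U := GroupHom (@hom_id_natural U).

Section Comp.
Variables (U V W : group_functor F) (h : group_hom V W) (f : group_hom U V).
Fact hom_comp_natural (R S : comAlgType F) (e : {lrmorphism R -> S}) (g : U R) :
  (h S \o f S : {multiplicative U S -> W S}) (pmap U e g) =
  pmap W e ((h R \o f R : {multiplicative U R -> W R}) g).
Proof. by rewrite /= !hom_natural. Qed.
Definition hom_comp : group_hom U W := GroupHom hom_comp_natural.
End Comp.

Lemma ev_trans (U : group_functor F) (A B : comAlgType F) (x : U A) (y : U B)
  (rx : represents x) (ry : represents y) a : a = ev ry x (ev rx y a).
Proof. by rewrite -(ev_pmap rx) pmap_ev ev_id. Qed.

Lemma unipotent_gen (Q : group_functor F) : unipotent Q ->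
  exists n (s : group_hom Q (UT n F)), forall (B : comAlgType F) (y : Q B),
    represents y -> forall b, gen (fun c => exists i j, c = val (s B y) i j) b.
Proof.
case=> _ [n [s [A [C [x [z [phi [[rx rz phiz] phi_surj]]]]]]]].
exists n, s => B y ry b; rewrite (ev_trans ry rx b); have [c <-] := phi_surj (ev ry x b).
have phizE i j : phi (val z i j) = val (s A x) i j by rewrite -phiz mxE.
apply: (@gen_map F A B (ev rx y) (fun c => exists i j, c = val (s A x) i j)).
  by move=> _ [i [j ->]]; rewrite ev_ut; apply: gen_sub; exists i, j.
apply: gen_map (ut_gen rz c) => _ [i [j ->]].
by rewrite phizE; apply: gen_sub; exists i, j.
Qed.

(** The function [a] comes from an algebraic quotient; this is unipotent by hypothesis, so the
    entries of one embedding generate its coordinate ring. *)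
Lemma pro_unipotent_generated (U : group_functor F) (A : comAlgType F) (x : U A) :
  represents x -> pro_unipotent U -> ut_generated x.
Proof.
move=> rx [_ Uq] a; have [Q [p [B [y [ry [b [algQ qp ab]]]]]]] := algebraic_quotient rx a.
have [n [s sgen]] := unipotent_gen (Uq Q p algQ qp).
rewrite -(ev_id rx a) ab; apply: gen_map (sgen B y ry b) => _ [i [j ->]].
by rewrite ev_ut; apply: gen_sub; exists n, (hom_comp s p), i, j.
Qed.

Section Span.
Variables (U : group_functor F) (A : comAlgType F) (x : U A) (rx : represents x).

Definition mx_coef n (m : 'M[A]_n) (a : A) : Prop :=
  exists (xi : 'rV[F]_n) (w : 'cV[F]_n), a = (scal_mx A xi *m m *m scal_mx A w) 0 0.

Lemma mx_rep_coef a : exists n (m : 'M[A]_n), mx_rep rx m /\ mx_coef m a.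
Proof.
have [n [m [xi [w [mR ->]]]]] := mx_rep_comodule rx a; exists n, m; split=> //.
exists xi, w; rewrite mxE exchange_big; apply: eq_bigr => j _.
rewrite !mxE mulr_suml; apply: eq_bigr => i _.
by rewrite !mxE /= -scalerAr -scalerAl mul1r mulr1 scalerA mulrC.
Qed.

Lemma mx_rep_block n n' (m : 'M[A]_n) (m' : 'M[A]_n') :
  mx_rep rx m -> mx_rep rx m' -> mx_rep rx (block_mx m 0 0 m').
Proof.
move=> [mM m1] [m'M m'1]; split=> [R g h|R]; rewrite !map_block_mx !map_mx0.
  by rewrite mulmx_block mM m'M !(mulmx0, mul0mx, addr0, add0r).
by rewrite m1 m'1 -scalar_mx_block.
Qed.

Lemma mx_rep_coefs (s : seq A) :
  exists n (m : 'M[A]_n), mx_rep rx m /\ forall a, a \in s -> mx_coef m a.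
Proof.
elim: s => [|a s [n [m [mR ms]]]].
  by have [n [m [mR _]]] := mx_rep_coef 0; exists n, m.
have [n' [m' [m'R [xi' [w' aE]]]]] := mx_rep_coef a.
exists _, (block_mx m' 0 0 m); split; first exact: mx_rep_block.
move=> b; rewrite inE => /orP [/eqP ->|/ms [xi [w ->]]].
  exists (row_mx xi' 0), (col_mx w' 0).
  rewrite /scal_mx map_row_mx map_col_mx !map_mx0 mul_row_block mul_row_col.
  by rewrite !(mulmx0, mul0mx, addr0).
exists (row_mx 0 xi), (col_mx 0 w).
rewrite /scal_mx map_row_mx map_col_mx !map_mx0 mul_row_block mul_row_col.
by rewrite !(mulmx0, mul0mx, addr0, add0r).
Qed.

(** Conjugate a representation having [a] as a coefficient, and absorb the conjugating matrices into
    the row and the column. *)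
Lemma ut_coef (a : A) : ut_generated x ->
  exists n (rho : group_hom U (UT n F)), mx_coef (val (rho A x)) a.
Proof.
move=> gx; have [n [m [mR [xi [w aE]]]]] := mx_rep_coef a.
have idI : injective (ev rx (hom_id U A x)).
  by move=> b c; rewrite !ev_id.
have [c [c' [cc' c'c [rho rhoE]]]] := unipotent_conj rx gx idI mR.
exists n, rho, (xi *m c'), (c *m w); rewrite aE rhoE !scal_mxM.
have -> : map_mx (ev rx x) m = m by apply/matrixP => i j; rewrite mxE ev_id.
have E : scal_mx A c' *m scal_mx A c = 1%:M by rewrite -scal_mxM c'c scal_mx1.
congr (fun_of_matrix _ 0 0); rewrite !mulmxA -[X in _ = X *m _ *m _ *m _ *m _]mulmxA E mulmx1.
by rewrite -[X in _ = X *m _]mulmxA E mulmx1.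
Qed.

End Span.

(** The finitely many generators of the coordinate ring of [Q] are coefficients of one
    representation. Once it is conjugated into [UT], its comorphism reaches these generators and is
    therefore surjective. *)
Lemma ut_generated_pro_unipotent (U : group_functor F) (A : comAlgType F) (x : U A) :
  represents x -> ut_generated x -> pro_unipotent U.
Proof.
move=> rx gx; split; first by exists A, x.
move=> Q p algQ [A' [B [x' [y [phi [cphi phi_inj]]]]]]; split=> //.
have [rx' ry _] := cphi; have gx' := ut_generated_transfer rx rx' gx.
have q_inj : injective (ev ry (p A' x')).
  by move=> b c; rewrite -!(comorphismE ry cphi); exact: phi_inj.
have [s sgen] : exists s : seq B, forall b, gen_seq s b.
  have [B2 [y2 [ry2 /fin_gen_algebraP [s2 s2gen]]]] := algQ.
  exists (map (ev ry2 y) s2) => b; rewrite (ev_trans ry ry2 b).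
  apply: gen_map (s2gen _) => c cs2.
  by apply: gen_sub; exact: map_f.
have [n [m [mR mc]]] := mx_rep_coefs ry s.
have [c [c' [cc' c'c [rho rhoE]]]] := unipotent_conj rx' gx' q_inj mR.
exists n, rho; have [C [z rz]] := UT_affine F n.
exists B, C, y, z, (ev rz (rho B y)); split; first by split=> //; rewrite pmap_ev.
move=> b; have Ssub := subalg_image (ev rz (rho B y)) (subalgT C).
have SL := subalg_lin Ssub.
have [|d _ <-] := sgen b _ Ssub; last by exists d.
move=> {}b bs.
have [xi [w ->]] := mc b bs.
have -> : m = scal_mx B c' *m val (rho B y) *m scal_mx B c.
  have E : scal_mx B c' *m scal_mx B c = 1%:M by rewrite -scal_mxM c'c scal_mx1.
  rewrite rhoE !mulmxA E mul1mx -mulmxA E.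
  by rewrite mulmx1; apply/matrixP => i j; rewrite mxE ev_id.
rewrite !mulmxA -(scal_mxM B xi c') -mulmxA -(scal_mxM B c w) mxE.
apply: (lin_closed_sum _ SL) => j _; rewrite mxE mulr_suml.
apply: (lin_closed_sum _ SL) => i _; rewrite !mxE /= -scalerAr -scalerAl mul1r mulr1.
do 2!apply: (lin_closedZ _ SL); exists (val z i j) => //.
by rewrite -{2}(pmap_ev rz (rho B y)) mxE.
Qed.

Lemma UT_generated n (C : comAlgType F) (z : UT n F C) : represents z -> ut_generated z.
Proof.
move=> rz c; apply: gen_trans (ut_gen rz c) => _ [i [j ->]].
by apply: gen_sub; exists n, (hom_id _), i, j.
Qed.

Lemma UT_pro_unipotent n : pro_unipotent (UT n F).
Proof.
have [C [z rz]] := UT_affine F n.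
exact: (ut_generated_pro_unipotent rz (UT_generated rz)).
Qed.

End Homs.

(** * Base change *)

Section BaseChangeUt.
Variables (k K : fieldType) (i : {rmorphism k -> K}) (G : group_functor k).
Variables (n : nat) (f : group_hom G (UT n k)).

Definition bc_ut_fun (R : comAlgType K) (g : base_change i G R) : UT n K R :=
  f (restr i R) g : ut_of n (restr i R).

Fact bc_ut_mul R : {morph @bc_ut_fun R : g h / (g * h)%g}.
Proof. by move=> g h; apply: val_inj; rewrite /bc_ut_fun gmulfM. Qed.
HB.instance Definition _ R := isMultiplicative.Build (base_change i G R) (UT n K R)
  (@bc_ut_fun R) (@bc_ut_mul R).

Fact bc_ut_natural (R S : comAlgType K) (h : {lrmorphism R -> S}) (g : base_change i G R) :
  bc_ut_fun (pmap (base_change i G) h g) = pmap (UT n K) h (bc_ut_fun g).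
Proof. by rewrite /bc_ut_fun /= hom_natural; exact: val_inj. Qed.

Definition bc_ut : group_hom (base_change i G) (UT n K) :=
  @GroupHom K (base_change i G) (UT n K) bc_ut_fun bc_ut_natural.

End BaseChangeUt.

Section BaseChangeAlgebra.
Variables (k K : fieldType) (i : {rmorphism k -> K}) (A : comAlgType k).

(** A copy of the tensor product, which itself carries only the [k]-structure; here [K] acts through
    the left factor. *)
Definition bc_alg : Type := tensor (restr i K^o) A.
HB.instance Definition _ := GRing.ComNzRing.copy bc_alg (tensor (restr i K^o) A).

Definition bc_inl (c : K) : bc_alg := @tinl k (restr i K^o) A c.
Definition bc_scale (c : K) (t : bc_alg) : bc_alg := bc_inl c * t.

Lemma bc_inlD : {morph bc_inl : a b / a + b}.
Proof. exact: (raddfD (@tinl k (restr i K^o) A)). Qed.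
Lemma bc_inlM : {morph bc_inl : a b / a * b}.
Proof. exact: (rmorphM (@tinl k (restr i K^o) A)). Qed.
Lemma bc_inl1 : bc_inl 1 = 1. Proof. by []. Qed.

Fact bc_scaleA a b t : bc_scale a (bc_scale b t) = bc_scale (a * b) t.
Proof. by rewrite /bc_scale mulrA bc_inlM. Qed.
Fact bc_scale1 : left_id 1 bc_scale.
Proof. by move=> t; rewrite /bc_scale bc_inl1 mul1r. Qed.
Fact bc_scaleDr : right_distributive bc_scale +%R.
Proof. by move=> a t u; rewrite /bc_scale mulrDr. Qed.
Fact bc_scaleDl t : {morph bc_scale^~ t : a b / a + b}.
Proof. by move=> a b; rewrite /bc_scale bc_inlD mulrDl. Qed.
HB.instance Definition _ := GRing.Zmodule_isLmodule.Build K bc_alg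
  bc_scaleA bc_scale1 bc_scaleDr bc_scaleDl.
Fact bc_scaleAl (a : K) (t u : bc_alg) : a *: (t * u) = (a *: t) * u.
Proof. exact: mulrA. Qed.
HB.instance Definition _ := GRing.Lmodule_isLalgebra.Build K bc_alg bc_scaleAl.
HB.instance Definition _ := GRing.Lalgebra_isComAlgebra.Build K bc_alg.

Definition bc_inr : A -> restr i bc_alg := @tinr k (restr i K^o) A.
Fact bc_inr_additive : zmod_morphism bc_inr.
Proof. exact: (rmorphB (@tinr k (restr i K^o) A)). Qed.
Fact bc_inr_multiplicative : monoid_morphism bc_inr.
Proof. by split; [| exact: (rmorphM (@tinr k (restr i K^o) A))]. Qed.
Fact bc_inr_scalable : scalable bc_inr.
Proof.
move=> a u; rewrite /bc_inr (linearZZ (@tinr k (restr i K^o) A)).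
rewrite -[X in a *: X]mul1r scalerAl; congr (_ * _).
rewrite -(rmorph1 (@tinl k (restr i K^o) A)) -linearZ /=; congr (tinl _ _).
exact: mulr1.
Qed.
HB.instance Definition _ := GRing.isZmodMorphism.Build A (restr i bc_alg) bc_inr
  bc_inr_additive.
HB.instance Definition _ := GRing.isMonoidMorphism.Build A (restr i bc_alg) bc_inr
  bc_inr_multiplicative.
HB.instance Definition _ := GRing.isScalable.Build k A (restr i bc_alg) *:%R bc_inr
  bc_inr_scalable.

Lemma bc_algP (t : bc_alg) : exists s : seq (K * A),
  t = \sum_(p <- s) p.1 *: (bc_inr p.2 : bc_alg).
Proof.
have [s ->] := tensP (t : tensor (restr i K^o) A); exists s.
by rewrite tensE.
Qed.

Section Lift.
Variables (R : comAlgType K) (phi : {lrmorphism A -> restr i R}).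

Definition bc_unit : restr i K^o -> restr i R := fun c => (c : K) *: (1 : R).
Fact bc_unit_additive : zmod_morphism bc_unit.
Proof. exact: (rmorphB (GRing.in_alg R)). Qed.
Fact bc_unit_multiplicative : monoid_morphism bc_unit.
Proof. by split; [exact: (rmorph1 (GRing.in_alg R)) | exact: (rmorphM (GRing.in_alg R))]. Qed.
Fact bc_unit_scalable : scalable bc_unit.
Proof. by move=> a c; rewrite /bc_unit [RHS]scalerA. Qed.
HB.instance Definition _ := GRing.isZmodMorphism.Build (restr i K^o) (restr i R) bc_unit
  bc_unit_additive.
HB.instance Definition _ := GRing.isMonoidMorphism.Build (restr i K^o) (restr i R) bc_unit
  bc_unit_multiplicative.
HB.instance Definition _ := GRing.isScalable.Build k (restr i K^o) (restr i R) *:%R bc_unit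
  bc_unit_scalable.

Definition bc_lift (t : bc_alg) : R := tlift bc_unit phi t.
Fact bc_lift_additive : zmod_morphism bc_lift.
Proof. exact: (rmorphB (tlift bc_unit phi)). Qed.
Fact bc_lift_multiplicative : monoid_morphism bc_lift.
Proof. by split; [exact: (rmorph1 (tlift bc_unit phi)) | exact: (rmorphM (tlift bc_unit phi))]. Qed.
Fact bc_lift_scalable : scalable bc_lift.
Proof.
move=> c t; pose c' : restr i K^o := c.
transitivity (tlift bc_unit phi (tinl A c' * t)) => //.
by rewrite rmorphM /= tlift_inl; exact: mulr_algl.
Qed.
HB.instance Definition _ := GRing.isZmodMorphism.Build bc_alg R bc_lift bc_lift_additive.
HB.instance Definition _ := GRing.isMonoidMorphism.Build bc_alg R bc_lift
  bc_lift_multiplicative.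
HB.instance Definition _ := GRing.isScalable.Build K bc_alg R *:%R bc_lift bc_lift_scalable.

Lemma bc_lift_inr a : bc_lift (bc_inr a) = phi a.
Proof. exact: (tlift_inr bc_unit phi a). Qed.
End Lift.
End BaseChangeAlgebra.

Section BaseChangeRepresented.
Variables (k K : fieldType) (i : {rmorphism k -> K}) (G : group_functor k).
Variables (A : comAlgType k) (x : G A) (rx : represents x).

Definition bc_inr_hom : {lrmorphism A -> restr i (bc_alg i A)} := @bc_inr k K i A.
Definition bc_point : base_change i G (bc_alg i A) := pmap G bc_inr_hom x.

Lemma ev_bc_point a : ev rx (bc_point : G (restr i (bc_alg i A))) a = bc_inr i a.
Proof. by rewrite /bc_point (ev_pmap rx bc_inr_hom x a) ev_id. Qed.

(** Extension of scalars is left adjoint to restriction. *)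
Lemma bc_represents : represents bc_point.
Proof.
move=> R g; exists (bc_lift (ev rx g) : {lrmorphism bc_alg i A -> R}).
  rewrite /bc_point /= -pmap_comp -[RHS](pmap_ev rx); congr (pmap G _ x).
  by apply: lrmorphism_eq => a /=; exact: (bc_lift_inr (ev rx g) a).
move=> psi psig t; have [s ->] := bc_algP t; rewrite !linear_sum.
apply: eq_bigr => p _; rewrite !linearZ /= bc_lift_inr; congr (_ *: _).
rewrite -psig (ev_pmap rx (restr_hom i psi) bc_point); congr (psi _).
exact/esym/ev_bc_point.
Qed.

Lemma ev_bc (R : comAlgType K) (g : base_change i G R) a :
  ev bc_represents g (bc_inr i a) = ev rx g a.
Proof.
have E := pmap_ev bc_represents g; set f := ev _ _; rewrite -[in RHS]E.
rewrite (ev_pmap rx (restr_hom i f) bc_point); congr (f _).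
exact/esym/ev_bc_point.
Qed.

Lemma bc_ut_generated : ut_generated x -> ut_generated bc_point.
Proof.
move=> gx t; have [s ->] := bc_algP t.
have gS := subalg_gen (ut_entry bc_point).
apply: (lin_closed_sum _ (subalg_lin gS)) => p _.
apply: (lin_closedZ _ (subalg_lin gS)).
pose S (a : A) := gen (ut_entry bc_point) (bc_inr i a : bc_alg i A).
have SS : subalg S.
  case: gS => g1 gD gM; split.
  - by rewrite /S rmorph1.
  - by move=> c u v Su Sv; rewrite /S linearP; exact: gD.
  - by move=> u v Su Sv; rewrite /S rmorphM; exact: gM.
apply: (gx p.2 S SS) => _ [n [f [a [b ->]]]].
apply: gen_sub; exists n, (bc_ut i f), a, b.
by rewrite /= /bc_ut_fun /bc_point hom_natural mxE.
Qed.

End BaseChangeRepresented.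

(** * Logarithms and exponentials *)

Section BinomialPolynomials.
Variable F : fieldType.
Hypothesis F0 : [pchar F] =i pred0.

Lemma natr_neq0 n : (n.+1%:R : F) != 0.
Proof. by have /pcharf0P -> := F0. Qed.

Lemma fact_neq0 n : (n`!%:R : F) != 0.
Proof. by have /pcharf0P -> := F0; rewrite -lt0n fact_gt0. Qed.

Lemma poly_nat_eq (p q : {poly F}) : (forall n, p.[n%:R] = q.[n%:R]) -> p = q.
Proof.
move=> pq; apply/eqP; rewrite -subr_eq0; apply/negPn/negP => pq0.
pose s := [seq n%:R : F | n <- iota 0 (size (p - q))].
have : (size s < size (p - q)%R)%N.
  apply: max_poly_roots => //.
    by apply/allP => _ /mapP [n _ ->]; rewrite rootE hornerD hornerN pq subrr.
  rewrite map_inj_uniq ?iota_uniq // => a b ab; apply/eqP.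
  wlog le : a b ab / (a <= b)%N.
    by move=> H; case/orP: (leq_total a b) => ?; [|rewrite eq_sym]; exact: H.
  have /pcharf0P/(_ (b - a)%N) := F0.
  by rewrite natrB // ab subrr eqxx subn_eq0 => ba; rewrite eqn_leq le -ba.
by rewrite size_map size_iota ltnn.
Qed.

(** The polynomial X (X - 1) ... (X - l + 1) / l!. *)
Fixpoint binp (l : nat) : {poly F} :=
  if l is l'.+1 then l'.+1%:R^-1 *: (binp l' * ('X - l'%:R%:P)) else 1.

Lemma binpE l n : (binp l).[n%:R] = 'C(n, l)%:R.
Proof.
elim: l => [|l IH] /=; first by rewrite hornerC bin0.
rewrite hornerZ hornerM hornerXsubC IH; apply: (mulfI (natr_neq0 l)).
rewrite mulrA mulfV ?natr_neq0 // mul1r -natrM mul_bin_left natrM mulrC.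
case: (leqP l n) => ln; first by rewrite natrB.
by rewrite bin_small // !mulr0.
Qed.

End BinomialPolynomials.

Section StrictUpper.
Variables (R : comNzRingType) (n : nat).
Implicit Types Y : 'M[R]_n.

Lemma strict_upper_nilpotent Y p :
  (forall i j : 'I_n, (j <= i)%N -> Y i j = 0) -> (n <= p)%N -> Y ^+ p = 0.
Proof.
move=> Y0 np; have YU : 1 - Y \in @unitriangular n R.
  by apply/unitriangularP => i j ji; rewrite !mxE Y0 // subr0.
have YE : 1 - (1 - Y) = Y by rewrite opprD addrA subrr add0r opprK.
have := strict_upper_nilp YU; rewrite YE => Yn.
by rewrite -(subnK np) exprD Yn mulr0.
Qed.

End StrictUpper.

Section UtPowers.
Variables (F : fieldType) (n : nat).
Hypothesis F0 : [pchar F] =i pred0.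

(** The binomial formula for u = 1 + (u - 1). The range of summation does not depend on [p], so the
    powers of [u] are polynomial in the exponent. *)
Lemma ut_power (u : ut_of n F) (p : nat) :
  val (u ^+ p)%g = \sum_(l < n) (binp F l).[p%:R] *: (val u - 1) ^+ l.
Proof.
have uE : val (u ^+ p)%g = val u ^+ p.
  elim: p => [|p IH]; first by [].
  by rewrite expgS exprS -IH.
have u0 q : (n <= q)%N -> (val u - 1) ^+ q = 0.
  apply: strict_upper_nilpotent => i j ji; rewrite !mxE.
  by have /unitriangularP -> // := valP u; rewrite subrr.
pose f l := (binp F l).[p%:R] *: (val u - 1) ^+ l.
have fs N : (n <= N)%N -> \sum_(l < N) f l = \sum_(l < n) f l.
  move=> /subnKC <-; rewrite big_split_ord /= [X in _ + X]big1 ?addr0 // => l _.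
  by rewrite /f u0 ?leq_addr // scaler0.
have fp N : (p < N)%N -> \sum_(l < N) f l = \sum_(l < p.+1) f l.
  move=> /subnKC <-; rewrite big_split_ord /= [X in _ + X]big1 ?addr0 // => l _.
  by rewrite /f binpE // bin_small ?scale0r // leq_addr.
rewrite uE -{1}[val u](subrK 1) addrC exprDn_comm; last exact: commr_sym (commr1 _).
(* Both sums extend to a common length: terms with l >= n vanish by nilpotency, those with l > p
   because the binomial coefficient does. *)
rewrite -[RHS](fs (maxn n p.+1) (leq_maxl _ _)) fp ?leq_maxr //.
apply: eq_bigr => l _; rewrite expr1n mul1r /f binpE //.
by rewrite scaler_nat.
Qed.

End UtPowers.

Section Exponential.
Variables (F : fieldType) (Q : group_functor F) (B : comAlgType F) (y : Q B).
Hypothesis F0 : [pchar F] =i pred0.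
Hypothesis ry : represents y.
Variables (m : nat) (s : group_hom Q (UT m F)).
Hypothesis sgen : forall b, gen (fun c => exists i j, c = val (s B y) i j) b.

Lemma ut_points_inj (R : comAlgType F) (g h : Q R) : val (s R g) = val (s R h) -> g = h.
Proof.
move=> gh; apply: (ev_inj (rx := ry)) => b.
apply: (sgen b (subalg_eq (ev ry g) (ev ry h))) => _ [i [j ->]].
by rewrite !ev_ut gh.
Qed.

Lemma is_exp_uniq (X : Q (dual F)) (g h : Q F^o) : is_exp X g -> is_exp X h -> g = h.
Proof. by move=> Xg Xh; apply: ut_points_inj; rewrite Xg Xh. Qed.

Lemma lie_mx_ev n (rho : group_hom Q (UT n F)) (X : Q (dual F)) i j :
  lie_mx rho X i j = dual_eps (ev ry X (val (rho B y) i j)).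
Proof. by rewrite mxE ev_ut. Qed.

Lemma lie_mx_strict n (rho : group_hom Q (UT n F)) (X : Q (dual F)) (i j : 'I_n) :
  (j <= i)%N -> lie_mx rho X i j = 0.
Proof.
move=> ji; rewrite mxE; have /unitriangularP -> // := valP (rho (dual F) X).
by case: (i == j).
Qed.

Lemma lie_re (X : Q (dual F)) b : Lie X -> dual_re (ev ry X b) = counit ry b.
Proof.
by move=> LX; rewrite -(ev_pmap ry (@dual_re F : {lrmorphism dual F -> F^o})) LX.
Qed.

Section Log.
Variable g : Q F^o.

Lemma power_poly_ex b : exists P : {poly F}, forall p, ev ry (g ^+ p)%g b = P.[p%:R].
Proof.
apply: (sgen b (S := fun b => exists P : {poly F}, forall p, ev ry (g ^+ p)%g b = P.[p%:R])).
  split.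
  - by exists 1 => p; rewrite rmorph1 hornerC.
  - move=> c u v [P uP] [P' vP]; exists (c *: P + P') => p.
    by rewrite linearP /= uP vP hornerD hornerZ.
  - move=> u v [P uP] [P' vP]; exists (P * P') => p.
    by rewrite rmorphM /= uP vP hornerM.
move=> _ [i [j ->]]; exists (\sum_(l < m) ((val (s F^o g) - 1) ^+ l) i j *: binp F l) => p.
rewrite ev_ut horner_sum.
have -> : s F^o (g ^+ p)%g = (s F^o g ^+ p)%g.
  by elim: p => [|p IH]; rewrite ?mult1 // !expgS gmulfM IH.
rewrite ut_power // summxE; apply: eq_bigr => l _.
by rewrite mxE hornerZ mulrC.
Qed.

Definition power_poly b : {poly F} := projT1 (cid (power_poly_ex b)).
Lemma power_polyE b p : ev ry (g ^+ p)%g b = (power_poly b).[p%:R].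
Proof. exact: (projT2 (cid (power_poly_ex b))). Qed.
Lemma power_poly_uniq b P : (forall p, ev ry (g ^+ p)%g b = P.[p%:R]) -> power_poly b = P.
Proof. by move=> bP; apply: poly_nat_eq => // p; rewrite -power_polyE. Qed.

(** [power_poly b] extends b(g^t) from natural [t] to a polynomial, so it describes the
    one-parameter group through [g]. Its value and derivative at t = 0 give the tangent vector log
    g. *)
Definition log_ev (b : B) : dual F := Dual (power_poly b).[0] (power_poly b)^`().[0].

Lemma power_poly_lin c a b : power_poly (c *: a + b) = c *: power_poly a + power_poly b.
Proof.
by apply: power_poly_uniq => p; rewrite linearP /= !power_polyE hornerD hornerZ.
Qed.
Lemma power_polyM a b : power_poly (a * b) = power_poly a * power_poly b.
Proof. by apply: power_poly_uniq => p; rewrite rmorphM /= !power_polyE hornerM. Qed.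
Lemma power_poly1 : power_poly 1 = 1.
Proof. by apply: power_poly_uniq => p; rewrite rmorph1 hornerC. Qed.

Fact log_ev_linear : linear log_ev.
Proof.
move=> c a b; apply: dual_ext => /=; rewrite power_poly_lin.
  by rewrite hornerD hornerZ.
by rewrite derivD derivZ hornerD hornerZ.
Qed.
Fact log_ev_multiplicative : monoid_morphism log_ev.
Proof.
split=> [|a b]; apply: dual_ext => /=; rewrite ?power_poly1 ?power_polyM.
- by rewrite hornerC.
- by rewrite derivC hornerC.
- by rewrite hornerM.
- by rewrite derivM hornerD !hornerM addrC.
Qed.
HB.instance Definition _ := GRing.isLinear.Build F B (dual F) *:%R log_ev log_ev_linear.
HB.instance Definition _ := GRing.isMonoidMorphism.Build B (dual F) log_ev
  log_ev_multiplicative.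

Definition logQ : Q (dual F) := pmap Q (log_ev : {lrmorphism B -> dual F}) y.

Lemma ev_logQ b : ev ry logQ b = log_ev b.
Proof. by rewrite /logQ ev_pmap ev_id. Qed.

Lemma logQ_Lie : Lie logQ.
Proof.
apply: (ev_inj (rx := ry)) => b.
rewrite (ev_pmap ry (@dual_re F : {lrmorphism dual F -> F^o})) ev_logQ /=.
by rewrite -[0]/(0%:R) -power_polyE expg0.
Qed.

Lemma power_poly_ut n (rho : group_hom Q (UT n F)) i j :
  power_poly (val (rho B y) i j) =
    \sum_(l < n) ((val (rho F^o g) - 1) ^+ l) i j *: binp F l.
Proof.
apply: power_poly_uniq => p; rewrite ev_ut horner_sum.
have -> : rho F^o (g ^+ p)%g = (rho F^o g ^+ p)%g.
  by elim: p => [|p IH]; rewrite ?mult1 // !expgS gmulfM IH.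
rewrite ut_power // summxE; apply: eq_bigr => l _.
by rewrite mxE hornerZ mulrC.
Qed.

(** The derivative of the [l]-th binomial polynomial at 0 is (-1)^(l-1) / l for l > 0 and zero for l
    = 0: this is the logarithm series, and it shows log to be polynomial in the entries. *)
Lemma lie_mx_log n (rho : group_hom Q (UT n F)) :
  lie_mx rho logQ = \sum_(l < n) (binp F l)^`().[0] *: (val (rho F^o g) - 1) ^+ l.
Proof.
apply/matrixP => i j; rewrite lie_mx_ev ev_logQ /= power_poly_ut summxE.
rewrite linear_sum horner_sum; apply: eq_bigr => l _.
by rewrite /= derivZ hornerZ mxE mulrC.
Qed.

Lemma is_exp_log : is_exp logQ g.
Proof.
move=> n rho; set Y := lie_mx rho logQ.
pose P i j := power_poly (val (rho B y) i j).
have PE p i j : (P i j).[p%:R] = val (rho F^o (g ^+ p)%g) i j by rewrite -power_polyE ev_ut.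
have P'0 i j : (P i j)^`().[0] = Y i j by rewrite /Y lie_mx_ev ev_logQ.
(* The differential equation P' = P Y: differentiate rho(g^(p+t)) = rho(g^p) rho(g^t) at t = 0, for
   every natural [p]. *)
have dP i j : (P i j)^`() = \sum_l Y l j *: P i l.
  apply: poly_nat_eq => // p; rewrite horner_sum.
  have Pp : P i j \Po ('X + p%:R%:P) = \sum_l (P i l).[p%:R] *: P l j.
    apply: poly_nat_eq => // q; rewrite horner_comp hornerD hornerX hornerC -natrD PE.
    rewrite addnC expgnDr gmulfM mxE horner_sum; apply: eq_bigr => l _.
    by rewrite hornerZ !PE.
  have := congr1 (fun R : {poly F} => R^`().[0]) Pp.
  rewrite deriv_comp derivD derivX derivC addr0 mulr1 horner_comp hornerD hornerX hornerC.
  rewrite add0r => ->; rewrite linear_sum horner_sum; apply: eq_bigr => l _.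
  by rewrite /= derivZ hornerZ P'0 hornerZ mulrC.
(* With P(0) = 1 the equation determines the coefficients of [P] as those of exp(t Y); the claim is
   its value at t = 1. *)
have Pq q : (\matrix_(i, j) (P i j)`_q) = (q`!%:R)^-1 *: Y ^+ q.
  elim: q => [|q IH].
    rewrite fact0 invr1 scale1r expr0; apply/matrixP => i j.
    by rewrite mxE -horner_coef0 -[0]/(0%:R) PE expg0 mult1.
  apply/matrixP => i j; rewrite !mxE; apply: (mulfI (natr_neq0 F0 q)).
  rewrite mulr_natl -coef_deriv dP coef_sum factS natrM invfM !mulrA mulfV ?natr_neq0 // mul1r.
  rewrite exprSr mxE mulr_sumr; apply: eq_bigr => l _.
  have /matrixP/(_ i l) := IH; rewrite !mxE coefZ => ->.
  by rewrite mulrC mulrA.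
have Y0 q : (n <= q)%N -> Y ^+ q = 0.
  by apply: strict_upper_nilpotent => i j; exact: lie_mx_strict.
apply/matrixP => i j; have := PE 1%N i j; rewrite expg1 => <-.
rewrite (@horner_coef_wide _ n); last first.
  apply/leq_sizeP => q nq; have /matrixP/(_ i j) := Pq q.
  by rewrite mxE Y0 // scaler0 mxE.
rewrite summxE; apply: eq_bigr => q _; rewrite expr1n mulr1.
by have /matrixP/(_ i j) := Pq q; rewrite mxE.
Qed.

End Log.
End Exponential.

Section Exp.
Variables (F : fieldType) (Q : group_functor F) (B : comAlgType F) (y : Q B).
Hypothesis F0 : [pchar F] =i pred0.
Hypothesis ry : represents y.
Variables (m : nat) (s : group_hom Q (UT m F)).
Hypothesis sgen : forall b, gen (fun c => exists i j, c = val (s B y) i j) b.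
Variable X : Q (dual F).
Hypothesis XL : Lie X.

Definition tangent (b : B) : F := dual_eps (ev ry X b).
Fact tangent_linear : linear_for *%R tangent.
Proof. by move=> c a b; rewrite /tangent linearP. Qed.
HB.instance Definition _ := GRing.isLinear.Build F B F *%R tangent tangent_linear.

Lemma tangentM a b :
  tangent (a * b) = counit ry a * tangent b + tangent a * counit ry b.
Proof. by rewrite /tangent rmorphM /= !(lie_re ry _ XL). Qed.

(* The left-invariant derivation of [O(Q)] extending the tangent vector [X]. *)
Definition deriv_op (b : B) : B := tens_at (coprod ry b) tangent.

Fact deriv_op_linear : linear deriv_op.
Proof.
by move=> c a b; rewrite /deriv_op linearP /= tens_atD tens_atZ.
Qed.
HB.instance Definition _ := GRing.isLinear.Build F B B *:%R deriv_op deriv_op_linear.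

Lemma coprod_counit b z : coprod ry b = tens z -> b = \sum_(p <- z) counit ry p.2 *: p.1.
Proof.
move=> bz; have := coprodP ry y 1%g b; rewrite mulg1 ev_id bz tliftE => ->.
by apply: eq_bigr => p _; rewrite ev_id ev1 -scalerAr mulr1.
Qed.

Lemma deriv_opM a b : deriv_op (a * b) = deriv_op a * b + a * deriv_op b.
Proof.
have [[z az] [w bw]] := conj (tensP (coprod ry a)) (tensP (coprod ry b)).
rewrite /deriv_op rmorphM /= az bw [tens z * tens w]tmulE !tens_atE big_allpairs_dep.
rewrite (coprod_counit az) (coprod_counit bw) !mulr_suml -big_split /=.
apply: eq_bigr => p _; rewrite !mulr_sumr -big_split /=; apply: eq_bigr => q _.
by rewrite tangentM scalerDl addrC -!scalerAl -!scalerAr !scalerA.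
Qed.

Lemma deriv_op1 : deriv_op 1 = 0.
Proof.
apply: (addrI (deriv_op 1)); rewrite addr0 -{3}[1 : B]mulr1 deriv_opM.
by rewrite mulr1 mul1r.
Qed.

Lemma deriv_op_ut n (rho : group_hom Q (UT n F)) i j :
  deriv_op (val (rho B y) i j) = \sum_l lie_mx rho X l j *: val (rho B y) i l.
Proof.
rewrite /deriv_op /coprod ev_ut gmulfM mxE tens_at_sum; apply: eq_bigr => l _.
rewrite !hom_natural mxE tens_at_tinl [X in tens_at X]mxE tens_at_tinr.
by rewrite -scalerAr mulr1 (lie_mx_ev ry).
Qed.

(** Divided powers of the derivation, for which the Leibniz rule carries no binomial
    coefficients. *)
Definition ddiv q (b : B) : B := (q`!%:R)^-1 *: iter q deriv_op b.

Lemma ddivS q b : q.+1%:R *: ddiv q.+1 b = deriv_op (ddiv q b).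
Proof.
rewrite /ddiv iterS [RHS]linearZ scalerA; congr (_ *: _).
by rewrite factS natrM invfM mulrA mulfV ?natr_neq0 // mul1r.
Qed.

Lemma ddivM q a b : ddiv q (a * b) = \sum_(p < q.+1) ddiv p a * ddiv (q - p) b.
Proof.
elim: q => [|q IH]; first by rewrite big_ord1 /ddiv fact0 invr1 !scale1r.
apply: (scalerI (natr_neq0 F0 q)); rewrite ddivS IH linear_sum scaler_sumr /=.
under eq_bigr => p _ do rewrite deriv_opM -!ddivS.
rewrite big_split /=.
pose f p := ddiv p a * ddiv (q.+1 - p) b.
(* The two halves of the Leibniz rule contribute [f p] with weights p and q + 1 - p, whose sum is
   the factor q + 1 on the left. *)
transitivity (\sum_(p < q.+2) p%:R *: f p + \sum_(p < q.+2) (q.+1 - p)%:R *: f p).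
  congr (_ + _).
    rewrite [RHS]big_ord_recl /= mulr0n scale0r add0r; apply: eq_bigr => p _.
    by rewrite /f /bump leq0n add1n subSS scalerAl.
  rewrite [RHS]big_ord_recr /= subnn mulr0n scale0r addr0; apply: eq_bigr => p _ /=.
  by rewrite /f subSn ?scalerAr // -ltnS.
rewrite -big_split; apply: eq_bigr => p _ /=.
by rewrite -scalerDl -natrD subnKC // -ltnS.
Qed.

Lemma ddiv_ut q n (rho : group_hom Q (UT n F)) i j :
  ddiv q (val (rho B y) i j) =
    \sum_l ((q`!%:R)^-1 * (lie_mx rho X ^+ q) l j) *: val (rho B y) i l.
Proof.
under eq_bigr => l _ do rewrite -scalerA; rewrite -scaler_sumr; congr (_ *: _).
elim: q => [|q IH].
  rewrite expr0 (bigD1 j) //= mxE eqxx scale1r big1 ?addr0 // => l lj.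
  by rewrite mxE (negbTE lj) scale0r.
rewrite iterS IH linear_sum; under eq_bigr => l _ do
  rewrite linearZ /= deriv_op_ut scaler_sumr.
rewrite exchange_big; apply: eq_bigr => p _ /=.
under eq_bigr => l _ do rewrite scalerA mulrC.
by rewrite -scaler_suml exprS mxE.
Qed.

Lemma ddiv_lin q c a b : ddiv q (c *: a + b) = c *: ddiv q a + ddiv q b.
Proof.
rewrite /ddiv; have -> : iter q deriv_op (c *: a + b) =
    c *: iter q deriv_op a + iter q deriv_op b.
  by elim: q => //= q ->; rewrite linearP.
by rewrite scalerDr !scalerA mulrC.
Qed.

Lemma ddiv1 q : ddiv q.+1 1 = 0.
Proof.
rewrite /ddiv iterSr deriv_op1; elim: q => [|q IH]; first by rewrite scaler0.
rewrite iterSr linear0 factS natrM invfM -scalerA; move/eqP: IH.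
rewrite scaler_eq0 invr_eq0 (negbTE (fact_neq0 F0 _)) /= => /eqP ->.
by rewrite !scaler0.
Qed.

(** The locally nilpotent elements form a subalgebra by [ddivM]; on the entries of [s] the
    derivation acts through the nilpotent matrix [lie_mx s X]. *)
Lemma ddiv_nilp b : exists N, forall q, (N <= q)%N -> ddiv q b = 0.
Proof.
apply: (sgen b (S := fun b => exists N, forall q, (N <= q)%N -> ddiv q b = 0)).
  split.
  - by exists 1%N => -[//|q] _; exact: ddiv1.
  - move=> c u v [N uN] [N' vN]; exists (maxn N N') => q; rewrite geq_max => /andP [Nq N'q].
    by rewrite ddiv_lin uN // vN // scaler0 addr0.
  - move=> u v [N uN] [N' vN]; exists (N + N')%N => q Nq.
    rewrite ddivM big1 // => p _; case: (leqP N p) => Np; first by rewrite uN ?mul0r.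
    rewrite vN ?mulr0 // leq_subRL; last by rewrite -ltnS.
    by apply: leq_trans Nq; rewrite leq_add2r ltnW.
move=> _ [i [j ->]]; exists m => q mq; rewrite ddiv_ut big1 // => l _.
rewrite (strict_upper_nilpotent _ mq) ?mxE ?mulr0 ?scale0r // => a c ca.
exact: lie_mx_strict.
Qed.

(** The function b(exp(t X)) as a polynomial in [t]; [ddiv_nilp] bounds its degree. *)
Definition exp_poly b : {poly F} :=
  \poly_(q < projT1 (cid (ddiv_nilp b))) counit ry (ddiv q b).

Lemma coef_exp_poly b q : (exp_poly b)`_q = counit ry (ddiv q b).
Proof.
rewrite coef_poly; case: ltnP => // Nq.
by rewrite (projT2 (cid (ddiv_nilp b))) // linear0.
Qed.

Definition exp_ev (b : B) : F^o := (exp_poly b).[1].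

Fact exp_ev_linear : linear exp_ev.
Proof.
move=> c a b; transitivity (c *: exp_poly a + exp_poly b).[1]; last first.
  by rewrite hornerD hornerZ.
congr (_.[1]); apply/polyP => q.
by rewrite coefD coefZ !coef_exp_poly ddiv_lin linearP.
Qed.
Fact exp_ev_multiplicative : monoid_morphism exp_ev.
Proof.
split=> [|a b]; rewrite /exp_ev.
  rewrite -[RHS](hornerC 1 1); congr (_.[1]); apply/polyP => q.
  rewrite coef_exp_poly coefC; case: q => [|q].
    by rewrite /ddiv fact0 invr1 scale1r rmorph1.
  by rewrite ddiv1 linear0.
rewrite -hornerM; congr (_.[1]); apply/polyP => q.
rewrite coefM coef_exp_poly ddivM linear_sum; apply: eq_bigr => p _.
by rewrite rmorphM !coef_exp_poly.
Qed.
HB.instance Definition _ := GRing.isLinear.Build F B F^o *:%R exp_ev exp_ev_linear.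
HB.instance Definition _ := GRing.isMonoidMorphism.Build B F^o exp_ev exp_ev_multiplicative.

Definition expQ : Q F^o := pmap Q (exp_ev : {lrmorphism B -> F^o}) y.

Lemma is_exp_expQ : is_exp X expQ.
Proof.
move=> n rho; set Y := lie_mx rho X.
have Y0 q : (n <= q)%N -> Y ^+ q = 0.
  by apply: strict_upper_nilpotent => i j; exact: lie_mx_strict.
have E i j q : (exp_poly (val (rho B y) i j))`_q = (q`!%:R)^-1 * (Y ^+ q) i j.
  rewrite coef_exp_poly ddiv_ut linear_sum (bigD1 i) //= big1 => [|l li].
    by rewrite linearZ /= /counit ev_ut mult1 mxE eqxx addr0; exact: mulr1.
  by rewrite linearZ /= /counit ev_ut mult1 mxE eq_sym (negbTE li) scaler0.
apply/matrixP => i j; rewrite -(ev_ut ry rho) /expQ ev_pmap ev_id /= /exp_ev.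
rewrite (@horner_coef_wide _ n); last first.
  by apply/leq_sizeP => q nq; rewrite E Y0 // mxE mulr0.
by rewrite summxE; apply: eq_bigr => q _; rewrite expr1n mulr1 E mxE.
Qed.

End Exp.

Section RowSpace.
Variable F : fieldType.

Lemma lin_closed_row_space n (P : 'rV[F]_n -> Prop) : lin_closed P ->
  exists r (M : 'M[F]_(r, n)), row_free M /\ forall v, P v <-> exists c, v = c *m M.
Proof.
move=> PL; have [P0 PD] := PL.
pose T r := `[< exists M : 'M[F]_(r, n), row_free M /\ forall i, P (row i M) >].
have T0 : exists r, T r.
  by exists 0%N; apply/asboolP; exists 0; split=> [|[]//]; rewrite /row_free mxrank0.
have Tn r : T r -> (r <= n)%N.
  by move=> /asboolP [M [/eqP Mr _]]; rewrite -[X in (X <= _)%N]Mr rank_leq_col.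
case: (ex_maxnP T0 Tn) => r /asboolP [M [Mf MP]] rmax.
exists r, M; split=> // v; split=> [Pv|[c ->]]; last first.
  rewrite mulmx_sum_row; apply: (lin_closed_sum _ PL) => i _.
  exact: (lin_closedZ _ PL).
case: (boolP (v <= M)%MS) => [/submxP [c ->]|vM]; first by exists c.
have : T (1 + r)%N.
  apply/asboolP; exists (col_mx v M); split; last first.
    move=> i; case: (split_ordP i) => j ->; last by rewrite rowKd.
    by rewrite rowKu (ord1 j) row_id.
  rewrite /row_free -addsmxE mxrank_disjoint_sum.
    rewrite (eqP Mf) rank_rV; suff -> : v != 0 by [].
    by apply: contraNneq vM => ->; rewrite sub0mx.
  apply/eqP; rewrite -mxrank_eq0 -leqn0 -ltnS; apply: leq_trans (_ : (_ < \rank v)%N) _; last first.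
    exact: rank_leq_row.
  rewrite ltn_neqAle mxrankS ?capmxSl // andbT; apply: contra vM => /eqP E.
  have vle : (v <= v :&: M)%MS by rewrite -(mxrank_leqif_sup (capmxSl v M)) E.
  exact: submx_trans vle (capmxSr _ _).
by move/rmax; rewrite ltnn.
Qed.

End RowSpace.

Lemma dual_eps_sum (F : fieldType) I (r : seq I) (f : I -> dual F) :
  dual_eps (\sum_(i <- r) f i) = \sum_(i <- r) dual_eps (f i).
Proof. exact: (big_morph (@dual_eps F)). Qed.

Section LieCoordinates.
Variables (F : fieldType) (Q : group_functor F) (B : comAlgType F) (y : Q B).
Hypothesis ry : represents y.
Variables (m : nat) (s : group_hom Q (UT m F)).
Hypothesis sgen : forall b, gen (fun c => exists i j, c = val (s B y) i j) b.

Lemma lie_val n (rho : group_hom Q (UT n F)) (X : Q (dual F)) i j : Lie X ->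
  val (rho (dual F) X) i j = Dual (i == j)%:R (lie_mx rho X i j).
Proof.
move=> XL; apply: dual_ext; last by rewrite /= mxE.
rewrite -(ev_ut ry) (lie_re ry _ XL) /counit ev_ut mult1 mxE /=.
by case: eqP.
Qed.

Lemma LieM (X X' : Q (dual F)) : Lie X -> Lie X' -> Lie (X * X')%g.
Proof. by rewrite /Lie /= => XL X'L; rewrite gmulfM XL X'L mulg1. Qed.

Lemma lie_mxM n (rho : group_hom Q (UT n F)) (X X' : Q (dual F)) : Lie X -> Lie X' ->
  lie_mx rho (X * X')%g = lie_mx rho X + lie_mx rho X'.
Proof.
move=> XL X'L; apply/matrixP => i j; rewrite !mxE gmulfM mxE dual_eps_sum.
under eq_bigr => l _ do rewrite !lie_val //=.
rewrite big_split /= addrC; congr (_ + _).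
  rewrite (bigD1 j) //= eqxx mulr1 big1 ?addr0 ?mxE // => l lj.
  by rewrite (negbTE lj) mulr0.
rewrite (bigD1 i) //= eqxx mul1r big1 ?addr0 ?mxE // => l li.
by rewrite eq_sym (negbTE li) mul0r.
Qed.

Lemma lie_mx_homothety n (rho : group_hom Q (UT n F)) a (X : Q (dual F)) :
  lie_mx rho (pmap Q (dual_homothety a) X) = a *: lie_mx rho X.
Proof. by apply/matrixP => i j; rewrite mxE hom_natural !mxE. Qed.

Lemma Lie_homothety a (X : Q (dual F)) : Lie X -> Lie (pmap Q (dual_homothety a) X).
Proof.
rewrite /Lie /= => XL; rewrite -pmap_comp -[RHS]XL; congr (pmap Q _ X).
exact: lrmorphism_eq.
Qed.

Lemma Lie1 : Lie (1%g : Q (dual F)).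
Proof. by rewrite /Lie /= mult1. Qed.

Lemma lie_mx1 n (rho : group_hom Q (UT n F)) : lie_mx rho 1%g = 0.
Proof.
by apply/matrixP => i j; rewrite !mxE mult1 mxE; case: (i == j).
Qed.

Lemma lie_mx_inj (X X' : Q (dual F)) : Lie X -> Lie X' ->
  lie_mx s X = lie_mx s X' -> X = X'.
Proof.
move=> XL X'L E; apply: (ut_points_inj ry sgen); apply/matrixP => i j.
by rewrite !lie_val // E.
Qed.

(** Through [s] the Lie algebra becomes a linear space of matrices, of which the rows of [M] form a
    basis. *)
Lemma lie_coordinates_ex : exists r (b : 'rV[F]_r -> Q (dual F)) (M : 'M[F]_(r, m * m)),
  lie_coordinates b /\ forall v, mxvec (lie_mx s (b v)) = v *m M.
Proof.
pose P (v : 'rV[F]_(m * m)) := exists2 X : Q (dual F), Lie X & mxvec (lie_mx s X) = v.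
have PL : lin_closed P.
  split; first by exists 1%g; [exact: Lie1 | rewrite lie_mx1 linear0].
  move=> a _ _ [X XL <-] [X' X'L <-].
  exists (pmap Q (dual_homothety a) X * X')%g; first exact/LieM/X'L/Lie_homothety.
  by rewrite lie_mxM ?lie_mx_homothety ?linearP //; exact: Lie_homothety.
have [r [M [Mf MP]]] := lin_closed_row_space PL.
have bex v : exists X, Lie X /\ mxvec (lie_mx s X) = v *m M.
  have [X XL XE] : P (v *m M) by apply/MP; exists v.
  by exists X.
have [b bP] := choice bex; exists r, b, M; split=> [|v]; last by case: (bP v).
have bL v : Lie (b v) by case: (bP v).
have bE v : mxvec (lie_mx s (b v)) = v *m M by case: (bP v).
have ext X X' : Lie X -> Lie X' -> mxvec (lie_mx s X) = mxvec (lie_mx s X') -> X = X'.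
  by move=> XL X'L E; apply: lie_mx_inj => //; exact: (can_inj mxvecK).
split.
- move=> v w; apply: ext; rewrite ?lie_mxM ?linearD /= ?bE ?mulmxDl //; exact: LieM.
- move=> a v; apply: ext; rewrite ?lie_mx_homothety ?linearZ /= ?bE ?scalemxAl //.
  exact: Lie_homothety.
split=> [v _|v w _ _ vw|X XL] /=; first exact: bL.
  by apply: (row_free_inj Mf); rewrite -!bE vw.
have [c cE] : exists c, mxvec (lie_mx s X) = c *m M by apply/MP; exists X.
by exists c => //; apply: ext; rewrite ?bE.
Qed.

(* [L] exists because [v |-> lie_mx s (b v)] is linear and injective. *)
Lemma lie_coordinates_retract r (b : 'rV[F]_r -> Q (dual F)) : lie_coordinates b ->
  exists L : 'M[F]_(m * m, r), forall v, mxvec (lie_mx s (b v)) *m L = v.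
Proof.
case=> bD bZ [bL bI _].
have bLie v : Lie (b v) by exact: bL.
pose f v := mxvec (lie_mx s (b v)).
have fL : linear f.
  by move=> a v w; rewrite /f bD bZ lie_mxM ?lie_mx_homothety ?linearP //; exact: Lie_homothety.
pose fM := GRing.isLinear.Build F _ _ *:%R f fL.
pose f' : {linear 'rV[F]_r -> 'rV[F]_(m * m)} := HB.pack_for {linear _ -> _} f fM.
have fE v : f v = v *m lin1_mx f' by rewrite mul_rV_lin1.
have Mf : row_free (lin1_mx f').
  apply: inj_row_free => v; rewrite -fE => fv; apply: bI; do ?exact: mem_set.
  apply: lie_mx_inj => //; apply: (can_inj mxvecK); rewrite -/(f v) -/(f 0) fv.
  by rewrite -[0 in RHS](scale0r 0) -[X in f X](addr0 _) fL scale0r add0r fE mul0mx.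
exists (pinvmx (lin1_mx f')) => v; rewrite -/(f v) fE -mulmxA.
by rewrite mulmxVp // mulmx1.
Qed.

End LieCoordinates.

(** * The topology of rational points *)

Section Continuity.
Variables (T : topologicalType) (F : topFieldType).
Implicit Types f g : T -> F.

Lemma continuous_cst (S : topologicalType) (c : S) : continuous (fun _ : T => c).
Proof. by move=> t; exact: cvg_cst. Qed.

Lemma continuous_add f g : continuous f -> continuous g -> continuous (fun t => f t + g t).
Proof.
move=> fc gc t.
apply: (@continuous_comp _ _ _ (fun t => (f t, g t)) (fun z : F * F => z.1 + z.2)).
  by apply: cvg_pair; [exact: fc | exact: gc].
exact: tvs.add_continuous.
Qed.

Lemma continuous_mul f g : continuous f -> continuous g -> continuous (fun t => f t * g t).
Proof.
move=> fc gc t.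
apply: (@continuous_comp _ _ _ (fun t => (f t, g t)) (fun z : F * F => z.1 * z.2)).
  by apply: cvg_pair; [exact: fc | exact: gc].
exact: mulr_continuous.
Qed.

Lemma continuous_sum (I : Type) (r : seq I) (P : pred I) (f : I -> T -> F) :
  (forall i, continuous (f i)) -> continuous (fun t => \sum_(i <- r | P i) f i t).
Proof.
move=> fc; elim: r => [|i r IH].
  have -> : (fun t => \sum_(i <- [::] | P i) f i t) = fun=> 0.
    by apply/funext => t; rewrite big_nil.
  exact: continuous_cst.
have -> : (fun t => \sum_(i <- i :: r | P i) f i t) =
    (fun t => (if P i then f i t else 0) + \sum_(i <- r | P i) f i t).
  by apply/funext => t; rewrite big_cons; case: ifP => // _; rewrite add0r.
apply: continuous_add => //; case: (P i); [exact: fc | exact: continuous_cst].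
Qed.

Lemma subalg_continuous (A : comAlgType F) (e : T -> {lrmorphism A -> F^o}) :
  subalg (fun a => continuous (fun t => e t a : F)).
Proof.
split=> [|c u v uc vc|u v uc vc].
- have -> : (fun t => e t 1 : F) = fun=> 1 by apply/funext => t; rewrite rmorph1.
  exact: continuous_cst.
- have -> : (fun t => e t (c *: u + v) : F) = (fun t => c * e t u + e t v).
    by apply/funext => t; rewrite linearP.
  by apply: continuous_add => //; apply: continuous_mul => //; exact: continuous_cst.
- have -> : (fun t => e t (u * v) : F) = (fun t => e t u * e t v).
    by apply/funext => t; rewrite rmorphM.
  exact: continuous_mul.
Qed.

Definition mx_continuous m n (M : T -> 'M[F]_(m, n)) : Prop :=
  forall i j, continuous (fun t => M t i j).

Lemma mx_continuousP m n (M : T -> 'M[F]_(m, n)) : mx_continuous M -> continuous M.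
Proof.
move=> Mc t A [P tP PA].
have : \forall u \near t, forall i j, P i j (M u i j).
  apply: filter_forall => i; apply: filter_forall => j; exact: (Mc i j t _ (tP i j)).
by apply: filterS => u Pu; apply: PA => i j; exact: Pu.
Qed.

Lemma mx_continuous_mul m n p (M : T -> 'M[F]_(m, n)) (N : T -> 'M[F]_(n, p)) :
  mx_continuous M -> mx_continuous N -> mx_continuous (fun t => M t *m N t).
Proof.
move=> Mc Nc i j; under eq_fun do rewrite mxE.
by apply: continuous_sum => l; exact: continuous_mul.
Qed.

Lemma mx_continuous_cst m n (M : 'M[F]_(m, n)) : mx_continuous (fun _ => M).
Proof. by move=> i j; exact: continuous_cst. Qed.

Lemma mx_continuous_sub m n (M N : T -> 'M[F]_(m, n)) :
  mx_continuous M -> mx_continuous N -> mx_continuous (fun t => M t - N t).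
Proof.
move=> Mc Nc i j; under eq_fun do rewrite !mxE -mulN1r.
apply: continuous_add; first exact: Mc.
by apply: continuous_mul; [exact: continuous_cst | exact: Nc].
Qed.

Lemma mx_continuous_scale m n (c : F) (M : T -> 'M[F]_(m, n)) :
  mx_continuous M -> mx_continuous (fun t => c *: M t).
Proof.
move=> Mc i j; under eq_fun do rewrite !mxE.
by apply: continuous_mul; [exact: continuous_cst | exact: Mc].
Qed.

Lemma mx_continuous_sum m n (I : Type) (r : seq I) (P : pred I) (M : I -> T -> 'M[F]_(m, n)) :
  (forall i, mx_continuous (M i)) -> mx_continuous (fun t => \sum_(i <- r | P i) M i t).
Proof.
move=> Mc i j; under eq_fun do rewrite summxE.
by apply: continuous_sum => l; exact: Mc.
Qed.

Lemma mx_continuous_exp n (M : T -> 'M[F]_n) p :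
  mx_continuous M -> mx_continuous (fun t => M t ^+ p).
Proof.
move=> Mc; elim: p => [|p IH] i j; under eq_fun do rewrite ?expr0 ?exprS.
  exact: continuous_cst.
exact: (mx_continuous_mul Mc IH).
Qed.

Lemma mx_continuous_mxvec m n (M : T -> 'M[F]_(m, n)) :
  mx_continuous M -> mx_continuous (fun t => mxvec (M t)).
Proof.
move=> Mc i j; case/mxvec_indexP: j => a b.
have -> : (fun t => mxvec (M t) i (mxvec_index a b)) = (fun t => M t a b).
  by apply/funext => t; rewrite (ord1 i) mxvecE.
exact: Mc.
Qed.

Lemma mx_continuous_vec_mx m n (M : T -> 'rV[F]_(m * n)) :
  mx_continuous M -> mx_continuous (fun t => vec_mx (M t)).
Proof.
move=> Mc i j; have -> : (fun t => vec_mx (M t) i j) = fun t => M t 0 (mxvec_index i j).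
  by apply/funext => t; rewrite mxE.
exact: Mc.
Qed.

End Continuity.

Lemma continuous_entry (F : topFieldType) m n (i : 'I_m) (j : 'I_n) :
  continuous (fun M : 'M[F]_(m, n) => M i j).
Proof.
move=> M A MA; exists (fun a b => if (a == i) && (b == j) then A else setT).
  by move=> a b; case: ifP => [/andP [/eqP -> /eqP ->] //|_]; exact: filterT.
by move=> N /(_ i j); rewrite !eqxx.
Qed.

Section RationalPoints.
Variables (F : topFieldType) (U : group_functor F).
Hypothesis F0 : [pchar F] =i pred0.

Lemma subbase_open V : rat_points_subbase V -> open (V : set (rat_points U)).
Proof.
move=> SV; exists [set V]; last first.
  by rewrite predeqE => ?; split=> [[_ ->]|] //; exists V.
move=> _ ->; exists [fset V]%fset.
  by move=> W; rewrite in_fset1 => /eqP ->; exact/mem_set.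
rewrite predeqE => t; split=> [|Vt W]; first by apply; rewrite /= in_fset1.
by rewrite /= in_fset1 => /eqP ->.
Qed.

Lemma continuous_rat_points (T : topologicalType) (f : T -> rat_points U) :
  (forall V, rat_points_subbase V -> open (f @^-1` V)) -> continuous f.
Proof.
move=> fV t A /=; rewrite nbhsE => -[_ [[B sB <-] [C BC Ct] sUBA]].
rewrite nbhs_filterE; apply: filterS sUBA _; apply: (@filterS _ _ _ C).
  by move=> ? ?; exists C.
have /sB [D sD IDeC] := BC; rewrite -IDeC; apply: filter_bigI => E DE.
have /sD/set_mem/fV oE := DE; apply: open_nbhs_nbhs; split=> //.
by move: Ct; rewrite -IDeC => /(_ _ DE).
Qed.

Variables (A : comAlgType F) (x : U A).
Hypothesis rx : represents x.
Hypothesis Up : pro_unipotent U.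
Variable T : topologicalType.

(** It suffices to treat subbasic sets, which come from algebraic quotients. There the coordinates
    of log are polynomials in the matrix entries, hence continuous. *)
Lemma continuous_of_coordinates (f : T -> rat_points U) :
  (forall a, continuous (fun t => ev rx (f t : U F^o) a : F)) -> continuous f.
Proof.
move=> fc; apply: continuous_rat_points => V [Q [p [W [algQ qp Wo ->]]]].
have [r [b [bL Oo]]] := Wo; set O := (X in open X) in Oo.
have [m [s sgen]] := unipotent_gen (Up.2 Q p algQ qp).
have [B [y [ry _]]] := algQ; have {}sgen := sgen B y ry.
have [L LE] := lie_coordinates_retract ry sgen bL.
pose u t := val (s F^o (p F^o (f t))).
(* The Lie coordinates of the logarithm of p(f t): [L] inverts the linear map from coordinates to
   matrices. *)
pose th t := mxvec (\sum_(l < m) (binp F l)^`().[0] *: (u t - 1) ^+ l) *m L.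
have thE t : b (th t) = logQ F0 ry sgen (p F^o (f t)).
  have [bD _ [bl bI bS]] := bL.
  have [v _ vE] := bS _ (logQ_Lie F0 ry sgen (p F^o (f t))).
  by rewrite /th -(lie_mx_log F0 ry sgen) -vE LE.
have uc : mx_continuous u.
  move=> i j; have := fc (ev ry (p A x) (val (s B y) i j)).
  by under eq_fun do rewrite -(ev_hom p rx ry) ev_ut.
have thc : continuous th.
  apply: mx_continuousP; apply: mx_continuous_mul; last exact: mx_continuous_cst.
  apply: mx_continuous_mxvec; apply: mx_continuous_sum => l.
  apply: mx_continuous_scale; apply: mx_continuous_exp; apply: mx_continuous_sub => //.
  exact: mx_continuous_cst.
have -> : f @^-1` (p F^o @^-1` W) = th @^-1` O.
  apply/seteqP; split=> t /= Wt.
    by exists (p F^o (f t)) => //; rewrite thE; exact: is_exp_log.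
  have [g Wg ge] := Wt; suff -> : p F^o (f t) = g by [].
  by apply: (is_exp_uniq ry sgen _ ge); rewrite thE; exact: is_exp_log.
by apply: open_comp => // t _; exact: thc.
Qed.

(** The function [a] descends to an algebraic quotient, where it is enough that it be continuous in
    Lie coordinates: the entries of exp are polynomials in those. *)
Lemma coordinates_continuous (f : T -> rat_points U) a :
  continuous f -> continuous (fun t => ev rx (f t : U F^o) a : F).
Proof.
move=> fc; apply/continuousP => O Oo.
have [Q [p [B [y [ry [c [algQ qp ac]]]]]]] := algebraic_quotient rx a.
have [m [s sgen]] := unipotent_gen (Up.2 Q p algQ qp).
have {}sgen := sgen B y ry.
pose W : set (Q F^o) := [set q : Q F^o | O (ev ry q c : F)].
have -> : (fun t => ev rx (f t : U F^o) a : F) @^-1` O = f @^-1` (p F^o @^-1` W).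
  by apply/seteqP; split=> t /=; rewrite /W /= ac.
apply: open_comp => [t _|]; first exact: fc.
apply: subbase_open; exists Q, p, W; split=> //.
have [r [b [M [bL bE]]]] := lie_coordinates_ex ry sgen.
have bLie v : Lie (b v) by case: bL => _ _ [bl _ _]; exact: bl.
exists r, b; split=> //.
pose E v := expQ F0 ry sgen (bLie v).
have -> : [set v | exists2 g, W g & is_exp (b v) g] = (fun v => ev ry (E v) c : F) @^-1` O.
  apply/seteqP; split=> v /=.
    move=> [g Wg ge]; suff -> : E v = g by [].
    exact: (is_exp_uniq ry sgen (is_exp_expQ _ _ _ _) ge).
  by move=> Ov; exists (E v) => //; exact: is_exp_expQ.
apply: open_comp => // v _; move: v.
apply: (sgen c (fun c => continuous (fun v => ev ry (E v) c : F))).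
  exact: (subalg_continuous (fun v => ev ry (E v))).
move=> _ [i [j ->]]; under eq_fun do rewrite ev_ut (is_exp_expQ F0 ry sgen (bLie _)).
have : mx_continuous (fun v : 'rV[F]_r => \sum_(n < m) n`!%:R^-1 *: lie_mx s (b v) ^+ n).
  apply: mx_continuous_sum => l; apply: mx_continuous_scale; apply: mx_continuous_exp.
  under [X in mx_continuous X]eq_fun do rewrite -[lie_mx _ _]mxvecK bE.
  apply: mx_continuous_vec_mx; apply: mx_continuous_mul; last exact: mx_continuous_cst.
  by move=> i' j'; exact: continuous_entry.
exact.
Qed.

End RationalPoints.

(** * Coefficients over the subfield *)

Section DenseClosed.

Lemma dense_closed (T : topologicalType) (S C : set T) :
  dense S -> closed C -> S `<=` C -> forall t, C t.
Proof.
move=> dS cC SC t; apply: contrapT => Ct.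
have [|u [Cu Su]] := dS (~` C) _ (closed_openC cC); first by exists t.
by apply: Cu; exact: SC.
Qed.

Lemma closed_eq0 (T : topologicalType) (F : topFieldType) (f : T -> F) :
  hausdorff_space F -> continuous f -> closed [set t | f t = 0].
Proof.
move=> hF /continuous_closedP fc.
have -> : [set t | f t = 0] = f @^-1` [set 0] by [].
by apply: fc; exact/accessible_closed_set1/hausdorff_accessible.
Qed.

End DenseClosed.

Section FiniteCoefficients.
Variables (G : topGroupType) (k K : topFieldType) (i : closed_subfield k K).
Hypothesis Gfg : topologically_fin_gen G.
Hypothesis k_haus : hausdorff_space k.
Hypothesis wc : weakly_cartesian_pair i.
Variables (m : nat) (f : {multiplicative G -> ut_of m K}).
Hypothesis fc : mx_continuous (fun g => val (f g)).
Variable w : 'cV[K]_m.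

Local Notation X l := (val (f l) - 1%:M).

(** The vectors obtained from [w] by at most [n] operators f(l) - 1 with [l] in [s]. Length [m] is
    enough to span a stable space, as longer words contribute only zero. *)
Fixpoint orbit_words (s : seq G) (n : nat) : seq 'cV[K]_m :=
  if n is p.+1 then w :: [seq X l *m t | l <- s, t <- orbit_words s p] else [:: w].

Lemma orbit_wordsS (s : seq G) n :
  orbit_words s n.+1 = w :: [seq X l *m t | l <- s, t <- orbit_words s n].
Proof. by []. Qed.

Lemma orbit_words_ind (s : seq G) (P : 'cV[K]_m -> Prop) n :
  P w -> (forall l t, l \in s -> P t -> P (X l *m t)) ->
  forall t, t \in orbit_words s n -> P t.
Proof.
move=> Pw PX; elim: n => [|n IH] t /=; first by rewrite mem_seq1 => /eqP ->.
rewrite inE => /orP [/eqP -> //|/allpairsP [[l u] /= [ls us ->]]].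
by apply: PX => //; exact: IH.
Qed.

Lemma orbit_words_head (s : seq G) n : w \in orbit_words s n.
Proof. by case: n => [|n]; rewrite ?orbit_wordsS mem_head. Qed.

Lemma orbit_words_step (s : seq G) n l t : l \in s -> t \in orbit_words s n ->
  X l *m t \in orbit_words s n.+1.
Proof.
move=> ls ts; rewrite inE; apply/orP; right.
by apply/allpairsP; exists (l, t).
Qed.

Lemma strict_upper_mul j l (t : 'cV[K]_m) :
  (forall a : 'I_m, (m <= a + j)%N -> t a 0 = 0) ->
  forall a : 'I_m, (m <= a + j.+1)%N -> (X l *m t) a 0 = 0.
Proof.
move=> tj a aj; rewrite mxE big1 // => b _; case: (leqP b a) => ba.
  have /unitriangularP U := valP (f l).
  by rewrite !mxE U // subrr mul0r.
rewrite tj ?mulr0 // (leq_trans aj) // addnS -addSn leq_add2r //.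
Qed.

(** Every letter is strictly upper triangular and clears one more entry at the bottom, so a word
    with n + 1 letters has its last n + 1 entries equal to zero. *)
Lemma orbit_words_depth (s : seq G) n t : t \in orbit_words s n.+1 ->
  t \in orbit_words s n \/ forall a : 'I_m, (m <= a + n.+1)%N -> t a 0 = 0.
Proof.
elim: n t => [|n IH] t; rewrite orbit_wordsS inE => /orP [/eqP ->|].
- by left; rewrite mem_seq1.
- move=> /allpairsP [[l u] /= [_ _ ->]]; right; apply: strict_upper_mul => a.
  by rewrite addn0 leqNgt ltn_ord.
- by left; rewrite inE eqxx.
move=> /allpairsP [[l u] [ls us ->]].
have [un|ud] := IH u us; first by left; exact: orbit_words_step.
by right; exact: strict_upper_mul.
Qed.

Lemma orbit_words_stable (s : seq G) l t : l \in s -> t \in orbit_words s m ->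
  X l *m t \in orbit_words s m \/ X l *m t = 0.
Proof.
move=> ls ts; have [|d] := orbit_words_depth (orbit_words_step ls ts); first by left.
right; apply/matrixP => a b; rewrite (ord1 b) d ?mxE //.
exact: leq_trans (leqnSn _) (leq_addl _ _).
Qed.

(** The hypothesis concerns subspaces of [K], not of K^m, so it is applied to the [k]-span of all
    entries of the vectors at once. The last clause is the embedding property: continuity can be
    tested after [b]. *)
Lemma entries_coordinates (q : nat) (tt : 'I_q -> 'cV[K]_m) :
  exists r (b : 'rV[k]_r -> K),
    [/\ forall c y z, b (c *: y + z) = i c * b y + b z, injective b,
        forall j a, range b (tt j a 0), closed (range b)
      & forall (T : topologicalType) (h : T -> 'rV[k]_r), continuous (fun t => b (h t)) ->
          continuous h].
Proof.
pose u (p : 'I_#|{: 'I_m * 'I_q}|) : tv_module (subfield_vect i) :=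
  tt (enum_val p).2 (enum_val p).1 0.
have [|cW [r [b [bW [bI bO]]]]] := wc (W := range (fun c : 'rV[k]_ _ => \sum_p c 0 p *: u p)).
  by exists _, u.
exists r, b; split=> //.
- by move=> c y z; exact: (linearP b).
- move=> j a; rewrite bW; exists (delta_mx 0 (enum_rank (a, j))) => //.
  rewrite (bigD1 (enum_rank (a, j))) //= big1 => [|p pn]; last first.
    by rewrite mxE (negbTE pn) scale0r.
  by rewrite mxE !eqxx scale1r addr0 /u enum_rankK.
- by rewrite bW.
move=> T h hc; apply/continuousP => O /bO [B Bo ->].
by apply: (open_comp (f := fun t => b (h t))) => // t _; exact: hc.
Qed.

(** The columns of [T] form a [k]-basis of the span of the orbit of [w], and [lam g] is the matrix
    of f(g) in it. The last clause is what [malcev_dense] relies on. *)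
Lemma finite_coefficients_mx : exists N (lam : G -> 'M[k]_N) (T : 'M[K]_(m, N)) (v : 'cV[k]_N),
  [/\ mx_continuous lam,
      forall n (M M' : 'M[k]_(N, n)), T *m map_mx i M = T *m map_mx i M' -> M = M',
      forall g, val (f g) *m T = T *m map_mx i (lam g),
      T *m map_mx i v = w
    & forall xi : 'rV[K]_m, (forall g, xi *m val (f g) *m w = 0) -> xi *m T = 0].
Proof.
have [s sdense] := Gfg.
pose tau := orbit_words s m; pose q := size tau.
pose tt (j : 'I_q) : 'cV[K]_m := tau`_j.
have tauP t : t \in tau -> exists j, t = tt j.
  by move=> /(nthP 0) [j jq <-]; exists (Ordinal jq).
have ttau j : tt j \in tau by exact: mem_nth.
have [r [b [bL bI tb cb bcont]]] := entries_coordinates tt.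
have b0 : b 0 = 0.
  have := bL 1 0 0; rewrite scale1r addr0 rmorph1 mul1r => /eqP.
  by rewrite -subr_eq0 opprD addNKr oppr_eq0 => /eqP.
have bZ c y : b (c *: y) = i c * b y by rewrite -[c *: y]addr0 bL b0 addr0.
have bD y z : b (y + z) = b y + b z.
  by rewrite -[y in LHS]scale1r bL rmorph1 mul1r.
have bsum I (l : seq I) (h : I -> 'rV[k]_r) : b (\sum_(p <- l) h p) = \sum_(p <- l) b (h p).
  by apply: (big_morph b).
(* Identifies k^(m r) with the vectors of K^m whose entries lie in the range of [b]. *)
pose psi (z : 'rV[k]_(m * r)) : 'cV[K]_m := \col_a b (row a (vec_mx z)).
have psiI : injective psi.
  move=> z z' /matrixP zz'; apply: (can_inj vec_mxK); apply/row_matrixP => a.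
  by apply: bI; have := zz' a 0; rewrite !mxE.
have psi_mul n (c : 'rV[k]_n) (M : 'M[k]_(n, m * r)) :
    psi (c *m M) = \sum_j i (c 0 j) *: psi (row j M).
  apply/matrixP => a e; rewrite !mxE mulmx_sum_row !linear_sum bsum summxE.
  by apply: eq_bigr => j _; rewrite !linearZ /= bZ !mxE.
have psi_ex (y : 'cV[K]_m) : (forall a, range b (y a 0)) -> exists z, psi z = y.
  move=> yb; have yb' a : exists c, b c = y a 0 by have [c _ cE] := yb a; exists c.
  have [c cE] := choice yb'; exists (mxvec (\matrix_a c a)); apply/matrixP => a e.
  by rewrite mxE mxvecK rowK (ord1 e).
have [z zE] := choice (fun j => psi_ex (tt j) (tb j)).
(* The rows of [M] are the orbit words in these coordinates; a row basis [D] of [M] gives the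
   columns of [T]. *)
pose M := \matrix_j z j; pose N := \rank M; pose D := row_base M.
have DM : (D :=: M)%MS := eq_row_base M.
have Df : row_free D := row_base_free M.
pose T : 'M[K]_(m, N) := \matrix_(a, j) psi (row j D) a 0.
have TE (c : 'cV[k]_N) : T *m map_mx i c = psi (c^T *m D).
  rewrite psi_mul; apply/matrixP => a e; rewrite (ord1 e) mxE summxE.
  by apply: eq_bigr => j _; rewrite !mxE mulrC.
have TI n (M1 M2 : 'M[k]_(N, n)) : T *m map_mx i M1 = T *m map_mx i M2 -> M1 = M2.
  move=> E; have cE e : col e M1 = col e M2.
    apply: trmx_inj; apply: (row_free_inj Df); apply: psiI; rewrite -!TE !map_col.
    by rewrite !colE !mulmxA E.
  by apply/matrixP => a e; have /matrixP/(_ a 0) := cE e; rewrite !mxE.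
pose V (y : 'cV[K]_m) := exists c : 'cV[k]_N, y = T *m map_mx i c.
have VM (c : 'rV[k]_(m * r)) : (c <= M)%MS -> V (psi c).
  rewrite -DM => /submxP [d ->]; exists d^T; by rewrite TE trmxK.
have V0 : V 0 by exists 0; rewrite map_mx0 mulmx0.
have VD y y' : V y -> V y' -> V (y + y').
  by move=> [c ->] [c' ->]; exists (c + c'); rewrite map_mxD mulmxDr.
have VN y : V y -> V (- y).
  by move=> [c ->]; exists (- c); rewrite map_mxN mulmxN.
have VZ c y : V y -> V (i c *: y).
  by move=> [d ->]; exists (c *: d); rewrite map_mxZ -scalemxAr.
have Vsum I (l : seq I) (h : I -> 'cV[K]_m) : (forall p, V (h p)) -> V (\sum_(p <- l) h p).
  by move=> Vh; elim/big_ind: _.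
have Vtau t : t \in tau -> V t.
  move=> /tauP [j ->]; rewrite -zE; apply: VM.
  by rewrite -[z j](rowK z); exact: row_sub.
have Vspan y : V y -> exists d : 'rV[k]_q, y = \sum_j i (d 0 j) *: tt j.
  move=> [c ->]; have /submxP [d dE] : (c^T *m D <= M)%MS by rewrite -DM submxMl.
  exists d; rewrite TE dE psi_mul; apply: eq_bigr => j _.
  by rewrite rowK zE.
have Vtau_map (A : 'M[K]_m) : (forall t, t \in tau -> V (A *m t)) -> forall y, V y -> V (A *m y).
  move=> At y /Vspan [d ->]; rewrite mulmx_sumr; apply: Vsum => j.
  by rewrite -scalemxAr; exact/VZ/At.
have VX l y : l \in s -> V y -> V (X l *m y).
  move=> ls; apply: Vtau_map => t tt'; have [/Vtau //|-> //] := orbit_words_stable ls tt'.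
have Vgen g : generated_subgroup s g -> forall y, V y -> V (val (f g) *m y).
  (* [group_closed] involves inverses, so the predicate records that both g and its inverse preserve
     [V]. *)
  pose H : {pred G} := fun g => `[< (forall y, V y -> V (val (f g) *m y)) /\
    (forall y, V y -> V (val (f g^-1%g) *m y)) >].
  move=> /(_ H) gH; suff /asboolP [] : g \in H by [].
  apply: gH => [|l ls].
    split=> [|g1 g2 /asboolP [H1 H1'] /asboolP [H2 H2']]; apply/asboolP.
      by split=> y; rewrite ?invg1 mult1 mul1mx.
    by split=> y Vy; rewrite ?invgF ?invgM ?invgK gmulfM /= -mulmxA; auto.
  apply/asboolP; split=> y Vy.
    rewrite -[val (f l)](subrK 1%:M) mulmxDl mul1mx; apply: VD => //; exact: VX.
  (* The inverse of a unitriangular matrix is a sum of powers of 1 minus that matrix, so stability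
     under f(l) - 1 is enough. *)
  rewrite multV [val _]/= /ut_inv_mx mulmx_suml; apply: Vsum => p.
  elim: (p : nat) => [|p' IH]; first by rewrite expr0 mul1mx.
  rewrite exprS -mulmxA; move: IH; move: (_ *m y) => y' Vy'.
  by rewrite -opprB mulNmx; apply: VN; exact: (VX l _ ls Vy').
have colT j : V (col j T) by exists (delta_mx j 0); rewrite map_delta_mx colE.
(* Passage from the dense subgroup to [G] takes two closed conditions. Here it is that the entries
   of f(g) T lie in the closed range of [b]. *)
have fT g j : exists z, psi z = val (f g) *m col j T.
  apply: psi_ex => a; move: g.
  apply: (dense_closed sdense) => [|g /Vgen /(_ _ (colT j)) [c ->]].
    have /continuous_closedP : continuous (fun g => (val (f g) *m col j T) a 0).
      by apply: mx_continuous_mul => //; exact: mx_continuous_cst.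
    by apply.
  by rewrite TE mxE; exists (row a (vec_mx (c^T *m D))).
have [h hE] : exists h : G -> 'I_N -> 'rV[k]_(m * r),
    forall g j, psi (h g j) = val (f g) *m col j T.
  have [h hE] := choice (fun p => fT p.1 p.2).
  by exists (fun g j => h (g, j)) => g j; exact: (hE (g, j)).
have hc j : mx_continuous (fun g => h g j).
  move=> e p; case/mxvec_indexP: p => a p; rewrite (ord1 e).
  have -> : (fun g => h g j 0 (mxvec_index a p)) = (fun g => row a (vec_mx (h g j)) 0 p).
    by apply/funext => g; rewrite !mxE.
  have rc : continuous (fun g => row a (vec_mx (h g j))).
    apply: bcont.
    have -> : (fun g => b (row a (vec_mx (h g j)))) = (fun g => (val (f g) *m col j T) a 0).
      by apply/funext => g; rewrite -hE mxE.
    by apply: mx_continuous_mul => //; exact: mx_continuous_cst.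
  move=> g; apply: (@continuous_comp _ _ _ (fun g => row a (vec_mx (h g j)))
    (fun M : 'rV[k]_r => M 0 p)); first exact: rc.
  exact: continuous_entry.
(* The second condition is that these coordinates lie in the row space of [D], the kernel of
   [cokermx D], which is closed since [k] is Hausdorff. *)
have hD g j : (h g j <= D)%MS.
  rewrite submxE; apply/eqP/matrixP => e p; rewrite [RHS]mxE (ord1 e); move: g.
  apply: (dense_closed sdense) => [|g /Vgen /(_ _ (colT j)) [c cE]].
    apply: closed_eq0 => //.
    by apply: mx_continuous_mul => //; exact: mx_continuous_cst.
  have -> : h g j = c^T *m D by apply: psiI; rewrite hE cE TE.
  by rewrite -mulmxA mulmx_coker mulmx0 mxE.
pose lam g : 'M[k]_N := \matrix_(a, j) (h g j *m pinvmx D) 0 a.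
have lamE g j : col j (lam g) = (h g j *m pinvmx D)^T.
  by apply/matrixP => a e; rewrite !mxE (ord1 e).
have Tlam g : val (f g) *m T = T *m map_mx i (lam g).
  apply/matrixP => a j.
  have : col j (val (f g) *m T) = col j (T *m map_mx i (lam g)).
    rewrite colE -mulmxA -colE -hE [RHS]colE -mulmxA -colE -map_col TE lamE trmxK.
    by rewrite mulmxKpV.
  by move/matrixP/(_ a 0); rewrite !mxE.
have [v vE] : V w by apply: Vtau; exact: orbit_words_head.
exists N, lam, T, v; split=> //.
  move=> a j; have -> : (fun g => lam g a j) = (fun g => (h g j *m pinvmx D) 0 a).
    by apply/funext => g; rewrite mxE.
  by apply: mx_continuous_mul => //; exact: mx_continuous_cst.
move=> xi xi0.
(* Vanishing against the whole orbit passes from [u] to (f(l) - 1) u, because f(g) f(l) = f(g l). *)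
have tau0 t : t \in tau -> forall g, xi *m val (f g) *m t = 0.
  apply: (orbit_words_ind (P := fun t => forall g, xi *m val (f g) *m t = 0)) => //.
  move=> l u _ u0 g; rewrite mulmxBl mul1mx mulmxBr u0 subr0 mulmxA.
  have := u0 (g * l)%g; rewrite gmulfM => E; rewrite -[RHS]E; congr (_ *m _).
  by rewrite -mulmxA.
apply/matrixP => e j; have := colT j => /Vspan [d dE].
have : xi *m col j T = 0.
  rewrite dE mulmx_sumr big1 // => p _; rewrite -scalemxAr.
  by have := tau0 _ (ttau p) 1%g; rewrite mult1 mulmx1 => ->; rewrite scaler0.
by rewrite colE mulmxA -colE => /matrixP/(_ e 0); rewrite !mxE.
Qed.

(** Cancelling [T] on the left transfers identities from [f] to [lam]: multiplicativity, and the
    vanishing of products of [m] matrices lam(g) - 1. The latter triangularizes [lam] over [k], and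
    the change of basis goes into [T] and [v]. *)
Lemma finite_coefficients : exists N (lam : {multiplicative G -> ut_of N k})
    (T : 'M[K]_(m, N)) (v : 'cV[k]_N),
  [/\ mx_continuous (fun g => val (lam g)),
      forall g, val (f g) *m T = T *m map_mx i (val (lam g)),
      T *m map_mx i v = w
    & forall xi : 'rV[K]_m, (forall g, xi *m val (f g) *m w = 0) -> xi *m T = 0].
Proof.
have [N [lam [T [v [lc TI fT Tv Txi]]]]] := finite_coefficients_mx.
have lamM g h : lam (g * h)%g = lam g *m lam h.
  apply: TI; rewrite -fT gmulfM map_mxM (mulmxA T) -fT -(mulmxA (val (f g)) T) -fT.
  by rewrite mulmxA.
have lam1 : lam 1%g = 1%:M.
  by apply: TI; rewrite -fT mult1 mul1mx map_mx1 mulmx1.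
have aug0 s : size s = m -> aug_prod lam s = 0.
  move=> sm; apply: TI; rewrite map_mx0 mulmx0.
  have -> : T *m map_mx i (aug_prod lam s) = aug_prod (fun g => val (f g)) s *m T.
    elim: s {sm} => [|g s IH] /=; first by rewrite map_mx1 mulmx1 mul1mx.
    have E : T *m map_mx i (lam g - 1%:M) = (val (f g) - 1%:M) *m T.
      by rewrite map_mxB map_mx1 mulmxBr mulmx1 -fT mulmxBl mul1mx.
    transitivity ((val (f g) - 1%:M) *m (T *m map_mx i (aug_prod lam s))).
      by rewrite mulmxA -E -mulmxA -map_mxM.
    by rewrite IH mulmxA.
  have := nilp_aug_prod (r := fun g => val (f g)) (n := m) (C := 1%:M) _ _ _ sm.
  rewrite mulmx1 => ->; rewrite ?mul0mx ?mult1 //.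
    by move=> g h; rewrite gmulfM.
  move=> a b; have fM g h : val (f (g * h)%g) = val (f g) *m val (f h) by rewrite gmulfM.
  have U := nilp_unitriangular fM (fun g => valP (f g)) a b.
  by apply: nilp_ext U => g; rewrite mulmx1.
have [|c [c' [cc' c'c cS]]] := @nilpotent_triangularizable k N
    (fun M => exists g, M = lam g - 1%:M) m.
  move=> s sm sS; have [t ts] : exists t, s = map (fun g => lam g - 1%:M) t.
    elim: s sS {sm} => [|M s IH] sS; first by exists [::].
    have [g ->] := sS M (mem_head _ _).
    have [|t ->] := IH; first by move=> M' sM'; apply: sS; rewrite inE sM' orbT.
    by exists (g :: t).
  have tm : size t = m by rewrite -sm ts size_map.
  by rewrite -(aug0 t tm) ts; elim: t {ts tm} => //= g t ->.
pose mu g := c *m lam g *m c'.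
have muU g : mu g \in @unitriangular N k.
  apply/unitriangularP => a b ba; have := cS _ (ex_intro _ g erefl) a b ba.
  have -> : c *m (lam g - 1%:M) *m c' = mu g - 1%:M by rewrite mulmxBr mulmxBl mulmx1 cc'.
  by move: (mu g) => M; rewrite !mxE => /eqP; rewrite subr_eq0 => /eqP.
pose nu g : ut_of N k := exist _ (mu g) (muU g).
have nuM : {morph nu : g h / (g * h)%g}.
  move=> g h; apply: val_inj; transitivity (mu g *m mu h) => //.
  by rewrite /= /mu lamM !mulmxA -(mulmxA _ c' c) c'c mulmx1.
pose nuX := isMultiplicative.Build G (ut_of N k) nu nuM.
exists N, (HB.pack_for {multiplicative G -> ut_of N k} nu nuX), (T *m map_mx i c'), (c *m v).
have E : map_mx i c' *m map_mx i c = 1%:M by rewrite -map_mxM c'c map_mx1.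
split.
- rewrite /= /mu; apply: mx_continuous_mul; last exact: mx_continuous_cst.
  by apply: mx_continuous_mul => //; exact: mx_continuous_cst.
- move=> g; rewrite /= /mu !map_mxM !mulmxA fT.
  by rewrite -[Y in _ = Y *m _ *m _]mulmxA E mulmx1.
- by rewrite map_mxM mulmxA -[Y in Y *m _]mulmxA E mulmx1.
- by move=> xi /Txi E0; rewrite mulmxA E0 mul0mx.
Qed.

End FiniteCoefficients.

(** * The pair of k with itself *)

Section TrivialPair.
Variables (k : topFieldType).
Hypothesis k_haus : hausdorff_space k.

Lemma id_top_embedding : top_embedding (idfun : k -> k).
Proof.
split=> // A; split=> [Ao|[B Bo ->] //]; by exists A.
Qed.

Lemma id_closed : closed (range (idfun : {rmorphism k -> k})).
Proof.
suff -> : range (idfun : {rmorphism k -> k}) = setT by exact: closedT.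
by apply/seteqP; split=> // z _; exists z.
Qed.

Definition trivial_subfield : closed_subfield k k :=
  ClosedSubfield id_top_embedding id_closed.

Let V := subfield_vect trivial_subfield.

Definition line_map (v : 'rV[k]_1) : tv_module V := v 0 0.
Fact line_map_linear : linear line_map.
Proof. by move=> c u v; rewrite /line_map !mxE. Qed.
HB.instance Definition _ := GRing.isLinear.Build k 'rV[k]_1 (tv_module V) *:%R line_map
  line_map_linear.

(** A subspace of [k] is 0 or [k], with coordinates in k^0 or k^1. This provides the case K = k of
    [finite_coefficients]. *)
Lemma trivial_weakly_cartesian : weakly_cartesian_pair trivial_subfield.
Proof.
move=> W [n [u WE]].
have [u0|[p up]] : (forall p, u p = 0) \/ exists p, u p != 0.
  have [?|no] := pselect (exists p, u p != 0); [by right | left => p].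
  by apply/eqP/negPn/negP => up; apply: no; exists p.
  have {}WE : W = [set 0].
    rewrite WE; apply/seteqP; split=> [_ [c _ <-]|_ ->] /=.
      by rewrite big1 // => p _; rewrite u0 scaler0.
    by exists 0 => //; rewrite big1 // => p _; rewrite u0 scaler0.
  split; first by rewrite WE; exact/accessible_closed_set1/hausdorff_accessible.
  exists 0%N, (\0 : {linear 'rV[k]_0 -> tv_module V}); split.
    rewrite WE; apply/seteqP; split=> [_ [c _ <-] //|_ ->] /=.
    by exists 0.
  split=> [v v' _|A]; first by rewrite (thinmx0 v) (thinmx0 v').
  split=> [Ao|[B Bo ->]]; last first.
    by apply: open_comp => // v _; exact: (@continuous_cst _ k (0 : k)).
  have [A0|A0] := pselect (A 0).
    exists setT; first exact: openT.
    by apply/seteqP; split=> // v _; rewrite (thinmx0 v).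
  exists set0; first exact: open0.
  by apply/seteqP; split=> // v; rewrite (thinmx0 v).
have {}WE : W = setT.
  rewrite WE; apply/seteqP; split=> // z _; exists (((z : k) / (u p : k)) *: delta_mx 0 p) => //.
  rewrite (bigD1 p) //= big1 => [|j jp].
    rewrite !mxE !eqxx mulr1 addr0; exact: divfK.
  by rewrite !mxE (negbTE jp) andbF mulr0 scale0r.
split; first by rewrite WE; exact: closedT.
exists 1%N, (line_map : {linear 'rV[k]_1 -> tv_module V}); split.
  by rewrite WE; apply/seteqP; split=> // z _; exists (const_mx (z : k)) => //=;
    rewrite /line_map mxE.
have cK (v : 'rV[k]_1) : const_mx (v 0 0) = v.
  by apply/matrixP => a b; rewrite mxE (ord1 a) (ord1 b).
split=> [v v' vv'|A]; first by rewrite -(cK v) -(cK v'); congr const_mx.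
split=> [Ao|[B Bo ->]]; last by apply: open_comp => // v _; exact: continuous_entry.
exists [set z | A (const_mx z)]; last by apply/seteqP; split=> v /=; rewrite /line_map cK.
apply: (open_comp (f := fun z : k => const_mx z : 'rV[k]_1)) => // z _.
apply: mx_continuousP => a b; under eq_fun do rewrite mxE.
by move=> t; exact: cvg_id.
Qed.
End TrivialPair.

(** * Mal'cev completions *)

Lemma ev_coef (F : fieldType) (U : group_functor F) (A R : comAlgType F) (x : U A)
    (rx : represents x) n (f : group_hom U (UT n F)) (g : U R) (xi : 'rV[F]_n) (w : 'cV[F]_n) :
  ev rx g ((scal_mx A xi *m val (f A x) *m scal_mx A w) 0 0) =
  (scal_mx R xi *m val (f R g) *m scal_mx R w) 0 0.
Proof.
have -> : val (f R g) = map_mx (ev rx g) (val (f A x)).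
  by apply/matrixP => i j; rewrite [RHS]mxE ev_ut.
by rewrite -!(map_scal_mx (ev rx g)) -!map_mxM [RHS]mxE.
Qed.

Lemma scal_mx_id (F : fieldType) m n (c : 'M[F]_(m, n)) : scal_mx F^o c = c.
Proof. by apply/matrixP => i j; rewrite mxE; exact: mulr1. Qed.

Section TwistedSum.
Variables (F : fieldType) (M : group_functor F) (m n : nat).
Variables (rho : group_hom M (UT m F)) (sig : group_hom M (UT n F)) (T : 'M[F]_(m, n)).

(** The block diagonal matrix of [rho] and [sig] conjugated by the block unipotent matrix of [T].
    Its upper right block measures the failure of [T] to intertwine them. *)
Definition twist_mx (R : comAlgType F) (g : M R) : 'M[R]_(m + n) :=
  block_mx (val (rho R g)) (val (rho R g) *m scal_mx R T - scal_mx R T *m val (sig R g))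
    0 (val (sig R g)).

Lemma twist_mx_ut R (g : M R) : twist_mx g \in @unitriangular (m + n) R.
Proof.
apply/unitriangularP => i j; rewrite /twist_mx.
case: (split_ordP i) => a ->; case: (split_ordP j) => b -> ji.
- by rewrite block_mxEul; have /unitriangularP -> // := valP (rho R g); rewrite eq_lshift.
- by move: ji; rewrite /= leqNgt (leq_trans (ltn_ord a)) ?leq_addr.
- by rewrite block_mxEdl mxE eq_rlshift.
- rewrite block_mxEdr; have /unitriangularP -> // := valP (sig R g).
    by rewrite eq_rshift.
  by rewrite /= leq_add2l in ji.
Qed.

Definition twist_fun (R : comAlgType F) (g : M R) : UT (m + n) F R :=
  (exist _ (twist_mx g) (twist_mx_ut g) : ut_of (m + n) R).

Fact twist_funM R : {morph @twist_fun R : g h / (g * h)%g}.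
Proof.
move=> g h; apply: val_inj; transitivity (twist_mx g *m twist_mx h) => //=.
rewrite /twist_mx mulmx_block !mulmx0 !mul0mx !addr0 add0r !gmulfM.
congr (block_mx _ _ _ _).
by rewrite mulmxBr mulmxBl !mulmxA addrA subrK.
Qed.
HB.instance Definition _ R := isMultiplicative.Build (M R) (UT (m + n) F R)
  (@twist_fun R) (@twist_funM R).

Fact twist_natural (R S : comAlgType F) (f : {lrmorphism R -> S}) (g : M R) :
  twist_fun (pmap M f g) = pmap (UT (m + n) F) f (twist_fun g).
Proof.
apply: val_inj; rewrite /= /twist_mx map_block_mx map_mx0 map_mxB !map_mxM !map_scal_mx.
by rewrite !hom_natural.
Qed.

Definition twist : group_hom M (UT (m + n) F) :=
  @GroupHom F M (UT (m + n) F) twist_fun twist_natural.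

Lemma twistE R (g : M R) : val (twist R g) = twist_mx g.
Proof. by []. Qed.

End TwistedSum.

Section MalcevCompletion.
Variables (G : topGroupType) (F : topFieldType) (M : group_functor F).
Variable eta : {multiplicative G -> rat_points M}.
Hypothesis F0 : [pchar F] =i pred0.
Hypothesis Mm : is_malcev_completion eta.

Section OnUnitriangular.
Variables (n : nat) (lam : {multiplicative G -> ut_of n F}).
Hypothesis lamc : mx_continuous (fun g => val (lam g)).

Definition ut_rat (g : G) : rat_points (UT n F) := lam g.
Fact ut_ratM : {morph ut_rat : g h / (g * h)%g}.
Proof. by move=> g h; rewrite /ut_rat gmulfM. Qed.
HB.instance Definition _ := isMultiplicative.Build G (rat_points (UT n F)) ut_rat ut_ratM.

Lemma ut_rat_continuous : continuous ut_rat.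
Proof.
have [C [z rz]] := UT_affine F n.
apply: (continuous_of_coordinates (rx := rz) F0 (UT_pro_unipotent F n)) => c.
have gc := ut_gen rz c.
apply: (gc (fun c => continuous (fun t => ev rz (ut_rat t : UT n F F^o) c : F))).
  exact: (subalg_continuous (fun t => ev rz (ut_rat t : UT n F F^o))).
move=> _ [i [j ->]].
have -> : (fun t => ev rz (ut_rat t : UT n F F^o) (val z i j) : F) = fun t => val (lam t) i j.
  by apply/funext => t; rewrite -[RHS]/(val (ut_rat t) i j) -{2}(pmap_ev rz (ut_rat t)) mxE.
exact: lamc.
Qed.

Lemma malcev_ut_extends : exists Lam : group_hom M (UT n F),
  forall g, val (Lam F^o (eta g)) = val (lam g).
Proof.
have [_ _ Mu] := Mm.
have [Lam LamE _] := Mu _ ut_rat (UT_pro_unipotent F n) (@ut_rat_continuous).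
by exists Lam => g; rewrite LamE.
Qed.

End OnUnitriangular.

Section Restriction.
Variables (n : nat) (rho : group_hom M (UT n F)).

Definition malcev_restr (g : G) : ut_of n F := rho F^o (eta g).
Fact malcev_restrM : {morph malcev_restr : g h / (g * h)%g}.
Proof.
move=> g h; rewrite /malcev_restr gmulfM; apply: val_inj.
have E : rho F^o ((eta g : M F^o) * (eta h : M F^o))%g =
    (rho F^o (eta g) * rho F^o (eta h))%g by rewrite gmulfM.
exact: (congr1 val E).
Qed.
HB.instance Definition _ := isMultiplicative.Build G (ut_of n F) malcev_restr malcev_restrM.

Lemma malcev_restr_continuous : mx_continuous (fun g => val (malcev_restr g)).
Proof.
have [Mp ec _] := Mm; have [[A [x rx]] _] := Mp; move=> i j.
have -> : (fun g => val (malcev_restr g) i j) =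
    fun g => ev rx (eta g : M F^o) (val (rho A x) i j).
  by apply/funext => g; rewrite ev_ut.
exact: (coordinates_continuous (rx := rx) F0 Mp).
Qed.
End Restriction.

Lemma malcev_ut_uniq n (rho sig : group_hom M (UT n F)) :
  (forall g, rho F^o (eta g) = sig F^o (eta g)) -> forall R, rho R =1 sig R.
Proof.
move=> rs; have [_ _ Mu] := Mm.
have [phi _ phiu] := Mu _ (ut_rat (malcev_restr rho)) (UT_pro_unipotent F n)
  (@ut_rat_continuous n _ (@malcev_restr_continuous n rho)).
move=> R g; rewrite (phiu rho) ?(phiu sig) // => t.
by rewrite -rs.
Qed.

(* Conjugating [rho (+) sig] by [1 + T] gives a second homomorphism to the
   unitriangular group, which agrees with [rho (+) sig] on the image of [G] as
   soon as [T] intertwines [rho] and [sig] there. *)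
Lemma malcev_intertwine m n (rho : group_hom M (UT m F)) (sig : group_hom M (UT n F))
    (T : 'M[F]_(m, n)) :
  (forall g, val (rho F^o (eta g)) *m T = T *m val (sig F^o (eta g))) ->
  forall R (g : M R), val (rho R g) *m scal_mx R T = scal_mx R T *m val (sig R g).
Proof.
move=> TG R g; have E : forall t, twist rho sig T F^o (eta t) = twist rho sig 0 F^o (eta t).
  move=> t; apply: val_inj; rewrite !twistE /twist_mx !scal_mx_id TG.
  by rewrite mulmx0 mul0mx !subrr.
have := congr1 val (malcev_ut_uniq E g).
rewrite !twistE /twist_mx => /eq_block_mx [_ /eqP + _ _].
rewrite /scal_mx map_mx0 mulmx0 mul0mx subrr subr_eq0 => /eqP; exact.
Qed.

(** Write a = xi rho w with w = T v. Vanishing on [G] gives xi T = 0, and intertwining gives a = xi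
    rho T v = xi T Lam v = 0. *)
Lemma malcev_dense (A : comAlgType F) (x : M A) (rx : represents x) a :
  topologically_fin_gen G -> hausdorff_space F ->
  (forall g, ev rx (eta g : M F^o) a = 0) -> a = 0.
Proof.
move=> Gfg F_haus a0; have [Mp _ _] := Mm.
have [n [rho [xi [w aE]]]] := ut_coef rx a (pro_unipotent_generated rx Mp).
have [N [lam [T [v [lc fT Tv Txi]]]]] := finite_coefficients Gfg F_haus
  (trivial_weakly_cartesian F_haus) (@malcev_restr_continuous n rho) w.
have [Lam LamE] := malcev_ut_extends lc.
have map_id p q (P : 'M[F]_(p, q)) : map_mx (trivial_subfield F) P = P.
  by apply/matrixP => i j; rewrite mxE.
have TL : forall R (g : M R), val (rho R g) *m scal_mx R T = scal_mx R T *m val (Lam R g).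
  by apply: malcev_intertwine => g; rewrite LamE; have := fT g; rewrite map_id.
have {}Txi : xi *m T = 0.
  apply: Txi => g; apply/matrixP => i j; rewrite (ord1 i) (ord1 j) [RHS]mxE -(a0 g) aE.
  by rewrite (ev_coef rx) !scal_mx_id.
rewrite aE -Tv map_id scal_mxM !mulmxA -(mulmxA (scal_mx A xi)) TL mulmxA -scal_mxM Txi.
by rewrite /scal_mx map_mx0 !mul0mx mxE.
Qed.

End MalcevCompletion.

(** * The comparison map *)

Section Inverse.
Variables (F : fieldType) (A B : comAlgType F) (f : {lrmorphism A -> B}).
Hypotheses (f_inj : injective f) (f_surj : forall b, exists a, f a = b).

Definition lr_inv (b : B) : A := projT1 (cid (f_surj b)).
Lemma lr_invK b : f (lr_inv b) = b.
Proof. exact: (projT2 (cid (f_surj b))). Qed.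

Fact lr_inv_linear : linear lr_inv.
Proof. by move=> c a b; apply: f_inj; rewrite linearP /= !lr_invK. Qed.
Fact lr_inv_multiplicative : monoid_morphism lr_inv.
Proof.
by split=> [|a b]; apply: f_inj; rewrite ?rmorph1 ?rmorphM /= !lr_invK.
Qed.
HB.instance Definition _ := GRing.isLinear.Build F B A *:%R lr_inv lr_inv_linear.
HB.instance Definition _ := GRing.isMonoidMorphism.Build B A lr_inv lr_inv_multiplicative.

Lemma lrmorphism_inverse : exists g : {lrmorphism B -> A}, forall b, f (g b) = b.
Proof. by exists lr_inv; exact: lr_invK. Qed.

End Inverse.

Lemma group_iso_of_bijective_comorphism (F : fieldType) (U V : group_functor F)
    (f : group_hom U V) (A B : comAlgType F) (x : U A) (y : V B)
    (rx : represents x) (ry : represents y) :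
  injective (ev ry (f A x)) -> (forall a, exists b, ev ry (f A x) b = a) -> is_group_iso f.
Proof.
move=> phi_inj phi_surj R.
have evf (g : U R) b : ev ry (f R g) b = ev rx g (ev ry (f A x) b) by exact: ev_hom.
have [h hK] := lrmorphism_inverse phi_inj phi_surj.
exists (fun p : V R => pmap U (ev ry p \o h : {lrmorphism A -> R}) x).
  move=> g; apply: (ev_inj (rx := rx)) => a; have [b <-] := phi_surj a.
  by rewrite ev_pmap ev_id /= evf hK.
move=> p; apply: (ev_inj (rx := ry)) => b.
rewrite evf ev_pmap ev_id /=; congr (ev ry p _).
by apply: phi_inj; rewrite hK.
Qed.

Section BaseChangeMap.
Variables (G : topGroupType) (k K : topFieldType) (i : closed_subfield k K).
Hypotheses (k0 : [pchar k] =i pred0) (K0 : [pchar K] =i pred0).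
Variables (Gk : group_functor k) (eta_k : {multiplicative G -> rat_points Gk}).
Hypothesis Gk_malcev : is_malcev_completion eta_k.
Variables (A : comAlgType k) (x : Gk A) (rx : represents x).

Definition bc_eta (g : G) : rat_points (base_change i Gk) := base_change_point i (eta_k g).

Fact bc_etaM : {morph bc_eta : g h / (g * h)%g}.
Proof.
move=> g h; rewrite /bc_eta gmulfM.
exact: (@gmulfM _ _ (pmap Gk (restr_unit_hom i)) (eta_k g) (eta_k h)).
Qed.
HB.instance Definition _ := isMultiplicative.Build G (rat_points (base_change i Gk))
  bc_eta bc_etaM.

Lemma bc_eta_coordinate g a :
  ev (bc_represents (i := i) rx) (bc_eta g : base_change i Gk K^o) (bc_inr i a) =
  i (ev rx (eta_k g : Gk k^o) a).
Proof. by rewrite ev_bc /bc_eta /base_change_point ev_pmap. Qed.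

Lemma bc_pro_unipotent : pro_unipotent (base_change i Gk).
Proof.
have [Mp _ _] := Gk_malcev.
apply: (ut_generated_pro_unipotent (bc_represents (i := i) rx)).
apply: bc_ut_generated; exact: (pro_unipotent_generated rx Mp).
Qed.

Lemma bc_eta_continuous : continuous bc_eta.
Proof.
have [Mp ec _] := Gk_malcev.
apply: (continuous_of_coordinates (rx := bc_represents (i := i) rx) K0 bc_pro_unipotent) => t.
have [s ->] := bc_algP t.
have -> : (fun g => ev (bc_represents (i := i) rx) (bc_eta g : base_change i Gk K^o)
      (\sum_(p <- s) p.1 *: (bc_inr i p.2 : bc_alg i A)) : K) =
    fun g => \sum_(p <- s) p.1 * i (ev rx (eta_k g : Gk k^o) p.2).
  apply/funext => g; rewrite linear_sum; apply: eq_bigr => p _.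
  by rewrite linearZ /= bc_eta_coordinate.
apply: continuous_sum => p; apply: continuous_mul; first exact: continuous_cst.
move=> g; apply: (@continuous_comp _ _ _ (fun g => ev rx (eta_k g : Gk k^o) p.2 : k) i).
  exact: (coordinates_continuous (rx := rx) k0 Mp).
exact: subfield_continuous.
Qed.

Hypotheses (Gfg : topologically_fin_gen G) (k_haus : hausdorff_space k).
Variables (GK : group_functor K) (eta_K : {multiplicative G -> rat_points GK}).
Hypothesis GK_malcev : is_malcev_completion eta_K.
Variables (B : comAlgType K) (y : GK B) (ry : represents y).
Variable Phi : group_hom GK (base_change i Gk).
Hypothesis PhiE : forall g : G, Phi K^o (eta_K g) = base_change_point i (eta_k g).

Local Notation phi := (ev (bc_represents (i := i) rx) (Phi B y)).

Lemma bc_comorphism_inj : injective phi.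
Proof.
apply: raddf_inj => t; have [s ->] := bc_algP t => phi0.
have ev0 g : \sum_(p <- s) p.1 * i (ev rx (eta_k g : Gk k^o) p.2) = 0.
  have := congr1 (ev ry (eta_K g : GK K^o)) phi0.
  rewrite linear0 -(ev_hom Phi ry (bc_represents (i := i) rx)) PhiE linear_sum => E.
  rewrite -[RHS]E; apply: eq_bigr => p _.
  by rewrite linearZ /= (bc_eta_coordinate g).
have [n [e [f [_ fe _]]]] := dual_basis [seq (p.1 : restr i K^o) | p <- s].
(* The functional [f j] is [k]-linear, so applied to [ev0 g] it shows that this element of [A]
   vanishes on [G]. *)
have f0 j : \sum_(p <- s) f j p.1 *: p.2 = 0 :> A.
  apply: (malcev_dense (rx := rx) k0 Gk_malcev Gfg k_haus) => g.
  have := congr1 (f j) (ev0 g); rewrite linear0 linear_sum => E.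
  rewrite linear_sum -[RHS]E; apply: eq_bigr => p _; rewrite linearZ /=.
  transitivity (f j ((ev rx (eta_k g : Gk k^o) p.2 : k) *: (p.1 : restr i K^o))).
    by rewrite linearZ; exact: mulrC.
  by congr (f j _); exact: mulrC.
rewrite (eq_big_seq (fun p => \sum_j (e j : K) *: (bc_inr i (f j p.1 *: p.2) : bc_alg i A))).
  rewrite exchange_big big1 // => j _; rewrite -scaler_sumr.
  have -> : \sum_(p <- s) (bc_inr i (f j p.1 *: p.2) : bc_alg i A) =
      bc_inr i (\sum_(p <- s) f j p.1 *: p.2) by rewrite linear_sum.
  by rewrite f0 linear0 scaler0.
move=> p ps; rewrite {1}(fe p.1 _); last by apply/mapP; exists p.
rewrite scaler_suml; apply: eq_bigr => j _.
rewrite [in RHS]linearZ /= [X in _ = _ *: X](_ : _ = i (f j p.1) *: (bc_inr i p.2 : bc_alg i A)) //.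
by rewrite scalerA mulrC.
Qed.

Hypothesis kK_wc : weakly_cartesian_pair i.

Lemma bc_comorphism_surj b : exists t, phi t = b.
Proof.
have [MKp _ _] := GK_malcev.
have [n [rho [xi [w bE]]]] := ut_coef ry b (pro_unipotent_generated ry MKp).
have [N [lam [T [v [lc fT Tv _]]]]] := finite_coefficients Gfg k_haus kK_wc
  (@malcev_restr_continuous G K GK eta_K K0 GK_malcev n rho) w.
have [Lam LamE] := malcev_ut_extends k0 Gk_malcev lc.
(* The representation of [GK] obtained by base change from [Lam]; on [G] it is the image of [lam]
   under [i]. *)
pose sig := hom_comp (bc_ut i Lam) Phi.
have sigE g : val (sig K^o (eta_K g)) = map_mx i (val (lam g)).
  rewrite -LamE /= PhiE /bc_ut_fun /base_change_point hom_natural.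
  by apply/matrixP => a c; rewrite !mxE.
have TL := malcev_intertwine K0 GK_malcev (rho := rho) (sig := sig) (T := T).
have {TL} TL : forall R (g : GK R), val (rho R g) *m scal_mx R T = scal_mx R T *m val (sig R g).
  by apply: TL => g; rewrite sigE; exact: fT.
have Ssub := subalg_lin (subalg_image phi (subalgT _)).
suff [t _ <-] : exists2 t, True & phi t = b by exists t.
(* Now b = xi rho T v = (xi T) sig v is a [K]-combination of entries of [sig], each of which lies in
   the image of [phi]. *)
rewrite bE -Tv scal_mxM !mulmxA -(mulmxA (scal_mx B xi)) TL mulmxA -scal_mxM mxE.
apply: (lin_closed_sum _ Ssub) => j _; rewrite mxE mulr_suml.
apply: (lin_closed_sum _ Ssub) => a _.
rewrite [scal_mx _ _ _ _]mxE [scal_mx _ _ j 0]mxE /= -scalerAr -scalerAl mul1r mulr1.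
do 2!apply: (lin_closedZ _ Ssub).
exists (val (bc_ut i Lam (bc_alg i A) (bc_point i x)) a j) => //.
exact: (ev_ut (bc_represents (i := i) rx) (bc_ut i Lam)).
Qed.

End BaseChangeMap.

Theorem proposition1p6 (G : topGroupType) (k K : topFieldType)
    (i : closed_subfield k K)
    (Gfg : topologically_fin_gen G)
    (k_haus : hausdorff_space k) (K_haus : hausdorff_space K)
    (k_char0 : [pchar k] =i pred0) (K_char0 : [pchar K] =i pred0)
    (kK_wc : weakly_cartesian_pair i)
    (k_straight : straight k)
    (Gk : group_functor k) (eta_k : {multiplicative G -> rat_points Gk})
    (Gk_malcev : is_malcev_completion eta_k)
    (GK : group_functor K) (eta_K : {multiplicative G -> rat_points GK})
    (GK_malcev : is_malcev_completion eta_K) :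
  pro_unipotent (base_change i Gk) /\
  exists Phi : group_hom GK (base_change i Gk),
    [/\ is_group_iso Phi,
        forall x : G, Phi K^o (eta_K x) = base_change_point i (eta_k x)
      & forall Psi : group_hom GK (base_change i Gk),
          (forall x : G, Psi K^o (eta_K x) = base_change_point i (eta_k x)) ->
          forall R : comAlgType K, Psi R =1 Phi R].

Proof.
have [[[A [x rx]] _] _ _] := Gk_malcev; have [[[B [y ry]] _] _ MKu] := GK_malcev.
have bcp := bc_pro_unipotent i Gk_malcev rx.
split=> //.
have [Phi PhiE Phiu] := MKu _ (bc_eta i eta_k) bcp
  (@bc_eta_continuous _ _ _ i k_char0 K_char0 _ _ Gk_malcev _ _ rx).
exists Phi; split=> [||Psi PsiE]; [|exact: PhiE|exact: Phiu].
apply: (group_iso_of_bijective_comorphism ry (ry := bc_represents (i := i) rx)).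
  exact: (bc_comorphism_inj k_char0 Gk_malcev Gfg k_haus ry PhiE).
exact: (bc_comorphism_surj k_char0 K_char0 Gk_malcev rx Gfg k_haus GK_malcev ry PhiE kK_wc).
Qed.
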